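(* Let $\Omega\subset\mathbb{R}^d$, $d\in\{2,3\}$, be a bounded polyhedral domain, $\mathbb{T}_h$ a conformal simplicial mesh of $\overline\Omega$, and let $\beta>0$ be a constant such that $$\inf_{q\in Q}\sup_{\psi\in V}\frac{b(\psi,q)}{|\psi|_{H^1(\Omega)^d}\|q\|_{L^2(\Omega)}}\ge\beta .$$ Then the nonconforming Stokes element of type $V_{dc,h}^{CR}\times Q_h^0$ satisfies the uniform inf-sup stability condition $$\inf_{q_h\in Q_h^0}\ \sup_{v_h\in V_{dc,h}^{CR}}\frac{b_h(v_h,q_h)}{|v_h|_{V_{dc,h}^{CR}}\,\|q_h\|_{Q_h^0}}\ \ge\ \beta_*:=\beta .$$
   Context: Infima and suprema are over nonzero elements. $V=H_0^1(\Omega)^d$, $Q=L_0^2(\Omega)=\{q\in L^2(\Omega):\int_\Omega q\,dx=0\}$, $b(\psi,q)=-\int_\Omega\operatorname{div}\psi\,q\,dx$. Mesh: $\mathbb{T}_h$ consists of closed $d$-simplices without hanging nodes, $h=\max_{T\in\mathbb{T}_h}\operatorname{diam}T$. $\mathcal{F}_h^i$, $\mathcal{F}_h^\partial$ are the sets of interior and boundary faces, $\mathcal{F}_h$ their union. For $F=T_1\cap T_2\in\mathcal{F}_h^i$, $[\![\varphi]\!]=\varphi|_{T_1}-\varphi|_{T_2}$ on $F$; for $F\in\mathcal{F}_h^\partial$, $[\![\varphi]\!]=\varphi$. $\Pi_F^0$ is the $L^2(F)$-projection onto constants on $F$; $\operatorname{div}_h$ is the elementwise divergence. $\ell_{T,F}=d!\,|T|_d/|F|_{d-1}$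 for a face $F$ of $T$ ($|\cdot|_k$ the $k$-dimensional Hausdorff measure). Penalty: $\kappa_F=h^{-2}(\sqrt{\ell_{T_1,F}}+\sqrt{\ell_{T_2,F}})^{-2}$ for $F=T_1\cap T_2\in\mathcal{F}_h^i$; $\kappa_F=h^{-2}\ell_{T_\partial,F}^{-1}$ for $F=\partial T_\partial\cap\partial\Omega\in\mathcal{F}_h^\partial$. Spaces: $X_{dc,h}^{CR}$ is the discontinuous Crouzeix–Raviart space, i.e. the span of the functions equal on one $T\in\mathbb{T}_h$ to $d(\frac1d-\lambda_{T,i})$, $1\le i\le d+1$ ($\lambda_{T,i}$ the barycentric coordinates of $T$), and zero elsewhere; $V_{dc,h}^{CR}=(X_{dc,h}^{CR})^d$ with norm $|v|_{V_{dc,h}^{CR}}^2=\sum_{i=1}^d\big(\sum_{T\in\mathbb{T}_h}|v_i|_{H^1(T)}^2+\sum_{F\in\mathcal{F}_h}\kappa_F\|\Pi_F^0[\![v_i]\!]\|_{L^2(F)}^2\big)$. $Q_h^0$ is the set of functions in $Q$ that are constant on each $T\in\mathbb{T}_h$, with norm $\|q_h\|_{Q_h^0}=\|q_h\|_{L^2(\Omega)}$. $b_h(v_h,q_h)=-\int_\Omega\operatorname{div}_hv_h\,q_h\,dx$. *)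

(* Defs.v *)
(* Functions on R^d are functions on 'rV[R]_d with R : realType; functions defined on a subset of R^d are total functions
   looked at on that subset only.  An element of an L2-type space is
   represented by any of its representatives. *)
From HB Require Import structures.
From mathcomp Require Import all_boot all_order all_algebra.
From mathcomp Require Import all_classical all_reals all_analysis.

Set Implicit Arguments.
Unset Strict Implicit.
Unset Printing Implicit Defensive.

Import Order.TTheory GRing.Theory Num.Theory.
Import numFieldNormedType.Exports.

Local Open Scope classical_set_scope.
Local Open Scope ring_scope.

(* sigma-algebra on R^n generated by the coordinates, i.e. the Borel sets *)
Definition rV_display : measure_display.
Proof. exact: (measure_tuple_display default_measure_display). Qed.

Section measurable_rV.
Context (R : realType) (n : nat).

Let coord (i : 'I_n) (x : 'rV[R]_n) : R := x ord0 i.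

Let rV_set0 : g_sigma_preimage coord set0.
Proof. exact: sigma_algebra0. Qed.

Let rV_setC A : g_sigma_preimage coord A -> g_sigma_preimage coord (~` A).
Proof. exact: sigma_algebraC. Qed.

Let rV_bigcup (F : _^nat) : (forall i, g_sigma_preimage coord (F i)) ->
  g_sigma_preimage coord (\bigcup_i (F i)).
Proof. exact: sigma_algebra_bigcup. Qed.

HB.instance Definition _ := @isMeasurable.Build rV_display
  'rV[R]_n (g_sigma_preimage coord) rV_set0 rV_setC rV_bigcup.

Lemma measurable_coord_rV (i : 'I_n) :
  measurable_fun [set: 'rV[R]_n] (fun x => x ord0 i).
Proof.
move=> _ Y mY; rewrite setTI; apply: sub_sigma_algebra => /=.
rewrite -bigcup_seq/=; exists i => /=; first by rewrite mem_index_enum.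
by exists Y => //; rewrite setTI.
Qed.

Lemma measurable_fun_rVP d (T : measurableType d) (f : T -> 'rV[R]_n) :
  (forall i, measurable_fun [set: T] (fun x => f x ord0 i)) ->
  measurable_fun [set: T] f.
Proof.
move=> mf _ A mA; rewrite setTI.
pose G := [set B : set 'rV[R]_n | measurable (f @^-1` B)].
suff : <<s \big[setU/set0]_(i < n)
   preimage_set_system setT (coord i) measurable >> `<=` G by apply.
apply: smallest_sub.
  split; first by rewrite /G /= preimage_set0.
  - by move=> B mB; rewrite /G /= setTD preimage_setC; exact: measurableC.
  - by move=> F mF; rewrite /G /= preimage_bigcup; apply: bigcup_measurable => k _; exact: mF.
rewrite -bigcup_seq => B [i /= _] [C mC <-].
by rewrite /G /= setTI -comp_preimage -[X in measurable X]setTI; exact: mf.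
Qed.

End measurable_rV.

(* Lebesgue measure on R^n, by iterated products along the bijection
   R * R^n -> R^(n+1) *)
Section lebesgue_rV.
Context (R : realType).

Definition consrV n (p : measurableTypeR R * 'rV[R]_n) : 'rV[R]_n.+1 := row_mx p.1%:M p.2.

Lemma measurable_consrV n : measurable_fun setT (@consrV n).
Proof.
apply: measurable_fun_rVP => i.
case: (split_ordP (i : 'I_(1 + n))) => j ->.
- rewrite (_ : (fun _ => _) = fst); last first.
    apply/funext => p; rewrite [LHS](row_mxEl p.1%:M p.2 ord0 j).
    by rewrite mxE (ord1 j).
  exact: measurable_fst.
- rewrite (_ : (fun _ => _) = (fun x : 'rV[R]_n => x ord0 j) \o snd); last first.
    by apply/funext => p; exact: (row_mxEr p.1%:M p.2 ord0 j).
  apply: measurableT_comp; last exact: measurable_snd.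
  exact: measurable_coord_rV.
Qed.

Lemma measurable_unconsrV n :
  measurable_fun setT
    (fun x : 'rV[R]_n.+1 => (x ord0 ord0, rsubmx (x : 'rV_(1 + n)))).
Proof.
apply/measurable_fun_pairP; split; first exact: measurable_coord_rV.
apply: measurable_fun_rVP => i.
apply: eq_measurable_fun (@measurable_coord_rV R n.+1 (rshift 1 i)) => x _ /=.
by rewrite mxE.
Qed.

Section step.
Context (n : nat) (m : {sigma_finite_measure set 'rV[R]_n -> \bar R}).

Definition lebesgue_step : set 'rV[R]_n.+1 -> \bar R :=
  pushforward (@lebesgue_measure R \x m)%E (@consrV n).

HB.instance Definition _ := Measure.copy lebesgue_step
  (measure_function_pushforward__canonical__measure_function_Measure
     (@lebesgue_measure R \x m)%E (@measurable_consrV n)).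

Let lebesgue_step_sigma_finite : sigma_finite setT lebesgue_step.
Proof.
have /sigma_finiteP[F [TF ndF Foo]] := sigma_finiteT (@lebesgue_measure R).
have /sigma_finiteP[G [TG ndG Goo]] := sigma_finiteT m.
pose g (x : 'rV[R]_n.+1) := (x ord0 ord0, rsubmx (x : 'rV_(1 + n))).
have gK p : g (consrV p) = p.
  case: p => a x; rewrite /g /consrV /= row_mxKr; congr pair.
  have -> : (ord0 : 'I_n.+1) = lshift n (ord0 : 'I_1) by exact/val_inj.
  by rewrite [LHS](row_mxEl a%:M x ord0 ord0) mxE eqxx.
exists (fun k => g @^-1` (F k `*` G k)).
  apply/esym; rewrite -subTset => x _.
  have [i _ Fi] : (\bigcup_i F i) (g x).1 by rewrite -TF.
  have [j _ Gj] : (\bigcup_j G j) (g x).2 by rewrite -TG.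
  exists (maxn i j) => //; split => /=.
  - by move: Fi; exact/subsetPset/ndF/leq_maxl.
  - by move: Gj; exact/subsetPset/ndG/leq_maxr.
move=> k; have [mF Fk] := Foo k; have [mG Gk] := Goo k; split.
  by rewrite -[X in measurable X]setTI; apply: measurable_unconsrV => //;
    exact: measurableX.
rewrite /lebesgue_step /pushforward -comp_preimage.
rewrite (_ : g \o _ = id); last by apply/funext => p; exact: gK.
rewrite preimage_id product_measure1E//.
by rewrite lte_mul_pinfty// ge0_fin_numE.
Qed.

HB.instance Definition _ := Measure_isSigmaFinite.Build _ _ _ lebesgue_step
  lebesgue_step_sigma_finite.
End step.

Fixpoint lebesgue_rV n : {sigma_finite_measure set 'rV[R]_n -> \bar R} :=
  match n with
  | 0 => \d_(0 : 'rV[R]_0)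
  | n'.+1 => lebesgue_step (lebesgue_rV n')
  end.

End lebesgue_rV.

Section euclidean.
Context (R : realType) (d : nat).
Implicit Types (x y : 'rV[R]_d) (A : set 'rV[R]_d).

(* the library's norm on 'rV[R]_d is the maximum norm *)
Definition enorm x : R := Num.sqrt (\sum_(i < d) x ord0 i ^+ 2).

Definition diam A : \bar R :=
  ereal_sup [set (enorm (x - y))%:E | x in A & y in A].

End euclidean.

(* k-dimensional Hausdorff measure on R^d, normalised by the volume of the
   k-dimensional Euclidean unit ball; as an outer measure, so that
   caratheodory_type (hausdorff k) is its sigma-algebra of measurable sets *)
Section hausdorff.
Context (R : realType) (d k : nat).
Local Open Scope ereal_scope.
Local Notation E := 'rV[R]_d.

Definition hausdorff_weight : \bar R :=
  lebesgue_rV R k [set x | (enorm x <= 1)%R] * (2^-1 ^+ k)%:E.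

Definition hausdorff_gauge (A : set E) : \bar R :=
  if A == set0 then 0 else hausdorff_weight * diam A ^+ k.

Definition hausdorff_delta (delta : R) (A : set E) : \bar R :=
  ereal_inf [set \sum_(i <oo) hausdorff_gauge (U i) | U in
    [set U : (set E)^nat | A `<=` \bigcup_i U i /\
                           forall i, diam (U i) <= delta%:E]].

Definition hausdorff (A : set E) : \bar R :=
  ereal_sup [set hausdorff_delta delta A | delta in [set t : R | (0 < t)%R]].

Lemma diam_set0 : diam (set0 : set E) = -oo.
Proof. by rewrite /diam image2E set0X image_set0 ereal_sup0. Qed.

Lemma hausdorff_gauge_ge0 A : 0 <= hausdorff_gauge A.
Proof.
rewrite /hausdorff_gauge; case: eqVneq => // /set0P[x Ax].
rewrite mule_ge0//; first by rewrite mule_ge0// lee_fin exprn_ge0// invr_ge0.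
apply: expe_ge0; apply: ereal_sup_ubound; exists x => //; exists x => //.
by rewrite subrr /enorm big1 ?sqrtr0// => i _; rewrite mxE expr0n.
Qed.

Let hdelta_ge0 t A : 0 <= hausdorff_delta t A.
Proof.
apply: le_ereal_inf_tmp => _ [U _ <-]; apply: nneseries_ge0 => n _ _.
exact: hausdorff_gauge_ge0.
Qed.

Let hdelta_le t : {homo hausdorff_delta t : A B / A `<=` B >-> A <= B}.
Proof.
move=> A B AB; apply: ereal_inf_le_tmp => _ [U [BU dU] <-]; exists U => //.
by split => //; exact: subset_trans BU.
Qed.

Let hdelta0 t : (0 < t)%R -> hausdorff_delta t set0 = 0.
Proof.
move=> t0; apply/eqP; rewrite eq_le hdelta_ge0 andbT.
apply: ereal_inf_lbound; exists (fun=> set0).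
  by split => // i; rewrite diam_set0 leNye.
by rewrite eseries0// => i _ _; rewrite /hausdorff_gauge eqxx.
Qed.

Let hdelta_sigma_subadditive t : sigma_subadditive (hausdorff_delta t).
Proof.
move=> A; have [[i ioo]|] := pselect (exists i, hausdorff_delta t (A i) = +oo).
  rewrite (eseries_pinfty _ _ ioo) ?leey// => n _.
  by rewrite -ltNye (lt_le_trans _ (hdelta_ge0 _ _)).
rewrite -forallNE => Aoo.
suff add2e (e : {posnum R}) : hausdorff_delta t (\bigcup_n A n) <=
    \sum_(i <oo) hausdorff_delta t (A i) + e%:num%:E.
  by apply/lee_addgt0Pr => _/posnumP[].
apply: le_trans (epsilon_trick _ _ _) => [|n|//]; last exact: hdelta_ge0.
pose P n (U : (set E)^nat) := (A n `<=` \bigcup_i U i /\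
    forall i, diam (U i) <= t%:E) /\
  \sum_(i <oo) hausdorff_gauge (U i) <=
    hausdorff_delta t (A n) + (e%:num / (2 ^ n.+1)%:R)%:E.
have [G PG] : {G : ((set E)^nat)^nat & forall n, P n (G n)}.
  apply: (@choice _ _ P) => n; rewrite /P /hausdorff_delta.
  set S := (X in ereal_inf X); move infS : (ereal_inf S) => iS.
  case: iS infS => [r Sr|Soo|Soo].
  - have en1 : (0 < e%:num / (2 ^ n.+1)%:R)%R by [].
    have /(lb_ereal_inf_adherent en1) : ereal_inf S \is a fin_num by rewrite Sr.
    move=> [x [U AU Ux] xS].
    by exists U; split => //; rewrite Ux -Sr; exact/ltW.
  - by have := Aoo n; rewrite /hausdorff_delta Soo.
  - by have := hdelta_ge0 t (A n); rewrite /hausdorff_delta Soo.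
pose g := hausdorff_gauge \o uncurry G.
have g_ge0 x : 0 <= g x by exact: hausdorff_gauge_ge0.
apply: (@le_trans _ _ (\esum_(i in setT) g i)).
  apply: ereal_inf_lbound => /=.
  have /card_esym/ppcard_eqP[f] := card_nat2.
  exists (uncurry G \o f).
    split => [x [i _ Ax]|i]; last first.
      by rewrite /=; case: (f i) => a b; exact: (PG a).1.2.
    have [j _ Gx] := (PG i).1.1 _ Ax.
    by exists (f^-1%FUN (i, j)) => //=; rewrite invK ?inE.
  rewrite -(esum_pred_image g _ xpredT) ?[fun=> _]set_true//.
  by rewrite image_eq.
rewrite (_ : esum _ _ = \sum_(i <oo) \sum_(j <oo ) hausdorff_gauge (G i j)).
  apply: lee_nneseries => n _; last exact: (PG n).2.
  by move=> _; apply: nneseries_ge0 => ? _ _; exact: hausdorff_gauge_ge0.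
pose J : nat -> set (nat * nat) := fun i => [set (i, j) | j in setT].
rewrite (_ : setT = \bigcup_k J k); last first.
  by rewrite predeqE => -[a b]; split => // _; exists a => //; exists b.
rewrite esum_bigcupT /=; last 2 first.
  - apply/trivIsetP => i j _ _ ij.
    rewrite predeqE => -[n m] /=; split => //= -[] [_] _ [<-{n} _].
    by move=> [m' _] [] /esym/eqP; rewrite (negbTE ij).
  - by move=> /= nm; exact: g_ge0.
rewrite -(image_id [set: nat]) -fun_true esum_pred_image//; last first.
  by move=> n _; exact: esum_ge0.
apply: eq_eseriesr => /= j _.
rewrite -(esum_pred_image (uncurry (fun i k => hausdorff_gauge (G i k)))
  (pair j) predT)//=; first 1 last.
- by move=> n _; exact: hausdorff_gauge_ge0.
- by move=> ? ? _ _; exact: (@can_inj _ _ _ snd).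
have -> : J j = [set (j, x) | x in fun=> true].
  by rewrite predeqE => -[a b]; split; move=> [i _ <-]; exists i.
by apply: eq_esum => -[].
Qed.

Let hausdorff_ge0 A : 0 <= hausdorff A.
Proof.
apply: (le_trans (hdelta_ge0 1%R A)); apply: ereal_sup_ubound.
by exists 1%R => //=; exact: ltr01.
Qed.

Let hausdorff0 : hausdorff set0 = 0.
Proof.
apply/eqP; rewrite eq_le hausdorff_ge0 andbT.
by apply: ge_ereal_sup => _ [t t0 <-]; rewrite hdelta0.
Qed.

Let hausdorff_le : {homo hausdorff : A B / A `<=` B >-> A <= B}.
Proof.
move=> A B AB; apply: ge_ereal_sup => _ [t t0 <-].
apply: (le_trans (hdelta_le t AB)); apply: ereal_sup_ubound; by exists t.
Qed.

Let hausdorff_sigma_subadditive : sigma_subadditive hausdorff.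
Proof.
move=> A; apply: ge_ereal_sup => _ [t t0 <-].
apply: (le_trans (hdelta_sigma_subadditive t A)).
apply: lee_nneseries => [i _ _|n _]; first exact: hdelta_ge0.
by apply: ereal_sup_ubound; exists t.
Qed.

HB.instance Definition _ := isOuterMeasure.Build R E hausdorff
  hausdorff0 hausdorff_ge0 hausdorff_le hausdorff_sigma_subadditive.

End hausdorff.

Section sobolev.
Context (R : realType).

Definition inL2 d (T : measurableType d) (mu : {measure set T -> \bar R})
  (D : set T) (f : T -> R) : Prop := f \_ D \in Lfun mu 2%:E.

Definition normL2 d (T : measurableType d) (mu : {measure set T -> \bar R})
  (D : set T) (f : T -> R) : R := fine ('N[mu]_2%:E [EFin \o (f \_ D)]).

Context (d : nat).
Local Notation E := 'rV[R]_d.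
Local Notation leb := (lebesgue_rV R d).
Implicit Types (Omega : set E) (j : 'I_d).

Definition partial j (f : E -> R) : E -> R :=
  fun x => 'D_(delta_mx ord0 j) f x.

Definition iter_partial (s : seq 'I_d) (f : E -> R) : E -> R :=
  foldr partial f s.

Definition smooth (f : E -> R) : Prop := forall s : seq 'I_d,
  continuous (iter_partial s f) /\
  forall j x, derivable (iter_partial s f) x (delta_mx ord0 j).

Definition test_function Omega (f : E -> R) : Prop :=
  [/\ smooth f, compact (closure [set x | f x != 0]) &
      closure [set x | f x != 0] `<=` Omega].

(* An element of H^1(Omega) is a pair (u, grad u) of a function and its weak
   gradient; the latter is determined by u up to null sets. *)
Definition sobolev_pair : Type := ((E -> R) * ('I_d -> E -> R))%type.

Definition weak_gradient Omega (u : E -> R) (g : 'I_d -> E -> R) : Prop :=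
  forall f j, test_function Omega f ->
    \int[leb]_(x in Omega) (u x * partial j f x) =
    - \int[leb]_(x in Omega) (g j x * f x).

Definition sobolev_H1 Omega : set sobolev_pair :=
  [set w | [/\ inL2 leb Omega w.1, forall j, inL2 leb Omega (w.2 j) &
               weak_gradient Omega w.1 w.2]].

Definition normH1 Omega (w : sobolev_pair) : R :=
  Num.sqrt (normL2 leb Omega w.1 ^+ 2
            + \sum_(j < d) normL2 leb Omega (w.2 j) ^+ 2).

Definition sobolev_H10 Omega : set sobolev_pair :=
  [set w | sobolev_H1 Omega w /\ forall e : R, 0 < e -> exists2 f,
     test_function Omega f &
     normH1 Omega (w.1 \- f, fun j => w.2 j \- partial j f) < e].

Definition V_space Omega : set ('I_d -> sobolev_pair) :=
  [set w | forall i, sobolev_H10 Omega (w i)].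

Definition V_nonzero Omega (w : 'I_d -> sobolev_pair) : Prop :=
  ~ forall i, (w i).1 = cst 0 %[ae leb in Omega].

Definition seminormV Omega (w : 'I_d -> sobolev_pair) : R :=
  Num.sqrt (\sum_(i < d) \sum_(j < d) normL2 leb Omega ((w i).2 j) ^+ 2).

Definition Q_space Omega : set (E -> R) :=
  [set q | inL2 leb Omega q /\ \int[leb]_(x in Omega) q x = 0].

Definition Q_nonzero Omega (q : E -> R) : Prop :=
  ~ (q = cst 0 %[ae leb in Omega]).

Definition form_b Omega (w : 'I_d -> sobolev_pair) (q : E -> R) : R :=
  - \int[leb]_(x in Omega) ((\sum_(i < d) (w i).2 i x) * q x).

Definition infsup_b Omega : \bar R :=
  ereal_inf [set ereal_sup
    [set (form_b Omega w q / (seminormV Omega w * normL2 leb Omega q))%:E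
      | w in [set w | V_space Omega w /\ V_nonzero Omega w]]
    | q in [set q | Q_space Omega q /\ Q_nonzero Omega q]].

End sobolev.

Section simplices.
Context (R : realType) (d : nat).
Local Notation E := 'rV[R]_d.

Definition hull k (a : 'I_k -> E) (I : {set 'I_k}) : set E :=
  [set x | exists t : 'I_k -> R,
     [/\ forall i, 0 <= t i, forall i, i \notin I -> t i = 0,
         \sum_(i < k) t i = 1 & x = \sum_(i < k) t i *: a i]].

(* rows (1, a i); affine independence of the points a i is linear
   independence of these rows *)
Definition homogeneous k (a : 'I_k -> E) : 'M[R]_(k, 1 + d) :=
  \matrix_(i < k) row_mx (1%:M : 'M[R]_1) (a i).

Definition affinely_independent k (a : 'I_k -> E) : bool :=
  row_free (homogeneous a).

(* barycentric coordinates with respect to the vertices of a nondegenerate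
   d-simplex: the solution t of \sum_i t i = 1 and \sum_i t i *: a i = x *)
Definition barycentric (a : 'I_d.+1 -> E) (i : 'I_d.+1) (x : E) : R :=
  (row_mx (1%:M : 'M[R]_1) x *m invmx (homogeneous a : 'M[R]_(1 + d))) ord0 i.

Definition boundary (A : set E) : set E := closure A `\` interior A.

Definition polyhedral_domain (Omega : set E) : Prop :=
  [/\ open Omega, connected Omega, Omega !=set0, bounded_set Omega &
      exists (m : nat) (a : 'I_m -> 'I_d -> E),
        (forall k, affinely_independent (a k)) /\
        boundary Omega = \bigcup_k hull (a k) [set: 'I_d]%SET].

End simplices.

Record mesh (R : realType) (d : nat) := Mesh {
  ncells : nat;
  vertex : 'I_ncells -> 'I_d.+1 -> 'rV[R]_d }.

Section mesh_theory.
Context (R : realType) (d : nat).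
Local Notation E := 'rV[R]_d.
Local Notation leb := (lebesgue_rV R d).
Implicit Types (M : mesh R d) (Omega F : set E).

Definition cell M (T : 'I_(ncells M)) : set E := hull (vertex T) [set: 'I_d.+1]%SET.

(* face opposite to the i-th vertex *)
Definition face M (T : 'I_(ncells M)) (i : 'I_d.+1) : set E :=
  hull (vertex T) [set~ i]%SET.

(* two distinct cells meet in a common face of lower dimension, possibly
   empty (hull of no vertex); in particular there are no hanging nodes *)
Definition conforming_mesh Omega M : Prop :=
  [/\ forall T : 'I_(ncells M), affinely_independent (vertex T),
      closure Omega = \bigcup_T cell (M := M) T &
      forall T1 T2 : 'I_(ncells M), T1 != T2 ->
        exists I1 I2 : {set 'I_d.+1},
          [/\ I1 \proper [set: 'I_d.+1]%SET, I2 \proper [set: 'I_d.+1]%SET,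
              cell T1 `&` cell T2 = hull (vertex T1) I1 &
              cell T1 `&` cell T2 = hull (vertex T2) I2]].

Definition interior_face M (T1 T2 : 'I_(ncells M)) : Prop :=
  (exists i, cell T1 `&` cell T2 = face T1 i) /\
  (exists i, cell T1 `&` cell T2 = face T2 i).

Definition boundary_face Omega M (T : 'I_(ncells M)) (i : 'I_d.+1) : Prop :=
  face T i `<=` boundary Omega.

Definition mesh_size M : R :=
  \big[Num.max/0]_(T < ncells M) fine (diam (cell T)).

Definition ell M (T : 'I_(ncells M)) F : R :=
  d`!%:R * fine (hausdorff d (cell T)) / fine (hausdorff d.-1 F).

Definition kappa_interior M (T1 T2 : 'I_(ncells M)) F : R :=
  mesh_size M ^- 2 * (Num.sqrt (ell T1 F) + Num.sqrt (ell T2 F)) ^- 2.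

Definition kappa_boundary M (T : 'I_(ncells M)) F : R :=
  mesh_size M ^- 2 * (ell T F)^-1.

Definition surface_outer : {outer_measure set E -> \bar R} :=
  @hausdorff R d d.-1.

Definition surface : {measure set (caratheodory_type surface_outer) -> \bar R} :=
  [the {measure set (caratheodory_type surface_outer) -> \bar R} of
   (surface_outer : set (caratheodory_type surface_outer) -> \bar R)].

(* L2(F)-orthogonal projection of f onto the constants *)
Definition proj_const F (f : E -> R) : R :=
  xget 0 [set c | forall k : R, \int[surface]_(x in F) ((f x - c) * k) = 0].

(* A discontinuous finite element function v is the family of its restrictions
   v T to the cells, each extended to R^d as an affine function; its traces on
   a face of T1 and T2 are those of v T1 and v T2. *)
Definition broken M : Type := 'I_(ncells M) -> E -> R.

Definition CR_basis M (T : 'I_(ncells M)) (i : 'I_d.+1) : broken M :=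
  fun T' x => if T' == T then d%:R * (d%:R^-1 - barycentric (vertex T) i x)
              else 0.

Definition X_CR M : set (broken M) :=
  [set v | exists c : 'I_(ncells M) -> 'I_d.+1 -> R,
     v = fun T' x => \sum_(T < ncells M) \sum_(i < d.+1) c T i * CR_basis T i T' x].

Definition V_CR M : set ('I_d -> broken M) :=
  [set v | forall i, X_CR (v i)].

Definition V_CR_nonzero M (v : 'I_d -> broken M) : Prop :=
  v <> fun _ _ _ => 0.

(* square of the L2(F)-norm of the projection of the jump f *)
Definition face_jump_sqr F (f : E -> R) : R :=
  normL2 surface F (cst (proj_const F f)) ^+ 2.

(* every interior face F = T1 `&` T2 is counted once, for T1 < T2 *)
Definition normX_sqr Omega M (v : broken M) : R :=
  \sum_(T < ncells M) \sum_(j < d) normL2 leb (cell T) (partial j (v T)) ^+ 2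
  + \sum_(T1 < ncells M)
      \sum_(T2 < ncells M | (T1 < T2)%N && `[< interior_face T1 T2 >])
        kappa_interior T1 T2 (cell T1 `&` cell T2) *
        face_jump_sqr (cell T1 `&` cell T2) (v T1 \- v T2)
  + \sum_(T < ncells M) \sum_(i < d.+1 | `[< boundary_face Omega T i >])
        kappa_boundary T (face T i) * face_jump_sqr (face T i) (v T).

Definition normV_CR Omega M (v : 'I_d -> broken M) : R :=
  Num.sqrt (\sum_(i < d) normX_sqr Omega (v i)).

(* elementwise divergence, with value 0 on the (null) skeleton of the mesh *)
Definition div_h M (v : 'I_d -> broken M) : E -> R := fun x =>
  \sum_(T < ncells M)
    \1_(interior (cell T)) x * \sum_(i < d) partial i (v i T) x.

Definition form_bh Omega M (v : 'I_d -> broken M) (q : E -> R) : R :=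
  - \int[leb]_(x in Omega) (div_h v x * q x).

Definition Q_h0 Omega M : set (E -> R) :=
  [set q | Q_space Omega q /\
     forall T : 'I_(ncells M), exists c : R, q = cst c %[ae leb in cell T]].

Definition infsup_bh Omega M : \bar R :=
  ereal_inf [set ereal_sup
    [set (form_bh Omega v q / (normV_CR Omega v * normL2 leb Omega q))%:E
      | v in [set v | V_CR (M := M) v /\ V_CR_nonzero v]]
    | q in [set q | Q_h0 Omega M q /\ Q_nonzero Omega q]].

End mesh_theory.

(* Main.v *)
Require Import Defs.
From HB Require Import structures.
From mathcomp Require Import all_boot all_order all_algebra.
From mathcomp Require Import all_classical all_reals all_analysis.
From mathcomp Require Import measurable_realfun.
From mathcomp Require Import ring lra.

Import Order.TTheory GRing.Theory Num.Theory.
Import numFieldNormedType.Exports.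

Set Implicit Arguments.
Unset Strict Implicit.
Unset Printing Implicit Defensive.

Local Open Scope classical_set_scope.
Local Open Scope ring_scope.

(* Test functions being dense in H^1_0, a strict lower bound for b(w, q) passes
   to smooth compactly supported f_i.  The Crouzeix-Raviart interpolant of f_i
   takes at the barycenter of each face the mean of f_i over that face.  On each
   cell its gradient is the mean of the gradient of f_i, so b_h(v, q) = b(f, q)
   for piecewise constant q and, by Jensen, the broken seminorm does not
   increase; the jumps are affine and vanish at face barycenters, so the penalty
   is 0.

   Let T be a cell and p its vertex opposite to a face F.  The mean over F is
   encoded as the mean over T of f + (x - p).grad f / d.  It depends on F only:
   shrinking T towards p by a factor r and letting r tend to 1 expresses it as a
   limit of means over slabs of T along F, and the slabs of two neighbours are
   exchanged by an affine map that moves their points by O(1 - r).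

   Affine changes of variables, for the Lebesgue measure as well as for the
   Hausdorff measure on a face, are only needed up to a constant factor, and
   follow from the uniqueness of translation-invariant measures.  In particular
   the Hausdorff measure of a face is invariant under the affine transposition
   of two vertices, hence its center of mass is the barycenter. *)

(** * Uniqueness of translation-invariant measures *)

(** The volume formula for a face mean mentions the opposite vertex, and two cells sharing a face
    have different ones: this is the obstacle. Working with cell integrals keeps everything about
    [f] inside Lebesgue measure; differentiating r -> r^d * (integral over T of the field at p + r
    (x - p)) at r = 1 takes the place of the divergence theorem. The surface measure then meets
    affine functions only, whose projections onto constants are decided by one symmetry: the
    barycentric coordinates of a face have equal integrals. Smoothness is used pointwise: on
    boundary faces, which are null sets, the values of [f] and of its partial derivatives are
    evaluated, so functions known up to null sets would not do. The supremum over V need not be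
    attained. Hence some 0 <= b < beta is fixed, the bound is kept strict until [f] is chosen, and b
    tends to beta at the end. Strictness also settles degenerate quotients: division by 0 gives 0,
    so a quotient above b >= 0 has a positive denominator. *)

Section haar.
Context (R : realType) (n : nat).
Local Notation E := 'rV[R]_n.

Lemma measurable_rV_comb (d : measure_display) (T : measurableType d)
    (f g : T -> E) (a b : R) (c : E) :
  measurable_fun setT f -> measurable_fun setT g ->
  measurable_fun setT (fun x => a *: f x + b *: g x + c).
Proof.
move=> mf mg; apply: measurable_fun_rVP => i.
rewrite (_ : (fun _ => _) =
  (fun x => a * f x ord0 i + b * g x ord0 i + c ord0 i)); last first.
  by apply/funext => x; rewrite !mxE.
have mc : forall h : T -> E, measurable_fun setT h ->
    measurable_fun setT (fun x => h x ord0 i).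
  by move=> h mh; exact: (measurableT_comp (measurable_coord_rV i) mh).
apply: measurable_funD => //; apply: measurable_funD;
  by apply: measurable_funM => //; exact: mc.
Qed.

Lemma measurable_preimageT (d d' : measure_display) (T : measurableType d)
    (T' : measurableType d') (f : T -> T') (A : set T') :
  measurable_fun setT f -> measurable A -> measurable (f @^-1` A).
Proof. by move=> mf mA; rewrite -[X in measurable X]setTI; exact: mf. Qed.

Variables (mu nu : {sigma_finite_measure set E -> \bar R}).
(** Both measures are carried by [P] and invariant under the translations [y - o] with [P y]. Two
    cases occur: [P = setT] and [o = 0] for Lebesgue measure; the hyperplane of a face and the
    barycenter of that face for the Hausdorff measure. *)
Variables (P : set E) (o : E).
Hypotheses (mP : measurable P) (muP : mu (~` P) = 0%E) (nuP : nu (~` P) = 0%E).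
Hypothesis mu_inv : forall y A, P y -> measurable A ->
  mu [set x | A (x + (y - o))] = mu A.
Hypothesis nu_inv : forall y A, P y -> measurable A ->
  nu [set x | A (x + (y - o))] = nu A.

Lemma measurable_sum_shift (A : set E) (a b : R) (c : E) : measurable A ->
  measurable [set p : E * E | A (a *: p.1 + b *: p.2 + c)].
Proof.
move=> mA; apply: measurable_preimageT mA.
by apply: measurable_rV_comb; [exact: measurable_fst|exact: measurable_snd].
Qed.

Let eq_int_P (m : {sigma_finite_measure set E -> \bar R}) (f g : E -> \bar R) :
  m (~` P) = 0%E -> measurable_fun setT f -> measurable_fun setT g ->
  (forall x, 0 <= f x)%E -> (forall x, 0 <= g x)%E ->
  (forall x, P x -> f x = g x) ->
  (\int[m]_x f x = \int[m]_x g x)%E.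
Proof.
move=> m0 mf mg f0 g0 fg; apply: ge0_ae_eq_integral => //.
exists (~` P); split => //; first exact: measurableC.
by move=> x /= h Px; apply: h => _; exact: fg.
Qed.

Let tonelli_set (D : set (E * E)) : measurable D ->
  (\int[mu]_x nu (xsection D x) = \int[nu]_y mu (ysection D y))%E.
Proof.
move=> mD; have := @indic_fubini_tonelli _ _ _ _ R mu nu D mD.
by rewrite indic_fubini_tonelli_FE// indic_fubini_tonelli_GE.
Qed.

(** The product measure of [D1] is computed in two orders. Integrating in x first gives the left
    side. At fixed x, a shift of y by [x - o] replaces [D1] by [D2]; integrating [D2] in x first
    leaves [B] reflected through [o]. *)
Lemma haar_swap (A B : set E) : measurable A -> measurable B ->
  (mu A * nu B = mu [set x | B (o + o - x)%R] * nu A)%E.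
Proof.
move=> mA mB.
pose D1 := [set p : E * E | A (1 *: p.1 + 1 *: p.2 - o) /\ B p.2].
pose D2 := [set p : E * E | A p.2 /\ B (- 1 *: p.1 + 1 *: p.2 + o)].
have mD1 : measurable D1.
  apply: measurableI; first exact: measurable_sum_shift.
  by apply: (measurable_preimageT (f := snd)) => //; exact: measurable_snd.
have mD2 : measurable D2.
  apply: measurableI; last exact: measurable_sum_shift.
  by apply: (measurable_preimageT (f := snd)) => //; exact: measurable_snd.
have mshift (C : set E) (v : E) : measurable C -> measurable [set x | C (x + v)].
  move=> mC; apply: (@measurable_preimageT _ _ _ _ (fun x : E => x + v)) => //.
  have -> : (fun x : E => x + v) = (fun x => 1 *: x + 0 *: x + v).
    by apply/funext => x; rewrite scale1r scale0r addr0.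
  by apply: measurable_rV_comb; exact: measurable_id.
have mrefl (C : set E) (v : E) : measurable C -> measurable [set x | C (v - x)].
  move=> mC; apply: (@measurable_preimageT _ _ _ _ (fun x : E => v - x)) => //.
  have -> : (fun x : E => v - x) = (fun x => -1 *: x + 0 *: x + v).
    by apply/funext => x; rewrite scaleN1r scale0r addr0 addrC.
  by apply: measurable_rV_comb; exact: measurable_id.
transitivity (\int[nu]_y mu (ysection D1 y))%E.
  rewrite -[in nu B](setIT B) -(integral_indic nu measurableT mB) -ge0_integralZl//.
  - apply: (eq_int_P nuP) => //.
    + apply: measurable_funeM; apply/measurable_EFinP.
      exact: measurable_indic.
    + exact: measurable_fun_ysection.
    + by move=> y; rewrite mule_ge0// lee_fin.
    + move=> y Py; rewrite indicE; case: (boolP (y \in B)) => yB.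
        rewrite mule1 -(mu_inv Py mA); congr (mu _); apply/seteqP.
        rewrite /ysection /= /D1; split => x /=; rewrite !inE /= !scale1r ?addrA.
          by move=> h; split => //; exact/set_mem.
        by case.
      rewrite mule0; apply/esym; rewrite [X in mu X](_ : _ = set0) ?measure0//.
      apply/seteqP; split => // x; rewrite /ysection /= inE => -[_ /= By].
      by move: yB; rewrite notin_setE.
  by apply/measurable_EFinP; exact: measurable_indic.
rewrite -(tonelli_set mD1).
transitivity (\int[mu]_y nu (xsection D2 y))%E.
  apply: (eq_int_P muP); [exact: measurable_fun_xsection
    |exact: measurable_fun_xsection|by []|by []|].
  move=> x Px; rewrite -(nu_inv Px (measurable_xsection x mD2)); congr (nu _).
  rewrite /xsection; apply/seteqP; split => y /=; rewrite !inE /=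
    /D1 /D2 /= !scale1r scaleN1r.
    move=> [h1 h2]; split; first by rewrite addrA (addrC y).
    by rewrite [X in B X](_ : _ = y)//; apply/rowP => i; rewrite !mxE; lra.
  move=> [h1 h2]; split; first by rewrite (addrC x) -addrA.
  by rewrite [X in B X](_ : _ = - x + (y + (x - o)) + o)//; apply/rowP => i; rewrite !mxE; lra.
rewrite (tonelli_set mD2) -[in nu A](setIT A) -(integral_indic nu measurableT mA).
rewrite -ge0_integralZl//; last first.
  by apply/measurable_EFinP; exact: measurable_indic.
apply: (eq_int_P nuP) => //.
- exact: measurable_fun_ysection.
- apply: measurable_funeM; apply/measurable_EFinP.
  exact: measurable_indic.
- by move=> y; rewrite mule_ge0// lee_fin.
- move=> y Py; rewrite indicE; case: (boolP (y \in A)) => yA; last first.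
    rewrite mule0 [X in mu X](_ : _ = set0) ?measure0//.
    apply/seteqP; split => // x; rewrite /ysection /= inE => -[Ay _ /=].
    by move: yA; rewrite notin_setE.
  rewrite mule1 -(mu_inv Py (measurable_ysection y mD2)); congr (mu _).
  apply/seteqP; rewrite /ysection /= /D2; split => x /=; rewrite !inE /= scale1r scaleN1r.
    move=> [_]; rewrite [X in B X](_ : _ = o + o - x)//.
    by apply/rowP => i; rewrite !mxE; lra.
  move=> h; split; first exact/set_mem.
  by rewrite [X in B X](_ : _ = o + o - x)//; apply/rowP => i; rewrite !mxE; lra.
Qed.

(** [haar_swap] with both sets equal to [S], after cancelling [nu S], shows that [S] and its
    reflection have the same [mu]-measure; this removes the reflection from the general identity. *)
Lemma haar_unique (S A : set E) : measurable S -> measurable A ->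
  (0 < nu S)%E -> (nu S < +oo)%E -> (mu A * nu S = mu S * nu A)%E.
Proof.
move=> mS mA nuS0 nuSoo.
have fS : nu S \is a fin_num by rewrite ge0_fin_numE.
suff -> : mu S = mu [set x | S (o + o - x)%R] by exact: haar_swap.
have /(congr1 (fun z => z * (fine (nu S))^-1%:E)%E) := haar_swap mS mS.
rewrite -!muleA -(fineK fS) -EFinM fineK// mulfV ?mule1//.
by rewrite gt_eqF// fine_gt0// nuS0.
Qed.

End haar.

(** * Borel sets and Lebesgue measure on R^n *)

Section rV_topology.
Context (R : realType) (n : nat).
Local Notation E := 'rV[R]_n.

Lemma ltr_norm_rV (x : E) (r : R) :
  0 < r -> (`|x| < r) = [forall i, `|x ord0 i| < r].
Proof.
move=> r0; apply/idP/forallP.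
  move=> xr i; apply: le_lt_trans xr.
  rewrite [leRHS]mx_normrE; apply: le_trans (le_bigmax _ _ (ord0, i)) => //=.
move=> h; rewrite [ltLHS]mx_normrE; apply/bigmax_ltP; split => // -[i j] _ /=.
by rewrite (ord1 i); exact/h.
Qed.

Lemma ler_norm_rV_coord (x : E) i : `|x ord0 i| <= `|x|.
Proof.
by rewrite [leRHS]mx_normrE; apply: le_trans (le_bigmax _ _ (ord0, i)).
Qed.

Definition cube (c : E) (r : R) : set E :=
  [set x | forall i, `|x ord0 i - c ord0 i| < r].

Lemma measurable_cube c r : measurable (cube c r).
Proof.
have -> : cube c r = \big[setI/setT]_(i < n) ((fun x : E => x ord0 i) @^-1`
     (ball (c ord0 i) r)).
  apply/seteqP; split => x; rewrite -bigcap_seq.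
    by move=> h i _ /=; rewrite /ball /= distrC.
  by move=> h i; have /= := h i (mem_index_enum _); rewrite /ball /= distrC.
apply: bigsetI_measurable => i _; apply: measurable_preimageT.
  exact: measurable_coord_rV.
exact: measurable_ball.
Qed.

Lemma cubeE (c : E) r : 0 < r -> cube c r = [set x | `|x - c| < r].
Proof.
move=> r0; apply/seteqP; split => x /=; rewrite ltr_norm_rV//.
  by move=> h; apply/forallP => i; rewrite !mxE.
by move=> /forallP h i; have := h i; rewrite !mxE.
Qed.

Lemma open_rV_measurable (U : set E) : open U -> measurable U.
Proof.
move=> oU.
(* Rational centers and radii 1/(k+1): once the radius is below e/2 and the center within that
   radius of x, the cube contains x and lies in the ball of radius e. *)
pose B (z : 'rV[rat]_n * nat) : set E := cube (map_mx ratr z.1) z.2.+1%:R^-1.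
have -> : U = \bigcup_(z in [set: 'rV[rat]_n * nat])
    (if `[< B z `<=` U >] then B z else set0).
  apply/seteqP; split => x; last by move=> [z _]; case: asboolP => // h /h.
  move=> Ux; have : nbhs x U by exact: open_nbhs_nbhs.
  move=> /nbhs_ballP[e /= e0]; rewrite mx_norm_ball /ball_ => eU.
  have [k _ ke] : exists2 k : nat, True & k.+1%:R^-1 < e / 2.
    have [k hk] := ltr_add_invr (divr_gt0 e0 (ltr0Sn R 1)).
    by exists k => //; move: hk; rewrite add0r.
  have k0 : 0 < k.+1%:R^-1 :> R by rewrite invr_gt0.
  have qex i : exists q : rat, `|x ord0 i - ratr q| < k.+1%:R^-1.
    have [|q] := @rat_in_itvoo R (x ord0 i - k.+1%:R^-1) (x ord0 i + k.+1%:R^-1).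
      by rewrite ltrD2l (lt_trans _ k0)// oppr_lt0.
    rewrite in_itv /= => /andP[h1 h2]; exists q.
    by rewrite distrC ltr_distl h1.
  have [q hq] := choice qex.
  exists (\row_i q i, k) => //; case: asboolP => [_ i|].
    by rewrite !mxE; exact: hq.
  move=> nB; exfalso; apply: nB => y; rewrite /B /= cubeE// => hy; apply: eU => /=.
  have : x \in cube (map_mx ratr (\row_i q i)) k.+1%:R^-1.
    by apply/mem_set => i; rewrite !mxE.
  rewrite inE cubeE//= => hx.
  set c := map_mx _ _ in hy hx.
  rewrite (_ : x - y = (x - c) - (y - c)); last by rewrite opprB addrA subrK.
  apply: le_lt_trans (ler_normB _ _) _; rewrite (splitr e).
  by apply: ltrD; [exact: lt_trans hx ke|exact: lt_trans hy ke].
apply: countable_bigcupT_measurable; first exact: countableP.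
by move=> z; case: asboolP => // _; exact: measurable_cube.
Qed.

Lemma continuous_rV_measurable (f : E -> R) :
  continuous f -> measurable_fun setT f.
Proof.
move=> /continuousP cf; apply: (measurability _ (RGenOpens.measurableE R)).
move=> _ [_ [a [b ->]] <-]; rewrite setTI; apply: open_rV_measurable.
by apply: cf; exact: interval_open.
Qed.

Lemma continuous_rV_measurable_map (f : E -> E) :
  continuous f -> measurable_fun setT f.
Proof.
move=> cf; apply: measurable_fun_rVP => i; apply: continuous_rV_measurable.
move=> x; apply: (@continuous_comp _ _ _ f (fun y : E => y ord0 i)) => //.
  exact: cf.
exact: (@coord_continuous R 1 n ord0 i (f x)).
Qed.

Lemma closed_rV_measurable (U : set E) : closed U -> measurable U.
Proof.
move=> cU; rewrite -(setCK U); apply: measurableC.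
by apply: open_rV_measurable; rewrite openC.
Qed.

End rV_topology.

(** * Translation invariance of Lebesgue measure and volume of cubes *)

Lemma lebesgue_measure_translation (R : realType) (v : R) (A : set R) :
  measurable A -> lebesgue_measure [set x | A (x + v)] = lebesgue_measure A.
Proof.
move=> mA.
have mf : measurable_fun [set: measurableTypeR R]
    ((fun x : R => x + v) : measurableTypeR R -> measurableTypeR R).
  exact: measurable_funD.
pose m := measure_function_pushforward__canonical__measure_function_Measure
  (@lebesgue_measure R) mf.
apply/esym; apply: (@lebesgue_measure_unique R m) => // _ [[a b] _ <-] /=.
rewrite /pushforward [X in _ = lebesgue_measure X](_ : _ = `]a - v, b - v]%classic).
  by rewrite !lebesgue_measure_itv/= !lte_fin ltrD2r -!EFinB; case: ifP => // _;
    congr EFin; lra.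
by apply/seteqP; split => x /=; rewrite !in_itv /= => /andP[h1 h2]; apply/andP; lra.
Qed.

Section lebesgue_translation.
Context (R : realType).

Lemma consrVD n (p q : R * 'rV[R]_n) :
  consrV p + consrV q = consrV (p.1 + q.1, p.2 + q.2).
Proof.
apply: (etrans (add_row_mx p.1%:M p.2 q.1%:M q.2)).
by rewrite /consrV /= [in RHS]raddfD.
Qed.

Lemma consrV_surj n (x : 'rV[R]_n.+1) : exists p, x = @consrV R n p.
Proof.
exists (x ord0 ord0, rsubmx (x : 'rV_(1 + n))); rewrite /consrV /=.
suff <- : lsubmx (x : 'rV_(1 + n)) = (x ord0 ord0)%:M.
  exact/esym/(@hsubmxK _ _ 1 n x).
apply/rowP => i; rewrite (ord1 i) !mxE mulr1n; congr (x _ _); exact/val_inj.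
Qed.

Lemma lebesgue_rV_translation n (v : 'rV[R]_n) (A : set 'rV[R]_n) :
  measurable A -> lebesgue_rV R n [set x | A (x + v)] = lebesgue_rV R n A.
Proof.
elim: n => [|n IH] in v A *.
  by move=> _; congr (lebesgue_rV R 0 _); apply/seteqP; split => x /=;
    rewrite (_ : x + v = x)//; apply/rowP => -[].
move=> mA; rewrite /= /lebesgue_step /pushforward.
have [w ->] := consrV_surj v.
pose sh (p : measurableTypeR R * 'rV[R]_n) : measurableTypeR R * 'rV[R]_n :=
  (p.1 + w.1, p.2 + w.2).
have msh : measurable_fun setT sh.
  apply/measurable_fun_pairP; split.
    by apply: measurable_funD => //; exact: measurable_fst.
  rewrite (_ : snd \o sh = fun p => 1 *: p.2 + 0 *: p.2 + w.2); last first.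
    by apply/funext => p; rewrite scale1r scale0r addr0.
  by apply: measurable_rV_comb; exact: measurable_snd.
pose m := measure_function_pushforward__canonical__measure_function_Measure
  (@lebesgue_measure R \x lebesgue_rV R n)%E msh.
rewrite [RHS](@product_measure_unique _ _ _ _ R (@lebesgue_measure R) (lebesgue_rV R n) m).
- by congr ((_ \x _)%E _); apply/seteqP; split => p /=; rewrite consrVD.
- move=> B C mB mC /=; rewrite /pushforward.
  rewrite [X in (_ \x _)%E X = _](_ : _ =
    [set x | B (x + w.1)] `*` [set x | C (x + w.2)])//.
  rewrite product_measure1E//; first by congr (_ * _)%E; [exact: lebesgue_measure_translation|exact: IH].
  + by apply: (@measurable_preimageT _ _ _ _ (fun x : measurableTypeR R => x + w.1)) => //;
      exact: measurable_funD.
  + apply: (@measurable_preimageT _ _ _ _ (fun x : 'rV[R]_n => x + w.2)) => //.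
    rewrite (_ : (fun x => _) = fun p => 1 *: p + 0 *: p + w.2).
      by apply: measurable_rV_comb; exact: measurable_id.
    by apply/funext => p; rewrite scale1r scale0r addr0.
- by apply: measurable_preimageT mA; exact: measurable_consrV.
Qed.

Lemma lebesgue_rV_cube n (c : 'rV[R]_n) (r : R) : 0 <= r ->
  lebesgue_rV R n (cube c r) = ((r *+ 2) ^+ n)%:E.
Proof.
move=> r0; elim: n c => [|n IH] c.
  rewrite /= /dirac /= indicE mem_set ?expr0//.
  by move=> [].
have [[a y] ->] := consrV_surj c.
rewrite /= /lebesgue_step /pushforward.
rewrite [X in (_ \x _)%E X = _](_ : _ = ball a r `*` cube y r); last first.
  have c0 (p : R * 'rV[R]_n) : consrV p ord0 (lshift n ord0 : 'I_(1 + n)) = p.1.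
    by rewrite [LHS](row_mxEl p.1%:M p.2 ord0) mxE mulr1n.
  have cS (p : R * 'rV[R]_n) j : consrV p ord0 (rshift 1 j : 'I_(1 + n)) = p.2 ord0 j.
    exact: (row_mxEr p.1%:M p.2 ord0 j).
  apply/seteqP; split => p /=; rewrite /cube /ball /=.
    move=> h; split; first by have := h (lshift n (ord0 : 'I_1) : 'I_(1 + n)); rewrite !c0 distrC.
    by move=> j; have := h (rshift 1 j : 'I_(1 + n)); rewrite !cS.
  move=> [h1 h2] i; case: (split_ordP (i : 'I_(1 + n))) => j ->.
    by rewrite (ord1 j) !c0 distrC.
  by rewrite !cS.
rewrite product_measure1E//; last exact: measurable_cube.
  rewrite exprS EFinM; congr (_ * _)%E; last exact: IH.
  exact: lebesgue_measure_ball.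
exact: measurable_ball.
Qed.

End lebesgue_translation.

(** * Lebesgue measure under affine maps *)

Section image_measure.
Context (R : realType) (d : measure_display) (T : measurableType d).
Variables (m : {sigma_finite_measure set T -> \bar R}) (f g : T -> T).

Definition image_measure of measurable_fun setT f & measurable_fun setT g &
  cancel f g : set T -> \bar R := pushforward m f.

Variables (mf : measurable_fun setT f) (mg : measurable_fun setT g).
Variable (fK : cancel f g).
Local Notation im := (image_measure mf mg fK).

HB.instance Definition _ := Measure.copy im
  (measure_function_pushforward__canonical__measure_function_Measure m mf).

Let im_sigma_finite : sigma_finite setT im.
Proof.
have [F TF Foo] := sigma_finiteT m.
exists (fun k => g @^-1` F k).
  by apply/esym; rewrite -subTset => x _; have : setT (g x) by []; rewrite TF.
move=> k; have [mF Fk] := Foo k; split; first exact: measurable_preimageT.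
rewrite /im /pushforward -comp_preimage (_ : g \o f = id) ?preimage_id//.
by apply/funext.
Qed.

HB.instance Definition _ := Measure_isSigmaFinite.Build _ _ _ im im_sigma_finite.
End image_measure.

Section lebesgue_affine.
Context (R : realType) (n : nat).
Local Notation E := 'rV[R]_n.
Local Notation leb := (lebesgue_rV R n).

Lemma lebesgue_affine (f g : E -> E) (S A : set E) :
  measurable_fun setT f -> measurable_fun setT g -> cancel f g ->
  (forall w, exists w', forall z, f (z + w') = f z + w) ->
  measurable S -> (0 < leb S)%E -> (leb S < +oo)%E -> measurable A ->
  (leb (f @^-1` A) * leb S = leb (f @^-1` S) * leb A)%E.
Proof.
move=> mf mg fK tr mS S0 Soo mA.
apply: (@haar_unique _ _ (image_measure leb mf mg fK) leb setT 0) => //.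
- by rewrite setCT measure0.
- by rewrite setCT measure0.
- move=> y B _ mB; rewrite subr0 /image_measure /= /pushforward.
  have [w hw] := tr y.
  apply: etrans (lebesgue_rV_translation w (measurable_preimageT mf mB)).
  by congr (leb _); apply/seteqP; split => x /=; rewrite hw.
- by move=> y B _ mB; rewrite subr0; exact: lebesgue_rV_translation.
Qed.

Lemma cube_gt0 (c : E) (r : R) : 0 < r -> (0 < leb (cube c r))%E.
Proof.
by move=> r0; rewrite lebesgue_rV_cube ?ltW// lte_fin exprn_gt0// mulrn_wgt0.
Qed.

Lemma cube_ltoo (c : E) (r : R) : (leb (cube c r) < +oo)%E.
Proof.
have [r0|r0] := leP 0 r; first by rewrite lebesgue_rV_cube// ltry.
apply: (@le_lt_trans _ _ (leb (cube c 0))).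
  apply: le_measure; rewrite ?inE; [exact: measurable_cube|exact: measurable_cube|].
  by move=> x /= h i; exact: lt_trans (h i) r0.
by rewrite lebesgue_rV_cube// ltry.
Qed.

Lemma bounded_lebesgue_ltoo (A : set E) : measurable A -> bounded_set A ->
  (leb A < +oo)%E.
Proof.
move=> mA [M [_ hM]].
(* Boundedness speaks of constants strictly above [M], hence a first 1; the cube is open, hence a
   second. *)
apply: (@le_lt_trans _ _ (leb (cube 0 (`|M| + 2)))); last exact: cube_ltoo.
apply: le_measure; rewrite ?inE//; first exact: measurable_cube.
move=> x Ax i; rewrite mxE subr0; apply: (le_lt_trans (ler_norm_rV_coord x i)).
apply: (@le_lt_trans _ _ (`|M| + 1)); last by rewrite ltrD2l; lra.
by apply: hM => //; have := ler_norm M; lra.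
Qed.

Lemma open_lebesgue_gt0 (A : set E) (x : E) : measurable A ->
  nbhs x A -> (0 < leb A)%E.
Proof.
move=> mA /nbhs_ballP[e /= e0]; rewrite mx_norm_ball /ball_ => eA.
apply: (lt_le_trans (cube_gt0 x e0)); apply: le_measure; rewrite ?inE//.
  exact: measurable_cube.
by rewrite cubeE// => y /= hy; apply: eA; rewrite /= distrC.
Qed.

Definition homothety (p : E) (r : R) (x : E) : E := p + r *: (x - p).

Lemma homothetyK p r : r != 0 -> cancel (homothety p r) (homothety p r^-1).
Proof.
by move=> r0 x; rewrite /homothety addrAC subrr add0r scalerA mulVf// scale1r addrC subrK.
Qed.

Lemma continuous_homothety p r : continuous (homothety p r).
Proof.
move=> x; apply: (@cvgD R _ _ (nbhs x) _ (cst p) (fun y : E => r *: (y - p))).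
  exact: cvg_cst.
apply: (@cvgZl_tmp R _ _ (nbhs x) _ r (fun y : E => y - p)).
by apply: (@cvgB R _ _ (nbhs x) _ id (cst p)); [exact: cvg_id|exact: cvg_cst].
Qed.

Lemma continuous_addZ (al : E -> R) (v : E) :
  continuous al -> continuous (fun x : E => x + al x *: v : E).
Proof.
move=> cal x; apply: (@cvgD R _ _ (nbhs x) _ id (fun y : E => al y *: v)).
  exact: cvg_id.
by apply: (@cvgZr_tmp R _ _ (nbhs x) _ al); exact: cal.
Qed.

Lemma measurable_homothety p r : measurable_fun setT (homothety p r).
Proof. by apply: continuous_rV_measurable_map; exact: continuous_homothety. Qed.

(** The factor is read off from [cube p r], whose preimage is [cube p 1]. *)
Lemma lebesgue_homothety p r A : 0 < r -> measurable A ->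
  ((r ^+ n)%:E * leb (homothety p r @^-1` A) = leb A)%E.
Proof.
move=> r0 mA; have rN0 : r != 0 by rewrite gt_eqF.
have := @lebesgue_affine (homothety p r) (homothety p r^-1) (cube p r) A
  (measurable_homothety p r) (measurable_homothety p r^-1) (homothetyK p rN0).
rewrite (_ : homothety p r @^-1` cube p r = cube p 1); last first.
  have hE x i : (`|homothety p r x ord0 i - p ord0 i| < r) = (`|x ord0 i - p ord0 i| < 1).
    rewrite [X in `|X|](_ : _ = r * (x ord0 i - p ord0 i)); last by rewrite !mxE; ring.
    by rewrite normrM gtr0_norm// -[ltRHS]mulr1 ltr_pM2l.
  by apply/seteqP; split => x /= h i; have := h i; rewrite hE.
rewrite !lebesgue_rV_cube ?ltW// => /(_ _ (measurable_cube _ _)).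
rewrite lte_fin exprn_gt0 ?mulrn_wgt0// ltry => /(_ _ isT isT mA).
have h w : exists w', forall z, homothety p r (z + w') = homothety p r z + w.
  exists (r^-1 *: w) => z; rewrite /homothety addrAC [X in _ + X]scalerDr.
  by rewrite scalerA mulfV// scale1r addrA.
have two : (2 : R) ^+ n != 0 by rewrite expf_neq0.
move=> /(_ h) /(congr1 (fun z => z * (2 ^- n)%:E)%E).
rewrite -(mulr_natr r 2) (_ : 1 *+ 2 = 2)// exprMn.
rewrite -muleA -EFinM mulfK// muleC => ->.
by rewrite muleC muleA -EFinM mulVf ?mul1e.
Qed.

End lebesgue_affine.

(** * Change of variables up to constant factors *)

Section change_of_variables.
Context (R : realType) (d : measure_display) (T : measurableType d).
Variables (m : {measure set T -> \bar R}) (f : T -> T) (a b : R).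
Hypotheses (mf : measurable_fun setT f) (a0 : 0 <= a) (b0 : 0 <= b).
Hypothesis fE : forall A, measurable A -> (a%:E * m (f @^-1` A) = b%:E * m A)%E.

Let ge0_change (D : set T) (h : T -> \bar R) : measurable D ->
  measurable_fun setT h -> (forall x, 0 <= h x)%E ->
  (a%:E * \int[m]_(x in f @^-1` D) h (f x) = b%:E * \int[m]_(x in D) h x)%E.
Proof.
move=> mD mh h0.
have mhD : measurable_fun D h by exact: measurable_funTS.
rewrite -(@ge0_integral_pushforward _ _ _ _ R f mf m D h)//.
transitivity (\int[mscale (NngNum a0)
   (measure_function_pushforward__canonical__measure_function_Measure m mf)]_(x in D) h x)%E.
  by rewrite ge0_integral_mscale.
transitivity (\int[mscale (NngNum b0) m]_(x in D) h x)%E.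
  by apply: eq_measure_integral => A mA _; exact: fE.
by rewrite ge0_integral_mscale.
Qed.

(** The identity for nonnegative functions is applied to positive and negative parts. A factor on
    each side matches the cross-multiplied form in which [lebesgue_affine] gives volume ratios. *)
Lemma Rintegral_affine (D : set T) (h : T -> R) : measurable D ->
  measurable_fun setT h ->
  m.-integrable (f @^-1` D) (EFin \o (h \o f)) ->
  m.-integrable D (EFin \o h) ->
  a * \int[m]_(x in f @^-1` D) h (f x) = b * \int[m]_(x in D) h x.
Proof.
move=> mD mh i1 i2.
have meh : measurable_fun setT (EFin \o h) by exact/measurable_EFinP.
rewrite /Rintegral.
have f1 : (\int[m]_(x in f @^-1` D) (h (f x))%:E \is a fin_num)%E.
  by apply: integrable_fin_num => //; exact: measurable_preimageT.
have f2 : (\int[m]_(x in D) (h x)%:E \is a fin_num)%E by exact: integrable_fin_num.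
apply: EFin_inj; rewrite !EFinM !fineK//.
have mfD : measurable (f @^-1` D) by exact: measurable_preimageT.
have n1 := integrable_neg_fin_num mfD i1.
have n2 := integrable_neg_fin_num mD i2.
have e1 := integralE m (f @^-1` D) ((EFin \o h) \o f).
have e2 := integralE m D (EFin \o h).
rewrite (funeneg_comp (EFin \o h) f) in e1 n1.
rewrite (funepos_comp (EFin \o h) f) in e1.
have mulB (c : R) (y z : \bar R) : z \is a fin_num ->
    (c%:E * (y - z) = c%:E * y - c%:E * z)%E.
  by move=> fz; rewrite muleBr// fin_num_adde_defl// fin_numN.
apply: (etrans (congr1 (fun z => a%:E * z)%E e1)).
apply: (etrans (mulB _ _ _ n1)).
apply: esym; apply: (etrans (congr1 (fun z => b%:E * z)%E e2)).
apply: (etrans (mulB _ _ _ n2)).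
apply: esym; apply: (congr2 (fun u v => u - v)%E).
  exact: (@ge0_change D _ mD (measurable_funepos meh) (funepos_ge0 _)).
exact: (@ge0_change D _ mD (measurable_funeneg meh) (funeneg_ge0 _)).
Qed.

End change_of_variables.

(** * Barycentric coordinates *)

Section continuous_real_functions.
Context (R : realType) (T : topologicalType).
Implicit Types f g : T -> R.

Lemma continuous_addf f g :
  continuous f -> continuous g -> continuous (fun x => f x + g x).
Proof. by move=> cf cg x; exact: (@cvgD R _ _ (nbhs x) _ f g _ _ (cf x) (cg x)). Qed.

Lemma continuous_subf f g :
  continuous f -> continuous g -> continuous (fun x => f x - g x).
Proof. by move=> cf cg x; exact: (@cvgB R _ _ (nbhs x) _ f g _ _ (cf x) (cg x)). Qed.

Lemma continuous_mulf f g :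
  continuous f -> continuous g -> continuous (fun x => f x * g x).
Proof. by move=> cf cg x; exact: (@cvgM R _ (nbhs x) _ f g _ _ (cf x) (cg x)). Qed.

Lemma continuous_cstf (c : R) : continuous (fun _ : T => c).
Proof. by move=> x; exact: cvg_cst. Qed.

Lemma continuous_sumf (I : Type) (r : seq I) (P : pred I) (F : I -> T -> R) :
  (forall i, continuous (F i)) -> continuous (fun x => \sum_(i <- r | P i) F i x).
Proof.
move=> cF; elim: r => [|i r IH].
  under eq_fun do rewrite big_nil; exact: continuous_cstf.
under eq_fun do rewrite big_cons.
by case: (P i) => //; exact: continuous_addf.
Qed.

End continuous_real_functions.

Lemma continuous_coordf (R : realType) d (j : 'I_d) :
  continuous (fun x : 'rV[R]_d => x ord0 j).
Proof. by move=> x; exact: (@coord_continuous R 1 d ord0 j x). Qed.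

Section barycentric_coordinates.
Context (R : realType) (d : nat).
Local Notation E := 'rV[R]_d.

Lemma mul_homogeneous k (a : 'I_k -> E) (u : 'rV[R]_k) :
  u *m homogeneous a =
  row_mx (\sum_i u ord0 i)%:M (\sum_i u ord0 i *: a i).
Proof.
apply/rowP => j; rewrite !mxE.
case: (split_ordP j) => l ->; rewrite ?row_mxEl ?row_mxEr.
  rewrite mxE (ord1 l) mulr1n; apply: eq_bigr => i _.
  by rewrite mxE row_mxEl mxE mulr1n mulr1.
rewrite summxE; apply: eq_bigr => i _.
by rewrite mxE [in RHS]mxE row_mxEr.
Qed.

Variable (a : 'I_d.+1 -> E).
Hypothesis ai : affinely_independent a.
Local Notation H := (homogeneous a : 'M[R]_(1 + d)).
Local Notation lam := (barycentric a).

Let unitH : H \in unitmx.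
Proof. by rewrite -row_free_unit. Qed.

(** The linear part of the i-th barycentric coordinate, that is its derivative in direction [v]. *)
Definition dbary (i : 'I_d.+1) (v : E) : R :=
  (row_mx (0 : 'M[R]_1) v *m invmx H) ord0 i.

Let bary_mul (x : 'M[R]_(1, 1 + d)) :
  row_mx (\sum_i (x *m invmx H) ord0 i)%:M (\sum_i (x *m invmx H) ord0 i *: a i) = x.
Proof. by rewrite -mul_homogeneous mulmxKV. Qed.

Let split_row (s t : R) (x y : E) : row_mx (s%:M : 'M[R]_1) x = row_mx (t%:M : 'M[R]_1) y ->
  s = t /\ x = y.
Proof.
move=> e; have [st ->] := eq_row_mx e; split => //.
by have := congr1 (fun M : 'M[R]_1 => M ord0 ord0) st; rewrite !mxE !mulr1n.
Qed.

Lemma sum_bary x : \sum_i lam i x = 1.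
Proof. by have /split_row[] := bary_mul (row_mx (1%:M : 'M[R]_1) x). Qed.

Lemma sum_baryZ x : \sum_i lam i x *: a i = x.
Proof. by have /split_row[] := bary_mul (row_mx (1%:M : 'M[R]_1) x). Qed.

Lemma sum_dbary v : \sum_i dbary i v = 0.
Proof.
have := bary_mul (row_mx (0 : 'M[R]_1) v).
by rewrite -[X in _ = row_mx X v](raddf0 (@scalar_mx R 1)) => /split_row[].
Qed.

Lemma sum_dbaryZ v : \sum_i dbary i v *: a i = v.
Proof.
have := bary_mul (row_mx (0 : 'M[R]_1) v).
by rewrite -[X in _ = row_mx X v](raddf0 (@scalar_mx R 1)) => /split_row[].
Qed.

Lemma bary_uniq (t : 'I_d.+1 -> R) i :
  \sum_i t i = 1 -> lam i (\sum_i t i *: a i) = t i.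
Proof.
move=> t1; rewrite /barycentric.
have -> : row_mx (1%:M : 'M[R]_1) (\sum_i t i *: a i) = (\row_i t i) *m H.
  rewrite mul_homogeneous -{1}t1; congr (row_mx _%:M _);
    by apply: eq_bigr => k _; rewrite mxE.
by rewrite mulmxK// mxE.
Qed.

Lemma bary_vertex i j : lam i (a j) = (i == j)%:R.
Proof.
have s1 : \sum_(k < d.+1) (k == j)%:R = 1 :> R.
  by rewrite (bigD1 j)//= eqxx big1 ?addr0// => k /negbTE ->.
have s2 : \sum_(k < d.+1) (k == j)%:R *: a k = a j.
  rewrite (bigD1 j)//= eqxx scale1r big1 ?addr0// => k /negbTE ->.
  by rewrite scale0r.
by rewrite -{1}s2 bary_uniq.
Qed.

Lemma baryDZ i x (s : R) v : lam i (x + s *: v) = lam i x + s * dbary i v.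
Proof.
rewrite /barycentric /dbary.
have -> : row_mx (1%:M : 'M[R]_1) (x + s *: v) =
    row_mx (1%:M : 'M[R]_1) x + s *: row_mx 0 v.
  by rewrite scale_row_mx add_row_mx scaler0 addr0.
by rewrite mulmxDl -scalemxAl !mxE.
Qed.

Lemma baryB i x y : lam i x - lam i y = dbary i (x - y).
Proof.
have := baryDZ i y 1 (x - y); rewrite scale1r mul1r addrC subrK => ->.
by rewrite addrC addKr.
Qed.

Lemma baryD i x v : lam i (x + v) = lam i x + dbary i v.
Proof. by rewrite -[v in LHS]scale1r baryDZ mul1r. Qed.

Lemma dbaryZ i (s : R) v : dbary i (s *: v) = s * dbary i v.
Proof. by rewrite /dbary -[0 in LHS](scaler0 _ s) -scale_row_mx -scalemxAl mxE. Qed.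

Lemma dbaryD i v w : dbary i (v + w) = dbary i v + dbary i w.
Proof. by rewrite /dbary -[0 in LHS]addr0 -add_row_mx mulmxDl mxE. Qed.

Lemma dbaryB_vertex i j k : dbary i (a j - a k) = (i == j)%:R - (i == k)%:R.
Proof. by rewrite -baryB !bary_vertex. Qed.

Lemma dbary_coord i v :
  dbary i v = \sum_j v ord0 j * dbary i (delta_mx ord0 j).
Proof.
rewrite {1}(row_sum_delta v); elim/big_rec2 : _ => [|j y x _ <-].
  by rewrite -[0](scale0r 0) dbaryZ mul0r.
by rewrite dbaryD dbaryZ.
Qed.

Lemma continuous_bary i : continuous (lam i).
Proof.
have -> : lam i = fun x => lam i 0 + \sum_j x ord0 j * dbary i (delta_mx ord0 j).
  by apply/funext => x; rewrite -dbary_coord -baryD add0r.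
apply: continuous_addf; first exact: continuous_cstf.
apply: continuous_sumf => j; apply: continuous_mulf; last exact: continuous_cstf.
exact: continuous_coordf.
Qed.

Lemma measurable_bary i : measurable_fun setT (lam i).
Proof. by apply: continuous_rV_measurable; exact: continuous_bary. Qed.

Lemma hullE (I : {set 'I_d.+1}) : hull a I =
  [set x | forall i, 0 <= lam i x /\ (i \notin I -> lam i x = 0)].
Proof.
apply/seteqP; split => x.
  move=> [t [t0 tI t1 ->]] i; rewrite bary_uniq//; split => //; exact: tI.
move=> /= h; exists (lam^~ x); split.
- by move=> i; have [] := h i.
- by move=> i; have [_] := h i.
- exact: sum_bary.
- by rewrite sum_baryZ.
Qed.

Local Notation T := (hull a [set: 'I_d.+1]%SET).

Lemma cellE : T = [set x | forall i, 0 <= lam i x].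
Proof.
rewrite hullE; apply/seteqP; split => x /= h i; first by have [] := h i.
by split => //; rewrite inE.
Qed.

Lemma hull_sub_cell I : hull a I `<=` T.
Proof. by rewrite cellE hullE => x /= h i; have [] := h i. Qed.

Lemma closed_hull I : closed (hull a I).
Proof.
rewrite (_ : hull a I = \bigcap_i (lam i @^-1` [set z | 0 <= z] `&`
   lam i @^-1` [set z | if i \in I then True else z = 0])); last first.
  rewrite hullE; apply/seteqP; split => x /= h i => [_|].
    by have [h1 h2] := h i; split => //=; case: ifPn.
  by have [//|h1 /=] := h i; case: ifPn.
apply: closed_bigI => i _; apply: closedI; apply: closed_comp.
- by move=> x _; exact: continuous_bary.
- exact: closed_ge.
- by move=> x _; exact: continuous_bary.
- by case: (i \in I); [exact: closedT|exact: closed_eq].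
Qed.

Lemma bary_le1 i x : T x -> lam i x <= 1.
Proof.
rewrite cellE => h; rewrite -(sum_bary x) (bigD1 i)//= lerDl.
by apply: sumr_ge0 => j _; exact: h.
Qed.

Lemma bounded_cell : exists2 M, 0 < M & forall x, T x -> `|x| <= M.
Proof.
exists (1 + \sum_i `|a i|).
  by apply: ltr_wpDr => //; apply: sumr_ge0.
move=> x Tx; rewrite -[x in leLHS]sum_baryZ.
apply: (le_trans (ler_norm_sum _ _ _)); rewrite -[leLHS]add0r lerD//.
apply: ler_sum => i _; rewrite normrZ ger0_norm; last by move: Tx; rewrite cellE.
by rewrite ler_piMl// bary_le1.
Qed.

Lemma compact_cell : compact T.
Proof.
apply: bounded_closed_compact; last exact: closed_hull.
have [M M0 hM] := bounded_cell; exists M; split; first by rewrite realE ltW.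
by move=> N MN x Tx /=; apply: le_trans (hM x Tx) (ltW MN).
Qed.

Lemma measurable_hull I : measurable (hull a I).
Proof. by apply: closed_rV_measurable; exact: closed_hull. Qed.

Lemma cell_ltoo : (lebesgue_rV R d T < +oo)%E.
Proof.
apply: bounded_lebesgue_ltoo; first exact: measurable_hull.
exact/compact_bounded/compact_cell.
Qed.

Lemma interior_cell x : (forall i, 0 < lam i x) -> nbhs x T.
Proof.
move=> h; have : \forall y \near x, forall i, 0 < lam i y.
  apply: (@filter_forall E _ (fun i y => 0 < lam i y) (nbhs x)) => i.
  exact: (cvgr_gt (lam i x) (@continuous_bary i x) 0 (h i)).
by apply: filterS => y hy; rewrite cellE => i; exact/ltW.
Qed.

Lemma cell_gt0 : (0 < lebesgue_rV R d T)%E.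
Proof.
apply: (@open_lebesgue_gt0 _ _ _ (\sum_(i < d.+1) d.+1%:R^-1 *: a i)).
  exact: measurable_hull.
apply: interior_cell => i; rewrite bary_uniq//.
by rewrite sumr_const card_ord -[LHS]mulr_natr mulVf.
Qed.

End barycentric_coordinates.

(** * Uniform Taylor expansion and traces on faces *)

Section uniform_taylor.
Context (R : realType) (d : nat).
Local Notation E := 'rV[R]_d.

(** Only [x] is confined to [K]: below, the second point is the image of a point of a cell and may
    lie outside the cell. *)
Lemma compact_unif_cont (g : E -> R) (K : set E) (e : R) :
  continuous g -> compact K -> 0 < e ->
  exists2 del, 0 < del & forall x y, K x -> `|x - y| < del -> `|g x - g y| < e.
Proof.
move=> cg /compact_near_coveringP cK e0.
have := cK R 0^'+ (fun del x => forall y, `|x - y| < del -> `|g x - g y| < e) _.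
move=> /(_ _)[x Kx|eta /= eta0 H]; last first.
  exists (eta / 2); first by rewrite divr_gt0.
  move=> x y Kx; apply: (H (eta / 2)) => //=; last by rewrite divr_gt0.
  by rewrite sub0r normrN gtr0_norm ?divr_gt0//; lra.
have e20 : 0 < e / 2 by lra.
have /cvgrPdist_lt/(_ _ e20)/nbhs_ballP[eta /= eta0 H] := cg x.
have H2 y : `|x - y| < eta -> `|g x - g y| < e / 2.
  by move=> xy; apply: H; rewrite mx_norm_ball.
exists (ball x (eta / 2), [set t | 0 < t < eta / 2]).
  split => /=; first by apply: nbhsx_ballx; lra.
  exists (eta / 2) => /=; first by lra.
  move=> t /=; rewrite sub0r normrN => h1 h2; rewrite h2 /=.
  by rewrite gtr0_norm in h1.
move=> [x' t] /= [+ /andP[t0 t1]] y; rewrite mx_norm_ball /ball_ /= => h1 h2.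
have h3 : `|g x - g x'| < e / 2 by apply: H2; lra.
have h4 : `|g x - g y| < e / 2.
  apply: H2; rewrite (_ : x - y = (x - x') + (x' - y)); last by rewrite addrA subrK.
  by apply: (le_lt_trans (ler_normD _ _)); lra.
rewrite (_ : g x' - g y = (g x - g y) - (g x - g x')); last by lra.
by apply: (le_lt_trans (ler_normB _ _)); lra.
Qed.

Variable f : E -> R.
Hypothesis df : forall j x, derivable f x (delta_mx ord0 j).

Let line_derive j (z : E) (s : R) :
  is_derive s 1 (fun t : R => f (z + t *: delta_mx ord0 j))
    (partial j f (z + s *: delta_mx ord0 j)).
Proof.
have eqf : (fun h : R => h^-1 *: (f (z + (h *: (1 : R) + s) *: delta_mx ord0 j)
      - f (z + s *: delta_mx ord0 j))) =
   (fun h : R => h^-1 *: (f (h *: delta_mx ord0 j + (z + s *: delta_mx ord0 j))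
      - f (z + s *: delta_mx ord0 j))).
  apply/funext => h; congr (_ *: (f _ - _)).
  by rewrite [h *: 1]mulr1 scalerDl addrCA addrA.
split; first by rewrite /derivable /= eqf; exact: df.
by rewrite /partial /derive /= eqf.
Qed.

Lemma directional_mvt j (z : E) (t c e : R) :
  (forall s, `|s| <= `|t| ->
     `|partial j f (z + s *: delta_mx ord0 j) - c| <= e) ->
  `|f (z + t *: delta_mx ord0 j) - f z - t * c| <= `|t| * e.
Proof.
move=> h.
pose phi (s : R) := f (z + s *: delta_mx ord0 j).
have cphi (A : set R) : {within A, continuous phi}.
  apply: continuous_subspaceT => s; apply: differentiable_continuous.
  by apply/derivable1_diffP; have := line_derive j z s.
have phi0 : phi 0 = f z by rewrite /phi scale0r addr0.
rewrite -phi0 -/(phi t).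
have [t0|t0] := leP 0 t.
  have [||s] := @MVT_segment R phi (fun s => partial j f (z + s *: delta_mx ord0 j)) 0 t t0.
    by move=> s _; exact: line_derive.
    exact: cphi.
  rewrite in_itv /= => /andP[s0 st] ->; rewrite subr0 mulrC -mulrBr normrM ler_wpM2l//.
  by apply: h; rewrite !ger0_norm.
have [||s] := @MVT_segment R phi (fun s => partial j f (z + s *: delta_mx ord0 j)) t 0 (ltW t0).
  by move=> s _; exact: line_derive.
  exact: cphi.
rewrite in_itv /= => /andP[ts s0] e1.
rewrite (_ : phi t - phi 0 = t * partial j f (z + s *: delta_mx ord0 j)); last first.
  by rewrite -opprB e1 sub0r mulrN opprK mulrC.
rewrite -mulrBr normrM ler_wpM2l//.
by apply: h; rewrite !ler0_norm// ?lerN2// ltW.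
Qed.

Hypothesis cf : forall j, continuous (partial j f).

(** The increment [h] is added one coordinate at a time, each time by the one-variable mean value
    theorem; uniform continuity of the partial derivatives on the ball of radius [M] makes [del]
    independent of [x]. *)
Lemma uniform_taylor (M e : R) : 0 < M -> 0 < e ->
  exists2 del, 0 < del & forall x h : E, `|x| <= M -> `|h| < del ->
    `|f (x + h) - f x - \sum_j h ord0 j * partial j f x| <= e * `|h|.
Proof.
move=> M0 e0.
have cK : compact [set x : E | `|x| <= M].
  apply: bounded_closed_compact.
    exists M; split; first exact: gtr0_real.
    by move=> N MN x /= xM; exact: le_trans xM (ltW MN).
  apply: (@closed_comp _ _ (fun x : E => `|x|) [set z | z <= M]).
    by move=> x _; exact: norm_continuous.
  exact: closed_le.
(* Each of the d coordinate steps may cost e/(d+1) times the norm of [h]; the successor avoids a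
   division by zero when d = 0. *)
have e1 : 0 < e / d.+1%:R by rewrite divr_gt0.
have delj j : exists del, 0 < del /\ forall x y : E, `|x| <= M -> `|x - y| < del ->
    `|partial j f x - partial j f y| < e / d.+1%:R.
  by have [del d0 H] := compact_unif_cont (@cf j) cK e1; exists del.
have [del hdel] := choice delj.
have [eta [eta0 etaj]] : exists eta, 0 < eta /\ forall j, eta <= del j.
  exists (\big[Num.min/1]_j del j); split.
    by apply/bigmin_gtP; split=> [|j _]; [exact: ltr01|have [] := hdel j].
  by move=> j; exact: bigmin_le_cond.
exists eta => // x h xM hN.
pose hk (k : nat) : E := \row_j (if (j < k)%N then h ord0 j else 0).
(* [hk k] keeps the first k coordinates of [h]. For k <= j its j-th coordinate is 0, so that adding
   [s] there cannot exceed the maximum norm of [h]; the right disjunct discards the other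
   indices. *)
have hkN k s j : `|s| <= `|h ord0 j| -> `|x - (x + hk k + s *: delta_mx ord0 j)| < eta
   \/ (j < k)%N.
  have [_|kj] := ltnP j k; [by right|move=> sh; left].
  rewrite -addrA opprD addrA subrr add0r normrN.
  apply: le_lt_trans hN; rewrite [leLHS]mx_normrE.
  apply/bigmax_leP; split => //= -[i l] _ /=; rewrite (ord1 i) !mxE eqxx /=.
  have [->|lj] := eqVneq l j.
    by rewrite ltnNge kj add0r mulr1; apply: le_trans sh (ler_norm_rV_coord _ _).
  rewrite mulr0 addr0; case: ifP => _; last by rewrite normr0.
  exact: ler_norm_rV_coord.
have step (j : 'I_d) : `|f (x + hk j.+1) - f (x + hk j) - h ord0 j * partial j f x|
    <= `|h ord0 j| * (e / d.+1%:R).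
  have -> : x + hk j.+1 = x + hk j + h ord0 j *: delta_mx ord0 j.
    rewrite -addrA; congr (_ + _); apply/rowP => l; rewrite !mxE eqxx /= ltnS leq_eqVlt.
    have [->|lj] := eqVneq l j; first by rewrite eqxx ltnn add0r mulr1.
    by rewrite -[nat_of_ord l == _]/(l == j) (negbTE lj) /= mulr0 addr0.
  apply: directional_mvt => s sh; rewrite distrC.
  have [hlt|] := hkN j s j sh; last by rewrite ltnn.
  by apply/ltW; apply: (hdel j).2 => //; exact: lt_le_trans hlt (etaj j).
have -> : f (x + h) - f x = \sum_(j < d) (f (x + hk j.+1) - f (x + hk j)).
  rewrite -(big_mkord xpredT (fun k => f (x + hk k.+1) - f (x + hk k))).
  rewrite (@telescope_sumr _ 0 d (fun k => f (x + hk k)))//.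
  congr (f _ - f _); first by congr (_ + _); apply/rowP => j; rewrite mxE ltn_ord.
  by rewrite -[LHS]addr0; congr (_ + _); apply/rowP => j; rewrite !mxE.
rewrite -sumrB; apply: (le_trans (ler_norm_sum _ _ _)).
apply: (@le_trans _ _ (\sum_(j < d) `|h| * (e / d.+1%:R))).
  apply: ler_sum => j _; apply: (le_trans (step j)).
  by rewrite ler_wpM2r ?(ltW e1)// ler_norm_rV_coord.
rewrite sumr_const card_ord -[leLHS]mulr_natr -mulrA [leRHS]mulrC ler_wpM2l//.
by rewrite mulrAC ler_pdivrMr// ler_wpM2l ?(ltW e0)// ler_nat.
Qed.

End uniform_taylor.

Lemma bernoulli_ineq (R : realType) (s : R) (k : nat) : 0 <= s -> s <= 1 ->
  1 - k%:R * s <= (1 - s) ^+ k <= 1.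
Proof.
move=> s0 s1.
elim: k => [|k /andP[IH1 IH2]]; first by rewrite mul0r subr0 expr0 lexx.
rewrite exprS; apply/andP; split.
  have k0 : 0 <= k%:R :> R by [].
  have : (1 - s) * (1 - k%:R * s) <= (1 - s) * (1 - s) ^+ k.
    by rewrite ler_wpM2l// subr_ge0.
  apply: le_trans; rewrite -natr1.
  have : 0 <= k%:R * (s * s) by exact: mulr_ge0 k0 (mulr_ge0 s0 s0).
  by lra.
by rewrite mulr_ile1 ?subr_ge0 ?exprn_ge0 ?subr_ge0//; lra.
Qed.

(** Since 1 - (1-s)^n = n s + O(s^2), the bounded expression is s (n A + B) + O(s^2); division by s
    leaves n A + B. *)
Lemma limit_scaling (R : realType) (n : nat) (A B : R) :
  (forall eta del, 0 < eta -> 0 < del -> exists s, [/\ 0 < s, s < del, s <= 1 &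
     `|A * (1 - (1 - s) ^+ n) + (1 - s) ^+ n * (s * B)| <= eta * s]) ->
  n%:R * A + B = 0.
Proof.
move=> H; apply/eqP; rewrite -normr_le0; apply/ler_addgt0Pr => eta eta0; rewrite add0r.
(* The first two terms collect the quadratic remainders [e3] and [e4]; the 1 makes [C] positive. *)
pose C := n%:R ^+ 2 * `|A| + n%:R * `|B| + 1.
have C0 : 0 < C by rewrite ltr_wpDl// addr_ge0// mulr_ge0// exprn_ge0.
have [||s [s0 sd s1 Hs]] := H (eta / 2) (eta / 2 / C); first by lra.
  by rewrite !divr_gt0.
have pw k := bernoulli_ineq k (ltW s0) s1.
have e1 : `|(1 - (1 - s) ^+ n) - n%:R * s| <= n%:R ^+ 2 * s ^+ 2.
  have -> : 1 - (1 - s) ^+ n = s * \sum_(i < n) (1 - s) ^+ i.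
    by rewrite -{1}(expr1n _ n) subrXX opprB addrCA subrr addr0; congr (_ * _);
      apply: eq_bigr => i _; rewrite expr1n mul1r.
  have -> : n%:R * s = s * \sum_(i < n) (1 : R) by rewrite sumr_const card_ord mulrC.
  rewrite -mulrBr -sumrB normrM gtr0_norm//.
  rewrite (_ : n%:R ^+ 2 * s ^+ 2 = s * (s * n%:R * n%:R)); last by ring.
  rewrite ler_wpM2l ?(ltW s0)//.
  apply: (le_trans (ler_norm_sum _ _ _)).
  apply: (@le_trans _ _ (\sum_(i < n) s * n%:R)); last first.
    by rewrite sumr_const card_ord -[leLHS]mulr_natr.
  apply: ler_sum => i _; have /andP[p1 p2] := pw i.
  rewrite ler_norml; apply/andP; split; last first.
    by apply: (@le_trans _ _ 0); [lra|exact: mulr_ge0 (ltW s0) (ler0n _ _)].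
  have : i%:R * s <= n%:R * s by rewrite ler_wpM2r ?(ltW s0)// ler_nat ltnW.
  by lra.
have /andP[q1 q2] := pw n.
have e2 : `|(1 - s) ^+ n - 1| <= n%:R * s by rewrite ler_norml; apply/andP; split; lra.
rewrite -(ler_pM2r s0).
rewrite -[X in _ * X](gtr0_norm s0) -normrM.
rewrite (_ : (n%:R * A + B) * s = (A * (1 - (1 - s) ^+ n) + (1 - s) ^+ n * (s * B))
   - A * ((1 - (1 - s) ^+ n) - n%:R * s) - ((1 - s) ^+ n - 1) * (s * B)); last by ring.
apply: (le_trans (ler_normB _ _)); apply: (le_trans (lerD (ler_normB _ _) (lexx _))).
have e3 : `|A * ((1 - (1 - s) ^+ n) - n%:R * s)| <= `|A| * (n%:R ^+ 2 * s ^+ 2).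
  by rewrite normrM ler_wpM2l.
have e4 : `|((1 - s) ^+ n - 1) * (s * B)| <= n%:R * s * (s * `|B|).
  by rewrite !normrM (gtr0_norm s0) ler_wpM2r// mulr_ge0// ltW.
have e5 : s * C <= eta / 2 by rewrite -ler_pdivlMr// ltW.
have e6 : s * (s * C) <= s * (eta / 2) by rewrite ler_wpM2l// ltW.
have s2 : 0 <= s * s by rewrite mulr_ge0 ?ltW.
move: Hs e3 e4 e6; rewrite /C !expr2.
set x1 := `|_|; set x2 := `|_|; set x3 := `|_|.
lra.
Qed.

(** * Independence of the face mean from the opposite vertex *)

Section trace.
Context (R : realType) (d : nat).
Local Notation E := 'rV[R]_d.
Local Notation leb := (lebesgue_rV R d).
Variable (a : 'I_d.+1 -> E).
Hypothesis ai : affinely_independent a.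
Local Notation lam := (barycentric a).
Local Notation T := (hull a [set: 'I_d.+1]%SET).

Lemma integrable_cell (g : E -> R) : continuous g ->
  leb.-integrable T (EFin \o g).
Proof.
move=> cg; apply: measurable_bounded_integrable.
- exact: measurable_hull.
- exact: cell_ltoo.
- by apply: measurable_funTS; exact: continuous_rV_measurable.
- have : compact (g @` T).
    apply: continuous_compact; last exact: compact_cell.
    by apply: continuous_subspaceT; exact: cg.
  move=> /compact_bounded[M [Mr hM]]; exists M; split => // N MN x /= Tx.
  by apply: (hM N MN); exists x.
Qed.

Variables (i : 'I_d.+1) (q : E).
Local Notation p := (a i).
(** The affine map that fixes the face opposite to [p] pointwise and sends [p] to [q]. It is allowed
    to be degenerate: [q] may lie on the face. *)
Definition vertex_move (x : E) : E := x + lam i x *: (q - p).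
Local Notation Psi := vertex_move.

Lemma continuous_vertex_move : continuous Psi.
Proof. by apply: continuous_addZ; exact: continuous_bary. Qed.

Variable f : E -> R.
Hypothesis df : forall j x, derivable f x (delta_mx ord0 j).
Hypothesis cf : continuous f.
Hypothesis cpf : forall j, continuous (partial j f).

(** The derivative of [f] along homotheties centered at [o]: to first order, f (x - s (x - o)) = f x
    - s * [radial o x]. *)
Definition radial (o x : E) : R := \sum_j (x - o) ord0 j * partial j f x.

Let u x := f x - f (Psi x).
Let U x := radial p x - radial q (Psi x).

Lemma continuous_comp_map (g : E -> R) (h : E -> E) :
  continuous g -> continuous h -> continuous (fun x => g (h x)).
Proof.
by move=> cg ch x; apply: (@continuous_comp _ _ _ h g); [exact: ch|exact: cg].
Qed.

Lemma continuous_radial o : continuous (radial o).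
Proof.
apply: continuous_sumf => j; apply: continuous_mulf => //.
have -> : (fun x : E => (x - o) ord0 j) = fun x => x ord0 j - o ord0 j.
  by apply/funext => x; rewrite !mxE.
by apply: continuous_subf; [exact: continuous_coordf|exact: continuous_cstf].
Qed.

Lemma continuous_jump : continuous u.
Proof.
apply: continuous_subf => //; apply: continuous_comp_map => //.
exact: continuous_vertex_move.
Qed.

Lemma continuous_radial_jump : continuous U.
Proof.
apply: continuous_subf; first exact: continuous_radial.
apply: continuous_comp_map; first exact: continuous_radial.
exact: continuous_vertex_move.
Qed.

Let homothety_vertex r x k : lam k (homothety p r x) = (1 - r) * (k == i)%:R + r * lam k x.
Proof. by rewrite /homothety baryDZ// -baryB// bary_vertex//; ring. Qed.

Let homothety_sub s x : homothety p (1 - s) x = x - s *: (x - p).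
Proof. by apply/rowP => j; rewrite !mxE; ring. Qed.

(** [Psi] turns homotheties centered at [p] into homotheties centered at [q], so both terms of [u]
    expand along the same parameter and produce [U]. *)
Let Psi_homothety s x :
  Psi (homothety p (1 - s) x) = Psi x - s *: (Psi x - q).
Proof.
rewrite /Psi homothety_vertex eqxx mulr1 homothety_sub; apply/rowP => j.
rewrite !mxE; ring.
Qed.

Let homothety_inv_ge0 r x k : 0 < r ->
  (0 <= lam k (homothety p r^-1 x)) = (0 <= (r - 1) * (k == i)%:R + lam k x).
Proof.
move=> r0; rewrite homothety_vertex.
rewrite (_ : _ + _ = r^-1 * ((r - 1) * (k == i)%:R + lam k x)); last first.
  by field; rewrite gt_eqF.
by rewrite pmulr_rge0// invr_gt0.
Qed.

Let T_small r x : 0 < r -> T x -> T (homothety p r^-1 x) \/ lam i x < 1 - r.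
Proof.
move=> r0 Tx; have [li|li] := ltP (lam i x) (1 - r); [by right|left].
rewrite cellE// => k; rewrite homothety_inv_ge0//.
have lk : 0 <= lam k x by move: Tx; rewrite cellE.
by have [->|_] := eqVneq k i; rewrite /= ?mulr1 ?mulr0; lra.
Qed.

Let T_sub r : 0 < r -> r <= 1 -> homothety p r^-1 @^-1` T `<=` T.
Proof.
move=> r0 r1 x; rewrite /= !cellE// => h k; have := h k.
by rewrite homothety_inv_ge0//; case: eqP => _; rewrite ?mulr1 ?mulr0; lra.
Qed.

(** With r = 1 - s, scaling gives A - r^d * (integral of u after the homothety) = integral of u over
    the slab left by the shrunken cell. The slab has volume O(s) and u is small there, because [Psi]
    nearly fixes it; the integral after the homothety is A - s B + o(s). Hence A - r^d (A - s B) =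
    o(s), and [limit_scaling] concludes. *)
Lemma trace_identity : \int[leb]_(x in T) (d%:R * u x + U x) = 0.
Proof.
have mT : measurable T by exact: measurable_hull.
have iu := integrable_cell continuous_jump.
have iU := integrable_cell continuous_radial_jump.
have idu : leb.-integrable T (EFin \o (fun x => d%:R * u x)).
  apply: integrable_cell; apply: continuous_mulf; last exact: continuous_jump.
  exact: continuous_cstf.
rewrite RintegralD//.
rewrite RintegralZl//; set A := Rintegral _ _ _; set B := Rintegral _ _ _.
apply: limit_scaling => eta del eta0 del0.
have [M M0 hM] := bounded_cell ai.
pose m := fine (leb T).
have m0 : 0 <= m by exact: fine_ge0.
pose D := `|q| + `|p| + 1.
have q0 := normr_ge0 q; have p0 := normr_ge0 p.
have D0 : 0 < D by rewrite /D; lra.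
have qp : `|q - p| <= D by apply: (le_trans (ler_normB _ _)); rewrite /D; lra.
pose M2 := M + D.
have M20 : 0 < M2 by rewrite /M2; lra.
have MM2 : M <= M2 by rewrite /M2; lra.
have pM2 : `|p| <= M2 by rewrite /M2 /D; lra.
have qM2 : `|q| <= M2 by rewrite /M2 /D; lra.
(* The denominators of [e1] and [e2] contain m + 1 instead of m; this inequality absorbs the
   difference. *)
have frac : m / (m + 1) <= 1 by rewrite ler_pdivrMr; lra.
have eta20 : 0 <= eta / 2 by lra.
have lam01 x : T x -> 0 <= lam i x <= 1.
  by move=> Tx; rewrite bary_le1// andbT; move: Tx; rewrite cellE.
have PsiM x : T x -> `|Psi x| <= M2.
  move=> Tx; apply: (le_trans (ler_normD _ _)); rewrite lerD ?hM// normrZ.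
  have /andP[l0 l1] := lam01 _ Tx.
  by rewrite ger0_norm// -[leRHS]mul1r ler_pM.
(* e1 bounds u on the slab T \ T_r, e2 is the relative error of the expansion
   of u along the homothety of ratio r = 1 - s *)
pose e1 := eta / (2 * (d.+1%:R * (m + 1))).
have e10 : 0 < e1 by rewrite divr_gt0// !mulr_gt0// ltr_wpDl.
have dR0 : 0 < d.+1%:R :> R by [].
have m1 : 0 < m + 1 by rewrite ltr_wpDl.
pose e2 := eta / (8 * M2 * (m + 1)).
have e20 : 0 < e2 by rewrite divr_gt0// !mulr_gt0.
have [del1 del10 hdel1] := compact_unif_cont cf (compact_cell ai) e10.
have [del2 del20 hdel2] := uniform_taylor df cpf M20 e20.
have [s [s0 sdel s1 sd1 sd2]] : exists s, [/\ 0 < s, s < del, s < 1,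
    s * D < del1 & s * (2 * M2) < del2].
  pose s := Num.min (Num.min (del / 2) (1 / 2))
    (Num.min (del1 / D / 2) (del2 / (2 * M2) / 2)).
  have s0 : 0 < s by rewrite !lt_min !divr_gt0// mulr_gt0.
  have : s <= s by [].
  rewrite {2}/s !le_min => /andP[/andP[h1 h2] /andP[h3 h4]].
  exists s; split => //; [lra|lra| |].
    by rewrite -ltr_pdivlMr//; apply: (le_lt_trans h3); rewrite ltr_pdivrMr// ltr_pMr ?divr_gt0// ltr1n.
  rewrite -ltr_pdivlMr ?mulr_gt0//; apply: (le_lt_trans h4).
  by rewrite ltr_pdivrMr// ltr_pMr ?divr_gt0 ?mulr_gt0// ltr1n.
exists s; split => //; first exact: ltW.
pose r := 1 - s.
have r0 : 0 < r by rewrite /r; lra.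
have r1 : r <= 1 by rewrite /r; lra.
(* The cell shrunk towards [p]; by [T_small], what it misses of [T] lies in the slab where the i-th
   coordinate is below s. *)
pose Tr := homothety p r^-1 @^-1` T.
have mTr : measurable Tr.
  by apply: measurable_preimageT mT; exact: measurable_homothety.
have rN0 : r != 0 by rewrite gt_eqF.
have preTr : homothety p r @^-1` Tr = T.
  rewrite /Tr -comp_preimage (_ : _ \o _ = id) ?preimage_id//.
  by apply/funext => x /=; rewrite homothetyK.
have TrT : Tr `<=` T by exact: T_sub.
have cur : continuous (fun x => u (homothety p r x)).
  by apply: continuous_comp_map; [exact: continuous_jump|exact: continuous_homothety].
have iur := integrable_cell cur.
have scale : r ^+ d * \int[leb]_(x in T) u (homothety p r x) = \int[leb]_(x in Tr) u x.
  have rd0 : 0 <= r ^+ d by rewrite exprn_ge0// ltW.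
  have mX X : measurable X ->
      ((r ^+ d)%:E * leb (homothety p r @^-1` X) = 1%:E * leb X)%E.
    by move=> mX; rewrite mul1e lebesgue_homothety.
  have := @Rintegral_affine _ _ _ leb _ _ _ (measurable_homothety p r) rd0 ler01 mX Tr u mTr.
  rewrite preTr mul1r; apply.
  - by apply: continuous_rV_measurable; exact: continuous_jump.
  - exact: iur.
  - exact: integrableS iu.
have slab : `|A - r ^+ d * \int[leb]_(x in T) u (homothety p r x)| <= e1 * (1 - r ^+ d) * m.
  rewrite scale /A.
  have TU : T = Tr `|` (T `\` Tr) by rewrite setDUK.
  rewrite {1}TU Rintegral_setU//; last 3 first.
  - exact: measurableD.
  - by rewrite -TU.
  - by rewrite disj_set2E setDIK.
  rewrite addrC addKr.
  have iD : leb.-integrable (T `\` Tr) (EFin \o u).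
    apply: integrableS iu => //; exact: measurableD.
  have mD : measurable (T `\` Tr) by exact: measurableD.
  apply: (le_trans (le_normr_Rintegral mD iD)).
  have lTr : (leb Tr = (r ^+ d * m)%:E)%E.
    by rewrite -(lebesgue_homothety p r0 mTr) preTr EFinM fineK// ge0_fin_numE// cell_ltoo.
  have lD : (leb (T `\` Tr) = ((1 - r ^+ d) * m)%:E)%E.
    have eD : (leb (T `\` Tr) = leb T - leb Tr)%E.
      have := measureD (mu := leb) mT mTr (cell_ltoo ai).
      by rewrite (_ : T `&` Tr = Tr)// setIidr.
    rewrite eD lTr -(@fineK _ (leb T)) ?ge0_fin_numE ?cell_ltoo// -EFinB.
    by congr EFin; rewrite -/m; ring.
  apply: (@le_trans _ _ (\int[leb]_(x in T `\` Tr) e1)).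
    apply: le_Rintegral.
    - exact: measurableD.
    - exact: (integrable_norm iD).
    - apply: measurable_bounded_integrable; [exact: measurableD| |exact: measurable_cst|].
        by apply: (eq_ind_r (fun z => (z < +oo)%E) _ lD); exact: ltry.
      by exists e1; split; [exact: gtr0_real|move=> N hN x _; rewrite /= gtr0_norm// ltW].
    (* In the slab [Psi] displaces x by its i-th coordinate times q - p, hence by at most s D <
       del1. *)
    - move=> x [Tx nTr]; apply/ltW/hdel1 => //.
      have [//|lx] := T_small r0 Tx.
      rewrite /Psi opprD addrA subrr add0r normrN normrZ.
      have /andP[l0 l1] := lam01 _ Tx.
      apply: (le_lt_trans _ sd1); rewrite ger0_norm// ler_pM//.
      by apply: ltW; move: lx; rewrite /r opprB addrCA subrr addr0.
  rewrite Rintegral_cst//.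
  by rewrite [X in _ * X](congr1 fine lD) /= mulrA.
have expand : `|\int[leb]_(x in T) u (homothety p r x) - (A - s * B)| <= e2 * (4 * M2 * s) * m.
  have -> : A - s * B = \int[leb]_(x in T) (u x - s * U x).
    rewrite RintegralB//; first by rewrite RintegralZl.
      apply: integrable_cell; apply: continuous_mulf; first exact: continuous_cstf.
    exact: continuous_radial_jump.
  have cl : continuous (fun x => u x - s * U x).
    apply: continuous_subf; first exact: continuous_jump.
    by apply: continuous_mulf; [exact: continuous_cstf|exact: continuous_radial_jump].
  rewrite -RintegralB//; last exact: (integrable_cell cl).
  have cg : continuous (fun x => u (homothety p r x) - (u x - s * U x)).
    exact: continuous_subf.
  apply: (le_trans (le_normr_Rintegral mT (integrable_cell cg))).
  apply: (@le_trans _ _ (\int[leb]_(x in T) (e2 * (4 * M2 * s)))); last first.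
    by rewrite Rintegral_cst.
  apply: le_Rintegral => //.
  - exact: (integrable_norm (integrable_cell cg)).
  - by apply: integrable_cell; exact: continuous_cstf.
  - move=> x Tx.
    (* Taylor at [z] with increment -s (z - o), of norm at most 2 M2 s. It is used at (p, x) and (q,
       Psi x), which adds up to the 4 M2 s of [expand]. *)
    have tay o z : `|z| <= M2 -> `|o| <= M2 ->
      `|f (z - s *: (z - o)) - f z + s * radial o z| <= e2 * (2 * M2 * s).
      move=> zM oM; have hb : `|- (s *: (z - o))| <= s * (2 * M2).
        rewrite normrN normrZ gtr0_norm// ler_wpM2l ?(ltW s0)//.
        by apply: (le_trans (ler_normB _ _)); rewrite mulr_natl mulr2n lerD.
      have := hdel2 z (- (s *: (z - o))) zM (le_lt_trans hb sd2).
      rewrite (_ : \sum_j _ = - (s * radial o z)); last first.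
        by rewrite /radial mulr_sumr -sumrN; apply: eq_bigr => j _; rewrite !mxE; ring.
      rewrite opprK => /le_trans; apply.
      by rewrite ler_wpM2l ?(ltW e20)// mulrC.
    have -> : u (homothety p r x) - (u x - s * U x) =
       (f (x - s *: (x - p)) - f x + s * radial p x)
       - (f (Psi x - s *: (Psi x - q)) - f (Psi x) + s * radial q (Psi x)).
      by rewrite /u /U /r Psi_homothety homothety_sub; ring.
    apply: (le_trans (ler_normB _ _)).
    have h1 : `|x| <= M2 by exact: le_trans (hM x Tx) MM2.
    apply: (le_trans (lerD (tay p x h1 pM2) (tay q (Psi x) (PsiM _ Tx) qM2))).
    by rewrite -mulrDr ler_wpM2l ?(ltW e20)// -!mulrDl -natrD.
set G := Rintegral _ _ _ in slab expand.
have rd0 : 0 <= r ^+ d by rewrite exprn_ge0// ltW.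
have rd1 : r ^+ d <= 1 by rewrite exprn_ile1// ltW.
have rds : 1 - r ^+ d <= d.+1%:R * s.
  have /andP[bd _] := bernoulli_ineq d (ltW s0) (ltW s1).
  rewrite lerBlDr -lerBlDl; apply: le_trans bd.
  by rewrite lerD2l lerN2 ler_wpM2r ?(ltW s0)// ler_nat.
have -> : A * (1 - (1 - s) ^+ d) + (1 - s) ^+ d * (s * B) =
   (A - r ^+ d * G) + r ^+ d * (G - (A - s * B)) by rewrite /r; ring.
apply: (le_trans (ler_normD _ _)); rewrite normrM (ger0_norm rd0).
have k1 : r ^+ d * `|G - (A - s * B)| <= eta / 2 * s.
  rewrite -[leRHS]mul1r ler_pM//; apply: (le_trans expand).
  rewrite (_ : e2 * (4 * M2 * s) * m = eta / 2 * s * (m / (m + 1))); last first.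
    by rewrite /e2; field; rewrite !gt_eqF.
  by rewrite ler_piMr// mulr_ge0// ltW.
have k2 : `|A - r ^+ d * G| <= eta / 2 * s.
  apply: (le_trans slab); apply: (@le_trans _ _ (e1 * (d.+1%:R * s) * m)).
    by rewrite ler_wpM2r// ler_wpM2l// ltW.
  rewrite (_ : e1 * (d.+1%:R * s) * m = eta / 2 * s * (m / (m + 1))); last first.
    by rewrite /e1; field; rewrite !gt_eqF.
  by rewrite ler_piMr// mulr_ge0// ltW.
by apply: (le_trans (lerD k2 k1)); rewrite -mulrDl -splitr.
Qed.

End trace.

(** * Hausdorff measure of faces *)

Section hausdorff_properties.
Context (R : realType) (d k : nat).
Local Notation E := 'rV[R]_d.
Local Notation H := (@hausdorff R d k).
Local Open Scope ereal_scope.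

Lemma enorm_coord (x : E) i : (`|x ord0 i| <= enorm x)%R.
Proof.
rewrite /enorm -sqrtr_sqr ler_wsqrtr// (bigD1 i)//= lerDl.
by apply: sumr_ge0 => j _; rewrite sqr_ge0.
Qed.

Lemma le_diam (A : set E) x y : A x -> A y -> (enorm (x - y))%:E <= diam A.
Proof. by move=> Ax Ay; apply: ereal_sup_ubound; exists x => //; exists y. Qed.

Lemma hausdorff_delta_le (del : R) A : (0 < del)%R ->
  hausdorff_delta k del A <= H A.
Proof. by move=> d0; apply: ereal_sup_ubound; exists del. Qed.

Lemma hausdorff_delta_ge0 (del : R) (A : set E) : 0 <= hausdorff_delta k del A.
Proof.
apply: le_ereal_inf_tmp => _ [U [_ _] <-]; apply: nneseries_ge0 => n _ _.
exact: hausdorff_gauge_ge0.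
Qed.

Lemma hausdorff_delta_anti (del del' : R) (A : set E) : (del <= del')%R ->
  hausdorff_delta k del' A <= hausdorff_delta k del A.
Proof.
move=> dd; apply: ereal_inf_le_tmp => _ [U [AU dU] <-]; exists U => //.
by split => // i; apply: le_trans (dU i) _; rewrite lee_fin.
Qed.

(** A set of diameter at most [del] cannot meet both [A] and [B], so every admissible cover of the
    union splits into a cover of each; [UC] keeps the members that meet a given set. *)
Lemma hausdorff_delta_separated (del s t : R) (A B : set E) i :
  (del < t - s)%R -> A `<=` [set x | x ord0 i <= s]%R ->
  B `<=` [set x | t <= x ord0 i]%R ->
  hausdorff_delta k del A + hausdorff_delta k del B <= hausdorff_delta k del (A `|` B).
Proof.
move=> dst As Bt; apply: le_ereal_inf_tmp => _ [U [ABU dU] <-].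
pose UC (C : set E) n : set E := if `[< U n `&` C !=set0 >] then U n else set0.
have UC_le C : C `<=` A `|` B ->
    hausdorff_delta k del C <= \sum_(n <oo) hausdorff_gauge k (UC C n).
  move=> CAB; apply: ereal_inf_lbound; exists (UC C) => //; split.
    move=> x Cx; have [n _ Ux] := ABU x (CAB x Cx); exists n => //.
    by rewrite /UC; case: asboolP => // -[]; exists x.
  move=> n; rewrite /UC; case: asboolP => _; first exact: dU.
  by rewrite diam_set0 leNye.
apply: (le_trans (leeD (UC_le A _) (UC_le B _))); [exact: subsetUl|exact: subsetUr|].
rewrite -nneseriesD => [|n _ _|n _ _]; try exact: hausdorff_gauge_ge0.
apply: lee_nneseries => n _; first by rewrite adde_ge0// hausdorff_gauge_ge0.
have g0 : hausdorff_gauge k (set0 : set E) = 0 by rewrite /hausdorff_gauge eqxx.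
rewrite /UC; case: asboolP => [[x [Ux Ax]]|_]; last first.
  by rewrite g0 add0e; case: asboolP => // _; rewrite g0 hausdorff_gauge_ge0.
case: asboolP => [[y [Uy By]]|_]; last by rewrite g0 adde0.
have := le_trans (le_diam Uy Ux) (dU n); rewrite lee_fin => h.
have := As _ Ax; have := Bt _ By => /=.
have := le_trans (ler_norm _) (le_trans (enorm_coord (y - x)%R i) h).
by rewrite !mxE => h1 h2 h3; exfalso; lra.
Qed.

Lemma hausdorff_separated (s t : R) (A B : set E) i :
  (s < t)%R -> A `<=` [set x | x ord0 i <= s]%R ->
  B `<=` [set x | t <= x ord0 i]%R -> H A + H B <= H (A `|` B).
Proof.
move=> st As Bt.
have [->|Xoo] := eqVneq (H (A `|` B)) +oo; first by rewrite leey.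
have H0 C : 0 <= H C by exact: outer_measure_ge0.
have fX : H (A `|` B) \is a fin_num by rewrite ge0_fin_numE// ltey.
(* Two independent scales, so that the suprema defining [H A] and [H B] can be taken one after the
   other. *)
have key (d1 d2 : R) : (0 < d1)%R -> (0 < d2)%R ->
    hausdorff_delta k d1 A + hausdorff_delta k d2 B <= H (A `|` B).
  move=> d10 d20; pose del : R := Num.min (Num.min d1 d2) ((t - s) / 2)%R.
  have del0 : (0 < del)%R by rewrite !lt_min d10 d20/= divr_gt0// subr_gt0.
  have : (del <= del)%R by [].
  rewrite {2}/del !le_min => /andP[/andP[dd1 dd2] dts].
  apply: (le_trans (leeD (hausdorff_delta_anti A dd1) (hausdorff_delta_anti B dd2))).
  apply: (le_trans _ (hausdorff_delta_le _ del0)).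
  by apply: hausdorff_delta_separated As Bt; apply: le_lt_trans dts _; lra.
have fB (d2 : R) : (0 < d2)%R -> hausdorff_delta k d2 B \is a fin_num.
  move=> d20; rewrite ge0_fin_numE ?hausdorff_delta_ge0//.
  apply: (le_lt_trans (hausdorff_delta_le _ d20)).
  by apply: (@le_lt_trans _ _ (H (A `|` B))); [exact: le_outer_measure|rewrite ltey].
have fA : H A \is a fin_num.
  rewrite ge0_fin_numE//.
  by apply: (@le_lt_trans _ _ (H (A `|` B))); [exact: le_outer_measure|rewrite ltey].
rewrite addeC -leeBrDr//; apply: ge_ereal_sup => _ [d2 /= d20 <-].
rewrite leeBrDr// addeC -leeBrDr; last exact: fB.
apply: ge_ereal_sup => _ [d1 /= d10 <-].
by rewrite leeBrDr; [exact: key|exact: fB].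
Qed.

(* The layers t + 1/(n+2) < x_i <= t + 1/(n+1) of even (resp. odd) index are
   pairwise separated, so that their measures are summable. *)
Lemma caratheodory_halfspace (t : R) i :
  H.-caratheodory [set x : E | x ord0 i <= t]%R.
Proof.
apply: le_caratheodory_measurable => X.
set C := [set x | _].
suff : H (X `&` C) + H (X `&` ~` C) <= H X by [].
have H0 A : 0 <= H A by exact: outer_measure_ge0.
have [->|Xoo] := eqVneq (H X) +oo; first by rewrite leey.
have HXoo : H X < +oo by rewrite ltey.
pose Y n : set E := X `&` [set x | t + n.+1%:R^-1 < x ord0 i]%R.
pose L n : set E := X `&` [set x | t + n.+2%:R^-1 < x ord0 i <= t + n.+1%:R^-1]%R.
have inv_le m n : (m <= n)%N -> (n.+1%:R^-1 <= m.+1%:R^-1 :> R)%R.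
  by move=> mn; rewrite lef_pV2 ?posrE// ler_nat.
have layers c n : \sum_(0 <= j < n) H (L (j.*2 + c)%N) <=
    H (X `&` [set x | t + (n.*2 + c)%:R^-1 < x ord0 i]%R).
  elim: n => [|n IH]; first by rewrite big_nil.
  rewrite big_nat_recr//=; case: n IH => [_|n IH].
    rewrite big_nil add0e; apply: le_outer_measure => x [Xx /= /andP[h _]].
    by split.
  apply: (le_trans (leeD IH (le_refl _))).
  apply: (@le_trans _ _ (H ((L (n.+1.*2 + c)%N) `|`
     (X `&` [set x | t + (n.+1.*2 + c)%:R^-1 < x ord0 i]%R)))).
    rewrite addeC.
    apply: (@hausdorff_separated (t + (n.+1.*2 + c).+1%:R^-1)%R
       (t + (n.+1.*2 + c)%:R^-1)%R _ _ i).
    - by rewrite ltrD2l ltf_pV2 ?posrE// ltr_nat.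
    - by move=> x [_ /= /andP[]].
    - by move=> x [_ /= /ltW].
  apply: le_outer_measure => x [[Xx /= /andP[h _]]|[Xx /= h]]; split => //=.
  apply: le_lt_trans h; rewrite lerD2l lef_pV2 ?posrE// ler_nat.
  by rewrite leq_add2r leq_double.
have sumL : \sum_(0 <= n <oo) H (L n) < +oo.
  apply: (@le_lt_trans _ _ (H X + H X)); last by rewrite lte_add_pinfty.
  apply: lime_le; first by apply: is_cvg_nneseries.
  apply: nearW => n.
  apply: (@le_trans _ _ (\sum_(0 <= j < n.*2) H (L j))).
    apply: lee_sum_nneg_natr => //; first by rewrite -addnn leq_addr.
  have -> : \sum_(0 <= j < n.*2) H (L j) =
    \sum_(0 <= j < n) H (L (j.*2 + 0)%N) + \sum_(0 <= j < n) H (L (j.*2 + 1)%N).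
    elim: n => [|n IH]; first by rewrite !big_nil adde0.
    rewrite doubleS (big_nat_recr n.*2.+1)//= (big_nat_recr n.*2)//= IH.
    rewrite (big_nat_recr n)//= (big_nat_recr n)//= addn0 addn1.
    by rewrite addeACA addeA.
  by apply: leeD; apply: le_trans (layers _ _) _; apply: le_outer_measure => x [].
(* Outside [C], a point lies in [Y n], which is separated from [C], or in a layer of index at least
   n; the tail of the convergent series tends to 0. *)
have sub n : H (X `&` C) + H (X `&` ~` C) <= H X + \sum_(n <= j <oo) H (L j).
  have Y_le : H (X `&` C) + H (Y n) <= H X.
    apply: (@le_trans _ _ (H ((X `&` C) `|` Y n))); last first.
      by apply: le_outer_measure => x [[]|[]].
    apply: (@hausdorff_separated t (t + n.+1%:R^-1)%R _ _ i).
    - by rewrite ltrDl.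
    - by move=> x [].
    - by move=> x [_ /= /ltW].
  apply: le_trans (leeD Y_le (le_refl _)); rewrite -addeA leeD2l//.
  apply: le_trans (leeD (le_refl _) (outer_measure_sigma_subadditive_tail _ _ _)).
  apply: le_trans (outer_measureU2 _ _ _); apply: le_outer_measure.
  move=> x [Xx] /= /negP; rewrite -ltNge => tx.
  have [Yx|Yx] := ltP (t + n.+1%:R^-1)%R (x ord0 i); [by left|right].
  (* The least such m is positive, since x is not in [Y n]; its predecessor is the index of the
     layer containing x. *)
  have exm : exists m, (t + m.+1%:R^-1 < x ord0 i)%R.
    by have [m hm] := ltr_add_invr tx; exists m.
  case: (ex_minnP exm) => -[|q] hq qmin.
    by exfalso; have := lt_le_trans hq Yx; rewrite ltrD2l ltNge inv_le.
  exists q => /=.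
    by move=> /inv_le qn; have := lt_le_trans hq Yx; rewrite ltrD2l ltNge qn.
  split => //=; rewrite hq /= leNgt; apply/negP => /qmin.
  by rewrite ltnn.
have tail := nneseries_tail_cvg sumL (fun n _ => H0 (L n)).
rewrite -[leRHS]adde0.
have cv : (H X + \sum_(n <= j <oo) H (L j)) @[n --> \oo] --> H X + 0.
  by apply: cvgeD => //; [rewrite fin_num_adde_defl|exact: cvg_cst].
rewrite -(cvg_lim _ cv)//; apply: lime_ge; first by apply/cvg_ex; exists (H X + 0).
by apply: nearW => n; exact: sub.
Qed.

End hausdorff_properties.

(** * Hausdorff measure under similarities *)

Section hausdorff_similarity.
Context (R : realType) (d k : nat).
Local Notation E := 'rV[R]_d.
Local Notation H := (@hausdorff R d k).
Local Open Scope ereal_scope.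

Lemma le_expe (x y : \bar R) n : 0 <= x -> x <= y -> x ^+ n <= y ^+ n.
Proof.
move=> x0 xy; elim: n => [|n IH]; first by rewrite !expe0.
by rewrite !expeS lee_pmul// expe_ge0.
Qed.

Lemma expeMl_fin (r : R) (x : \bar R) n : (r%:E * x) ^+ n = (r ^+ n)%:E * x ^+ n.
Proof.
elim: n => [|n IH]; first by rewrite !expe0 expr0 mul1e.
by rewrite !expeS IH exprS EFinM muleACA.
Qed.

Lemma hausdorff_weight_ge0 : 0 <= hausdorff_weight R k.
Proof. by rewrite /hausdorff_weight mule_ge0// lee_fin exprn_ge0// invr_ge0. Qed.

Variables (g : E -> E) (r : R).
Hypotheses (r0 : (0 < r)%R)
  (hg : forall x y, enorm (g x - g y) = (r * enorm (x - y))%R).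

Lemma diam_similarity A : diam (g @` A) <= r%:E * diam A.
Proof.
apply: ge_ereal_sup => _ [_ [x Ax <-]] [_ [y Ay <-]] <-.
rewrite hg EFinM; apply: lee_wpmul2l; first by rewrite lee_fin ltW.
exact: le_diam.
Qed.

Lemma enorm0 : enorm (0 : E) = 0%R.
Proof. by rewrite /enorm big1 ?sqrtr0// => i _; rewrite mxE expr0n. Qed.

Lemma hausdorff_gauge_similarity A :
  hausdorff_gauge k (g @` A) <= (r ^+ k)%:E * hausdorff_gauge k A.
Proof.
rewrite /hausdorff_gauge; have [->|A0] := eqVneq A set0.
  by rewrite image_set0 eqxx mule0.
have [x Ax] : A !=set0 by exact/set0P.
rewrite ifF; last by apply/negP => /eqP/seteqP[/(_ (g x))] h _; apply: h; exists x.
rewrite muleCA; apply: lee_wpmul2l; first exact: hausdorff_weight_ge0.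
rewrite -expeMl_fin; apply: le_expe; last exact: diam_similarity.
have gx : (g @` A) (g x) by exists x.
by have := le_diam gx gx; rewrite subrr enorm0.
Qed.

Lemma hausdorff_similarity A : H (g @` A) <= (r ^+ k)%:E * H A.
Proof.
apply: ge_ereal_sup => _ [del /= del0 <-].
have rk0 : (0 < r ^+ k)%R by rewrite exprn_gt0.
have del'0 : (0 < del / r)%R by rewrite divr_gt0.
apply: (@le_trans _ _ ((r ^+ k)%:E * hausdorff_delta k (del / r) A)); last first.
  by rewrite lee_pmul2l//; exact: hausdorff_delta_le.
rewrite -lee_pdivrMl//; apply: le_ereal_inf_tmp => _ [U [AU dU] <-].
rewrite lee_pdivrMl// -nneseriesZl; last by move=> n _; exact: hausdorff_gauge_ge0.
apply: (@le_trans _ _ (\sum_(n <oo) hausdorff_gauge k (g @` (U n)))).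
  apply: ereal_inf_lbound; exists (fun n => g @` (U n)) => //; split.
    by move=> _ [x Ax <-]; have [n _ Ux] := AU x Ax; exists n => //; exists x.
  move=> n; apply: (le_trans (diam_similarity _)).
  rewrite -lee_pdivlMl// -EFinM mulrC; exact: dU.
apply: lee_nneseries => n _; first by move=> _; exact: hausdorff_gauge_ge0.
exact: hausdorff_gauge_similarity.
Qed.

End hausdorff_similarity.

Lemma enormZ (R : realType) d (s : R) (x : 'rV[R]_d) :
  enorm (s *: x) = `|s| * enorm x.
Proof.
rewrite /enorm -sqrtr_sqr -sqrtrM ?sqr_ge0// mulr_sumr.
by congr Num.sqrt; apply: eq_bigr => i _; rewrite mxE exprMn.
Qed.

Section hausdorff_maps.
Context (R : realType) (d k : nat).
Local Notation E := 'rV[R]_d.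
Local Notation H := (@hausdorff R d k).

Lemma hausdorff_homothety (c : E) (r : R) A : 0 < r ->
  (H (homothety c r @` A) <= (r ^+ k)%:E * H A)%E.
Proof.
move=> r0; apply: hausdorff_similarity => // x y.
rewrite /homothety opprD addrACA subrr add0r -scalerBr opprB addrA subrK.
by rewrite enormZ gtr0_norm.
Qed.

Lemma hausdorff_translation (v : E) (A : set E) :
  H [set x : E | A (x + v)] = H A.
Proof.
have tr (w : E) (B : set E) : (H [set x : E | B (x + w)%R] <= H B)%E.
  have iso (x y : E) : enorm (x - w - (y - w)) = 1 * enorm (x - y).
    by rewrite mul1r opprB addrA subrK.
  have := @hausdorff_similarity R d k (fun x : E => x - w) 1 ltr01 iso B.
  rewrite expr1n mul1e; apply: le_trans.
  by apply: le_outer_measure => x /= Bx; exists (x + w) => //; rewrite addrK.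
apply/eqP; rewrite eq_le tr /=.
rewrite [X in (H X <= _)%E](_ : A = [set x : E | [set y : E | A (y + v)] (x - v)]) ?tr//.
by apply/seteqP; split => x /=; rewrite subrK.
Qed.

End hausdorff_maps.

(** * The surface measure on Borel sets *)

Section borel_surface.
Context (R : realType) (d : nat).
Local Notation E := 'rV[R]_d.
Local Notation S := (@surface R d).

(** The identity between two sigma-algebras on one set. Its measurability says that Borel sets are
    Caratheodory measurable; pushing [surface] along it gives a Borel measure, the kind that
    [haar_unique] handles. *)
Definition borel_of_cara (x : caratheodory_type (@surface_outer R d)) : E := x.

Lemma measurable_borel_of_cara : measurable_fun setT borel_of_cara.
Proof.
apply: measurable_fun_rVP => i.
apply: (measurability _ (RGenOInfty.measurableE R)) => _ [_ [t ->] <-].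
rewrite setTI.
rewrite (_ : _ @^-1` _ = ~` [set x : E | x ord0 i <= t]).
  by apply: measurableC; exact: caratheodory_halfspace.
apply/seteqP; split => x /=; rewrite in_itv/= andbT.
  by rewrite ltNge => /negP.
by move=> /negP; rewrite -ltNge.
Qed.

Definition borel_surface : set E -> \bar R := pushforward S borel_of_cara.
HB.instance Definition _ := Measure.copy borel_surface
  (measure_function_pushforward__canonical__measure_function_Measure S
     measurable_borel_of_cara).

Lemma borel_surfaceE A : borel_surface A = hausdorff d.-1 A.
Proof. by []. Qed.

Lemma measurable_cara (A : set E) : measurable A ->
  measurable (A : set (caratheodory_type (@surface_outer R d))).
Proof. by move=> mA; exact: (measurable_preimageT measurable_borel_of_cara mA). Qed.

End borel_surface.

Section sigma_finite_of.
Context (R : realType) (d : measure_display) (T : measurableType d).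
Variable m : {measure set T -> \bar R}.

(** The proof [sf] is an argument so that sigma-finiteness proved under section hypotheses becomes
    part of the type. *)
Definition sigma_finite_of of sigma_finite setT m : set T -> \bar R := m.

Variable sf : sigma_finite setT m.
HB.instance Definition _ := Measure.copy (sigma_finite_of sf) m.
HB.instance Definition _ := Measure_isSigmaFinite.Build _ _ _ (sigma_finite_of sf) sf.
End sigma_finite_of.

(** * Symmetry of the surface measure on a face *)

Section face_mean.
Context (R : realType) (d : nat).
Local Notation E := 'rV[R]_d.
Local Notation S := (@surface R d).
Variables (a : 'I_d.+1 -> E) (i : 'I_d.+1).
Hypotheses (d0 : (0 < d)%N) (ai : affinely_independent a).
Local Notation lam := (barycentric a).
Local Notation F := (hull a [set~ i]%SET).
Local Notation H := (@hausdorff R d d.-1).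
Hypotheses (HF0 : (0 < H F)%E) (HFoo : (H F < +oo)%E).

Lemma faceE : F = [set x | lam i x = 0 /\ forall j, 0 <= lam j x].
Proof.
rewrite hullE//; apply/seteqP; split => x /=.
  move=> h; split; first by have [_] := h i; apply; rewrite !inE eqxx.
  by move=> j; have [] := h j.
by move=> [h1 h2] j; split => //; rewrite !inE negbK => /eqP ->.
Qed.

Let P : set E := [set x | lam i x = 0].

Let mP : measurable P.
Proof.
apply: (measurable_preimageT (f := lam i) (A := [set 0])) => //.
exact: measurable_bary.
Qed.

Let mF : measurable F. Proof. exact: measurable_hull. Qed.

Let eta0 := mrestr (borel_surface (R := R) (d := d)) mP.

Let bc (j : 'I_d.+1) : R := if j == i then 0 else d%:R^-1.

Let sum_bc : \sum_j bc j = 1.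
Proof.
rewrite (bigD1 i)//= /bc eqxx add0r.
under eq_bigr => j ji do rewrite (negbTE ji).
rewrite sumr_const (_ : #|_| = d).
  by rewrite -[LHS]mulr_natr mulVf// pnatr_eq0 -lt0n.
by rewrite cardC1 card_ord.
Qed.

Let c : E := \sum_j bc j *: a j.

Let lam_c j : lam j c = bc j. Proof. exact: bary_uniq. Qed.

Let lam_homothety r x j : lam j (homothety c r x) = (1 - r) * bc j + r * lam j x.
Proof. by rewrite /homothety baryDZ// -baryB// lam_c; ring. Qed.

(** The hyperplane [P] is exhausted by enlargements of [F] about its barycenter [c], which have
    finite measure by [hausdorff_homothety]; the complement of [P] has measure 0 under [eta0]. *)
Let sigma_finite_eta : sigma_finite setT eta0.
Proof.
exists (fun n => (homothety c n.+1%:R^-1 @^-1` F) `|` ~` P).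
  apply/esym; rewrite -subTset => x _.
  have [Px|nPx] := pselect (P x); last by exists 0%N => //; right.
  have dR : 0 < d%:R^-1 :> R by rewrite invr_gt0 ltr0n.
  pose M := \sum_j `|lam j x|.
  have lM j : - M <= lam j x.
    rewrite lerNl; apply: (le_trans (ler_norm _)); rewrite normrN.
    by rewrite /M (bigD1 j)//= lerDl; apply: sumr_ge0.
  (* Chosen with (n+1)/d > M. Index n+1 has ratio 1/(n+2), and the contracted j-th coordinate is
     ((n+1)/d + lam j x)/(n+2) >= 0 for j other than i. *)
  pose n := Num.truncn (M / d%:R^-1).
  have hn : M < n.+1%:R * d%:R^-1 by rewrite -ltr_pdivrMr// truncnS_gt.
  exists n.+1 => //; left => /=; rewrite faceE /= lam_homothety.
  have e0 : bc i = 0 by rewrite /bc eqxx.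
  split; first by rewrite e0 Px !mulr0 addr0.
  move=> j; rewrite lam_homothety /bc; case: eqP => [->|_].
    by rewrite Px !mulr0 addr0.
  rewrite (_ : _ + _ = n.+2%:R^-1 * (n.+1%:R * d%:R^-1 + lam j x)); last first.
    rewrite mulrDr; congr (_ + _); rewrite mulrA; congr (_ * _).
    have -> : n.+1%:R = n.+2%:R - 1 :> R by rewrite -[n.+2%:R]natr1 addrK.
    by rewrite mulrBr mulr1 mulVf// pnatr_eq0.
  by rewrite mulr_ge0// (le_trans _ (lerD (ltW hn) (lM j))) ?subrr.
move=> n; have mG : measurable (homothety c n.+1%:R^-1 @^-1` F).
  by apply: measurable_preimageT mF; exact: measurable_homothety.
split; first by apply: measurableU mG _; exact: measurableC.
rewrite /eta0 /mrestr setIUl setICl setU0 borel_surfaceE.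
apply: (@le_lt_trans _ _ (H (homothety c n.+1%:R @` F))).
  apply: le_outer_measure => x [/= Fx _]; exists (homothety c n.+1%:R^-1 x) => //.
  by rewrite -[X in homothety c X (homothety _ _ _)]invrK homothetyK// invr_neq0.
apply: (le_lt_trans (@hausdorff_homothety R d d.-1 c n.+1%:R F (ltr0Sn R n))).
by rewrite lte_mul_pinfty// lee_fin exprn_ge0.
Qed.

Let eta := sigma_finite_of sigma_finite_eta.

Let etaE A : eta A = H (A `&` P). Proof. by []. Qed.

Let eta_inv y o A : P y -> P o -> measurable A ->
  eta [set x | A (x + (y - o))] = eta A.
Proof.
move=> Py Po mA; rewrite !etaE -[RHS](@hausdorff_translation _ _ _ (y - o)).
congr H; apply/seteqP; split => x [h1 h2]; split => //=; move: h2;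
  by rewrite /P /= baryD// -baryB// Py Po subrr addr0.
Qed.

Section swap.
Variables (j k : 'I_d.+1).
Hypotheses (ji : j != i) (ki : k != i).

(** The affine involution exchanging [a j] and [a k] and fixing the other vertices. *)
Definition swap_vertices (x : E) : E := x + (lam j x - lam k x) *: (a k - a j).
Local Notation sw := swap_vertices.

Let lam_sw x l : lam l (sw x) =
  lam l x + (lam j x - lam k x) * ((l == k)%:R - (l == j)%:R).
Proof. by rewrite /sw baryDZ// dbaryB_vertex. Qed.

Lemma continuous_swap : continuous sw.
Proof.
by apply: continuous_addZ; apply: continuous_subf; exact: continuous_bary.
Qed.

Let lam_j_sw x : lam j (sw x) = lam k x.
Proof.
rewrite lam_sw eqxx; have [->|_] := eqVneq j k; first by rewrite !subrr mul0r addr0.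
by rewrite sub0r mulrN1; ring.
Qed.

Let lam_k_sw x : lam k (sw x) = lam j x.
Proof.
rewrite lam_sw eqxx [k == j]eq_sym; have [->|_] := eqVneq j k; first by rewrite !subrr mul0r addr0.
by rewrite subr0 mulr1; ring.
Qed.

Let swK : cancel sw sw.
Proof.
move=> x; rewrite {1}/sw lam_j_sw lam_k_sw /sw -addrA -scalerDl.
by rewrite subrKA subrr scale0r addr0.
Qed.

Let lam_i_sw x : lam i (sw x) = lam i x.
Proof.
by rewrite lam_sw eq_sym (negbTE ki) eq_sym (negbTE ji) subrr mulr0 addr0.
Qed.

Let sw_add z y o : sw (z + (sw y - sw o)) = sw z + (y - o).
Proof.
have lD l : lam l (z + (sw y - sw o)) = lam l z + (lam l (sw y) - lam l (sw o)).
  by rewrite baryD// -baryB.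
rewrite {1}/sw !lD !lam_j_sw !lam_k_sw /sw.
apply/rowP => l; rewrite !mxE; ring.
Qed.

Let sw_F : sw @^-1` F = F.
Proof.
have sub x : F x -> F (sw x).
  rewrite !faceE /= => -[h1 h2]; split; first by rewrite lam_i_sw.
  move=> l; have [->|lj] := eqVneq l j; first by rewrite lam_j_sw.
  have [->|lk] := eqVneq l k; first by rewrite lam_k_sw.
  by rewrite lam_sw (negbTE lj) (negbTE lk) subrr mulr0 addr0.
by apply/seteqP; split => x /= h; [rewrite -[x]swK|]; exact: sub.
Qed.

Let msw : measurable_fun setT sw.
Proof. by apply: continuous_rV_measurable_map; exact: continuous_swap. Qed.

Let swP x : P (sw x) = P x. Proof. by rewrite /P /= lam_i_sw. Qed.

Let etaF : eta F = H F.
Proof.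
by rewrite etaE; congr H; rewrite setIidl// => x; rewrite faceE => -[].
Qed.

(** The swap is in general no isometry, so the metric definition of the measure does not give
    invariance. It permutes the translations of [P], so [haar_unique] yields a constant factor, and
    the factor is 1 because the swap maps [F] onto itself. *)
Lemma swap_invariant A : measurable A -> eta (sw @^-1` A) = eta A.
Proof.
move=> mA.
have Pc : P c by rewrite /P /= lam_c /bc eqxx.
have fF : eta F \is a fin_num by rewrite ge0_fin_numE// etaF.
have : (eta (sw @^-1` A) * eta F = eta (sw @^-1` F) * eta A)%E.
  apply: (@haar_unique _ _ (image_measure eta msw msw swK) eta P c mP) => //.
  - suff : H ((sw @^-1` (~` P)) `&` P) = 0%E by [].
    rewrite (_ : _ `&` _ = set0) ?outer_measure0//.
    by apply/seteqP; split => // x [/=]; rewrite swP.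
  - suff : H ((~` P) `&` P) = 0%E by [].
    by rewrite setICl outer_measure0.
  - move=> y B Py mB.
    suff : eta (sw @^-1` [set x | B (x + (y - c))]) = eta (sw @^-1` B) by [].
    rewrite -(@eta_inv (sw y) (sw c) (sw @^-1` B)).
    + by congr eta; apply/seteqP; split => x /=; rewrite sw_add.
    + by rewrite swP.
    + by rewrite swP.
    + exact: measurable_preimageT.
  - by move=> y B Py mB; exact: eta_inv.
  - by suff : (0 < eta F)%E by []; rewrite etaF.
  - by suff : (eta F < +oo)%E by []; rewrite etaF.
rewrite sw_F [RHS]muleC -(fineK fF).
move=> /(congr1 (fun z => z * (fine (eta F))^-1%:E)%E).
rewrite -!muleA -EFinM mulfV ?mule1//.
by rewrite gt_eqF// fine_gt0// etaF HF0.
Qed.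

Lemma integrable_bary_eta l : eta.-integrable F (EFin \o lam l).
Proof.
apply: measurable_bounded_integrable => //.
- by suff : (eta F < +oo)%E by []; rewrite etaF.
- by apply: measurable_funTS; exact: measurable_bary.
- exists 1; split => // N hN x Fx /=.
  have Tx := hull_sub_cell ai Fx; have := bary_le1 ai l Tx; move: Tx; rewrite cellE// => h.
  by rewrite ger0_norm//; lra.
Qed.

Lemma swap_integral : \int[eta]_(x in F) lam j x = \int[eta]_(x in F) lam k x.
Proof.
have e1 A : measurable A -> (1%:E * eta (sw @^-1` A) = 1%:E * eta A)%E.
  by move=> mA; rewrite swap_invariant.
have := @Rintegral_affine _ _ _ eta _ _ _ msw ler01 ler01 e1 F (lam k) mF (measurable_bary a k).
rewrite sw_F !mul1r => <-.
- by apply: eq_Rintegral => x _; rewrite lam_k_sw.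
- rewrite (_ : _ \o _ = EFin \o lam j); first exact: integrable_bary_eta.
  by apply/funext => x /=; rewrite lam_k_sw.
- exact: integrable_bary_eta.
Qed.

End swap.

Let cF : measurable (F : set (caratheodory_type (@surface_outer R d))).
Proof. by apply: measurable_cara; exact: measurable_hull. Qed.

Let mlam l : measurable_fun (F : set (caratheodory_type (@surface_outer R d))) (lam l).
Proof.
apply: measurable_funTS.
exact: (measurableT_comp (measurable_bary a l) (@measurable_borel_of_cara R d)).
Qed.

Lemma integrable_bary_surface l :
  S.-integrable (F : set (caratheodory_type (@surface_outer R d))) (EFin \o lam l).
Proof.
apply: measurable_bounded_integrable; [exact: cF|exact: HFoo|exact: mlam|].
exists 1; split => // N hN x Fx /=.
have Tx := hull_sub_cell ai Fx; have := bary_le1 ai l Tx; move: Tx; rewrite cellE// => h.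
by rewrite ger0_norm//; lra.
Qed.

(** The integral passes from the Caratheodory to the Borel sigma-algebra by a pushforward, and then
    to [eta] because [F] lies in [P]; there the swap exchanges the two coordinates. *)
Lemma surface_bary_eq j k : j != i -> k != i ->
  \int[S]_(x in F) lam j x = \int[S]_(x in F) lam k x.
Proof.
move=> ji ki.
suff e l : \int[S]_(x in F) lam l x = \int[eta]_(x in F) lam l x.
  by rewrite !e; exact: swap_integral.
rewrite /Rintegral; congr fine.
transitivity (\int[borel_surface (d := d)]_(x in F) (lam l x)%:E)%E.
  apply: esym; apply: (@integral_pushforward _ _ _ _ R _
    (@measurable_borel_of_cara R d) S F (EFin \o lam l)) => //.
  - by apply/measurable_EFinP; exact: measurable_bary.
  - exact: integrable_bary_surface.
apply: eq_measure_integral => A mA AF.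
suff : H A = H (A `&` P) by [].
by congr H; rewrite setIidl// => x /AF; rewrite faceE => -[].
Qed.

End face_mean.

(** * L2 norms and jumps *)

Section normL2_integral.
Context (R : realType) (dsp : measure_display) (T : measurableType dsp).
Variables (mu : {measure set T -> \bar R}) (D : set T).
Implicit Types f g : T -> R.

Lemma Lnorm2E f : ('N[mu]_2%:E [EFin \o (f \_ D)] =
  (\int[mu]_(x in D) (f x ^+ 2)%:E) `^ 2^-1)%E.
Proof.
rewrite unlock /Lnorm (_ : (2 : R)^-1 = 2%R^-1)//; congr poweR.
rewrite [RHS]integral_mkcond; apply: eq_integral => x _ /=.
rewrite /patch; case: ifPn => _.
  by rewrite /= powR_mulrn// real_normK// num_real.
by rewrite (_ : point = 0 :> R)// normr0 powR0.
Qed.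

(** Valid without integrability: for an infinite integral, [fine] makes both sides 0. *)
Lemma normL2E f : normL2 mu D f = Num.sqrt (\int[mu]_(x in D) (f x ^+ 2)).
Proof.
rewrite /normL2 Lnorm2E /Rintegral.
have : (0 <= \int[mu]_(x in D) (f x ^+ 2)%:E)%E.
  by apply: integral_ge0 => x _; rewrite lee_fin sqr_ge0.
case: (integral _ _ _) => [r| |]//; last by rewrite poweRyr ?invr_eq0// sqrtr0.
by rewrite lee_fin poweR_EFin /= => r0; rewrite powR12_sqrt.
Qed.

Lemma sqr_normL2 f : normL2 mu D f ^+ 2 = \int[mu]_(x in D) (f x ^+ 2).
Proof.
by rewrite normL2E sqr_sqrtr// Rintegral_ge0// => x _; rewrite sqr_ge0.
Qed.

Lemma normL2_ge0 f : 0 <= normL2 mu D f.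
Proof. by rewrite normL2E sqrtr_ge0. Qed.

Hypothesis mD : measurable D.

Lemma integrable_sumR (I : Type) (s : seq I) (P : pred I) (h : I -> T -> R) :
  (forall i, mu.-integrable D (EFin \o h i)) ->
  mu.-integrable D (EFin \o (fun x => \sum_(i <- s | P i) h i x)).
Proof.
move=> ih; apply: (eq_integrable mD (fun x => \sum_(i <- s | P i) (h i x)%:E)%E).
  by move=> x _ /=; rewrite sumEFin.
by apply: integrable_sum => // i _; exact: ih.
Qed.

Lemma Rintegral_sum (I : Type) (s : seq I) (P : pred I) (h : I -> T -> R) :
  (forall i, mu.-integrable D (EFin \o h i)) ->
  \int[mu]_(x in D) (\sum_(i <- s | P i) h i x) =
  \sum_(i <- s | P i) \int[mu]_(x in D) h i x.
Proof.
move=> ih; elim: s => [|i s IH].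
  by under eq_Rintegral do rewrite big_nil; rewrite Rintegral_cst// mul0r big_nil.
under eq_Rintegral do rewrite big_cons; rewrite big_cons.
case: ifPn => // _; rewrite RintegralD// ?IH//.
exact: integrable_sumR.
Qed.

Lemma inL2_measurable f : inL2 mu D f -> measurable_fun D f.
Proof.
move=> /andP[]; rewrite inE /= => mf _.
exact/(measurable_restrictT f mD).
Qed.

Lemma inL2_integrable_sqr f : inL2 mu D f ->
  mu.-integrable D (EFin \o (fun x => f x ^+ 2)).
Proof.
move=> fL; have mf := inL2_measurable fL; apply/integrableP; split.
  by apply/measurable_EFinP; exact: measurable_funX.
move: fL => /andP[_]; rewrite inE /= /finite_norm Lnorm2E => foo.
rewrite (eq_integral (fun x => (f x ^+ 2)%:E)); last first.
  by move=> x _ /=; rewrite ger0_norm// sqr_ge0.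
rewrite ltNge leye_eq; apply/negP => /eqP h.
by move: foo; rewrite h poweRyr// invr_eq0.
Qed.

Lemma integrable_mulL2 f g : measurable_fun D f -> measurable_fun D g ->
  mu.-integrable D (EFin \o (fun x => f x ^+ 2)) ->
  mu.-integrable D (EFin \o (fun x => g x ^+ 2)) ->
  mu.-integrable D (EFin \o (fun x => f x * g x)).
Proof.
move=> mf mg f2 g2.
have fg : mu.-integrable D (EFin \o (fun x => f x ^+ 2 + g x ^+ 2)).
  by apply: eq_integrable (integrableD mD f2 g2) => // x _.
apply: le_integrable fg => //.
  by apply/measurable_EFinP; exact: measurable_funM.
move=> x _ /=; rewrite lee_fin normrM (ger0_norm (addr_ge0 (sqr_ge0 _) (sqr_ge0 _))).
rewrite -(real_normK (num_real (f x))) -(real_normK (num_real (g x))).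
have := sqr_ge0 (`|f x| - `|g x|); have := normr_ge0 (f x); have := normr_ge0 (g x).
move: `|f x| `|g x| => u v v0 u0; rewrite !expr2 => h.
have : 0 <= u * v by rewrite mulr_ge0.
lra.
Qed.

End normL2_integral.

Section face_jump.
Context (R : realType) (d : nat).
Local Notation E := 'rV[R]_d.
Local Notation S := (@surface R d).
Variables (a : 'I_d.+1 -> E) (i : 'I_d.+1).
Hypotheses (d0 : (0 < d)%N) (ai : affinely_independent a).
Local Notation lam := (barycentric a).
Local Notation F := (hull a [set~ i]%SET).
Local Notation H := (@hausdorff R d d.-1).

Let mF : measurable (F : set (caratheodory_type (@surface_outer R d))).
Proof. by apply: measurable_cara; exact: measurable_hull. Qed.

(* When F has infinite measure, the normL2 of a nonzero constant is fine +oo = 0. *)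
Lemma face_jump_sqr_eq0 (g : E -> R) (cc : 'I_d.+1 -> R) :
  (forall x, F x -> g x = \sum_j cc j * lam j x) -> \sum_(j | j != i) cc j = 0 ->
  face_jump_sqr F g = 0.
Proof.
move=> gE cc0; rewrite /face_jump_sqr sqr_normL2.
have cstE c : \int[S]_(x in F) (cst c x ^+ 2) = c ^+ 2 * fine (S F).
  exact: (Rintegral_cst S mF (c ^+ 2)).
(* A zero [fine] covers both a null face and a face of infinite measure; otherwise the measure is
   positive and finite, as [surface_bary_eq] requires. *)
rewrite cstE; have [->|HF0] := eqVneq (fine (S F)) 0; first by rewrite mulr0.
have S0 : (0 <= S F)%E by [].
have HFoo : (H F < +oo)%E.
  by move: HF0; rewrite ltey; apply: contra => /eqP h; rewrite [S F]h.
have HFgt0 : (0 < H F)%E.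
  rewrite lt_neqAle S0 andbT; apply: contra HF0 => /eqP h.
  by rewrite [S F](esym h).
suff -> : proj_const F g = 0 by rewrite expr0n mul0r.
rewrite /proj_const; set A := [set _ | _].
(* If no constant qualifies, [xget] returns its default 0, which is the claim. Otherwise testing
   with k = 1 shows that y times the measure of [F] is the integral of g, which vanishes. *)
have [y _ Ay|//] := xgetP 0 A.
have ib := integrable_bary_surface ai HFoo.
have iZ j : S.-integrable (F : set (caratheodory_type (@surface_outer R d)))
    (EFin \o (fun x => cc j * lam j x)).
  by apply: eq_integrable (integrableZl mF (cc j) (ib j)).
have iS := integrable_sumR mF (index_enum _) xpredT iZ.
have ic : S.-integrable (F : set (caratheodory_type (@surface_outer R d)))
    (EFin \o (cst y)).
  apply: measurable_bounded_integrable; [exact: mF|exact: HFoo|exact: measurable_cst|].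
  by exists `|y|; split; [exact: num_real|move=> N hN x _ /=; exact: ltW].
have gE2 : {in (F : set (caratheodory_type (@surface_outer R d))),
   (fun x => (g x - y) * 1) =1 (fun x => \sum_j cc j * lam j x - cst y x)}.
  by move=> x; rewrite inE => Fx; rewrite mulr1 gE.
have := etrans (esym (eq_Rintegral S gE2)) (Ay 1); rewrite RintegralB//.
rewrite [X in _ - X](Rintegral_cst S mF y).
have -> : \int[S]_(x in F) (\sum_j cc j * lam j x) = 0.
  have iE j : \int[S]_(x in F) (cc j * lam j x) = cc j * \int[S]_(x in F) lam j x.
    by rewrite RintegralZl//; exact: ib.
  rewrite (Rintegral_sum mF (index_enum _) xpredT iZ).
  under eq_bigr => j _ do rewrite iE.
  have z : \int[S]_(x in F) lam i x = 0.
    rewrite (@eq_Rintegral _ _ _ S F (cst 0)); last first.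
      by move=> x; rewrite inE faceE// => -[].
    by rewrite (Rintegral_cst S mF 0) mul0r.
  rewrite (bigD1 i)//= z mulr0 add0r.
  have [j0 j0i|nj] := pickP (fun j => j != i); last by rewrite big_pred0.
  rewrite (eq_bigr (fun j => cc j * \int[S]_(x in F) lam j0 x)); last first.
    by move=> j ji; rewrite (surface_bary_eq d0 ai HFgt0 HFoo ji j0i).
  by rewrite -mulr_suml cc0 mul0r.
rewrite sub0r => /eqP; rewrite oppr_eq0 mulf_eq0 (negbTE HF0) orbF => /eqP.
by [].
Qed.

End face_jump.

(** * Crouzeix-Raviart interpolation on a cell *)

Section derive_affine.
Context (R : realType) (d : nat).
Local Notation E := 'rV[R]_d.

Lemma derive_affine (g : E -> R) (x v : E) (m : R) :
  (forall s, g (x + s *: v) = g x + s * m) -> 'D_v g x = m.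
Proof.
move=> gE; apply: cvg_lim => //.
apply: (@cvg_trans _ (cst m @ (0 : R)^')); last exact: cvg_cst.
apply: near_eq_cvg; near=> h => /=.
rewrite [h *: v + x]addrC gE [g x + _]addrC addrK scalerA mulVf ?scale1r//.
by near: h; exact: nbhs_dnbhs_neq.
Unshelve. all: by end_near. Qed.

Lemma derive_near0 (g : E -> R) (x v : E) :
  (\forall y \near x, g y = 0) -> 'D_v g x = 0.
Proof.
move=> g0; have -> : 'D_v g x = 'D_v (cst (0 : R)) x by exact: near_eq_derive.
exact: derive_cst.
Qed.

End derive_affine.

(** * Matching the vertices of two cells that share a face *)

Section vertex_matching.
Context (R : realType) (d : nat).
Local Notation E := 'rV[R]_d.
Variables (a b : 'I_d.+1 -> E).
Hypotheses (ai : affinely_independent a) (bi : affinely_independent b).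

Lemma bary_comb k n (t : 'I_n -> R) (y : 'I_n -> E) :
  \sum_l t l = 1 ->
  barycentric a k (\sum_l t l *: y l) = \sum_l t l * barycentric a k (y l).
Proof.
move=> t1.
rewrite (_ : \sum_l t l *: y l =
    \sum_m (\sum_l t l * barycentric a m (y l)) *: a m).
  rewrite bary_uniq//; rewrite exchange_big/= -[RHS]t1; apply: eq_bigr => l _.
  by rewrite -mulr_sumr sum_bary// mulr1.
under [RHS]eq_bigr => m _ do rewrite scaler_suml.
rewrite exchange_big/=; apply: eq_bigr => l _.
under [RHS]eq_bigr => m _ do rewrite -scalerA.
by rewrite -scaler_sumr sum_baryZ.
Qed.

Variables (i j : 'I_d.+1).
Hypothesis ab : hull a [set~ i]%SET = hull b [set~ j]%SET.

(** Vertices are extreme points. Write [a k] as a convex combination of the [b l]: its k-th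
    coordinate is 1, the largest possible on the face, so every [b l] of positive weight has k-th
    coordinate 1 and equals [a k]. *)
Lemma face_vertex k : k != i -> exists l, l != j /\ a k = b l.
Proof.
move=> ki.
have : hull a [set~ i]%SET (a k).
  by rewrite hullE// => m; rewrite bary_vertex//; split => //;
    rewrite !inE negbK => /eqP ->; rewrite eq_sym (negbTE ki).
rewrite ab => -[t [t0 tj t1 akE]].
have tjj : t j = 0 by apply: tj; rewrite !inE eqxx.
have bl1 l : l != j -> (forall m, 0 <= barycentric a m (b l)) /\ barycentric a k (b l) <= 1.
  move=> lj; have : hull a [set~ i]%SET (b l).
    rewrite ab hullE// => m; rewrite bary_vertex//; split => //.
    by rewrite !inE negbK => /eqP ->; rewrite eq_sym (negbTE lj).
  move=> /(hull_sub_cell ai) Tb; split; last exact: bary_le1.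
  by move: Tb; rewrite cellE.
have s1 : \sum_l t l * (1 - barycentric a k (b l)) = 0.
  under eq_bigr => l _ do rewrite mulrBr mulr1.
  by rewrite sumrB t1 -bary_comb// -akE bary_vertex// eqxx subrr.
have [l tl] : exists l, t l != 0.
  apply/existsP; apply: contra_eqT t1 => /existsPn h.
  rewrite big1 ?(eq_sym 0) ?oner_eq0// => l _.
  by apply/eqP; have := h l; rewrite negbK.
have lj : l != j by apply: contra tl => /eqP ->; rewrite tjj.
exists l; split => //.
have /eqP : t l * (1 - barycentric a k (b l)) = 0.
  have ge m : 0 <= t m * (1 - barycentric a k (b m)).
    have [->|mj] := eqVneq m j; first by rewrite tjj mul0r.
    by rewrite mulr_ge0// subr_ge0; have [] := bl1 _ mj.
  move/eqP: s1; rewrite psumr_eq0; last by move=> m _; exact: ge.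
  by move=> /allP/(_ l (mem_index_enum _)) /eqP.
rewrite mulf_eq0 (negbTE tl) /= subr_eq0 => /eqP bk.
have [b0 _] := bl1 _ lj.
rewrite -[RHS](sum_baryZ ai) (bigD1 k)//= -bk scale1r big1 ?addr0// => m mk.
have : \sum_(m | m != k) barycentric a m (b l) = 0.
  by have := sum_bary ai (b l); rewrite (bigD1 k)//= -bk => /eqP; rewrite addrC -subr_eq0 addrK => /eqP.
move=> /eqP; rewrite psumr_eq0// => /allP/(_ m (mem_index_enum _)); rewrite mk /=.
by move=> /eqP ->; rewrite scale0r.
Qed.

Lemma face_matching : exists tau : 'I_d.+1 -> 'I_d.+1,
  [/\ bijective tau, tau i = j & forall k, k != i -> a k = b (tau k)].
Proof.
have h k : exists l, if k == i then l = j else l != j /\ a k = b l.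
  by case: eqP => [|/eqP ki]; [exists j|exact: face_vertex].
have [tau htau] := choice h; exists tau.
have ti : tau i = j by have := htau i; rewrite eqxx.
have tk k : k != i -> tau k != j /\ a k = b (tau k).
  by move=> ki; have := htau k; rewrite (negbTE ki).
split => //; last by move=> k /tk[].
apply: injF_bij => k l kl.
have [ki|ki] := eqVneq k i.
  have [li|li] := eqVneq l i; first by rewrite ki li.
  by have [] := tk _ li; rewrite -kl ki ti eqxx.
have [li|li] := eqVneq l i; first by have [] := tk _ ki; rewrite kl li ti eqxx.
have [_ ak] := tk _ ki; have [_ al] := tk _ li.
have := bary_vertex ai k l; rewrite al -kl -ak bary_vertex// eqxx.
by case: eqP => // _ /eqP; rewrite oner_eq0.
Qed.

End vertex_matching.

Lemma cross_mul_eq (F : fieldType) (x y a b : F) :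
  a != 0 -> b != 0 -> b * x = a * y -> x / a = y / b.
Proof.
move=> a0 b0 h; apply/eqP; rewrite eqr_div//; apply/eqP.
by rewrite mulrC h mulrC.
Qed.

Section vertex_move_matching.
Context (R : realType) (d : nat).
Local Notation E := 'rV[R]_d.
Variables (a b : 'I_d.+1 -> E) (tau tau' : 'I_d.+1 -> 'I_d.+1) (i j : 'I_d.+1).
Hypotheses (ai : affinely_independent a) (bi : affinely_independent b).
Hypotheses (tauK : cancel tau tau') (tau'K : cancel tau' tau).
Hypotheses (ti : tau i = j) (tk : forall k, k != i -> a k = b (tau k)).

(** The move sends each vertex [a k] to [b (tau k)], and an affine map carries barycentric
    coordinates along with the vertices. *)
Lemma bary_vertex_move k x :
  barycentric b (tau k) (vertex_move a i (b j) x) = barycentric a k x.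
Proof.
have -> : vertex_move a i (b j) x = \sum_l barycentric a (tau' l) x *: b l.
  rewrite (reindex tau)/=; last by exists tau' => l _.
  rewrite /vertex_move -[X in X + _](sum_baryZ ai) (bigD1 i)//= [RHS](bigD1 i)//=.
  rewrite addrAC tauK ti -scalerDr [a i + _]addrC subrK; congr (_ + _).
  by apply: eq_bigr => l li; rewrite tauK tk.
rewrite bary_uniq ?tauK//; rewrite -[RHS](sum_bary ai x) [RHS](reindex tau')//=.
by exists tau => l _.
Qed.

Lemma vertex_moveK : cancel (vertex_move a i (b j)) (vertex_move b j (a i)).
Proof.
move=> x; have := bary_vertex_move i x; rewrite ti => e.
rewrite {1}/vertex_move e /vertex_move.
by rewrite -addrA -scalerDr subrKA subrr scaler0 addr0.
Qed.

End vertex_move_matching.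

(** * Face means as cell integrals, and the local interpolant *)

Section trace_mean.
Context (R : realType) (d : nat).
Local Notation E := 'rV[R]_d.
Local Notation leb := (lebesgue_rV R d).
Local Notation simplex a := (hull a [set: 'I_d.+1]%SET).
Implicit Types (a b : 'I_d.+1 -> E).

(* By the divergence theorem applied to (x - a i) f, this is the mean of f over
   the face opposite to the vertex a i. *)
Definition trace_mean a (i : 'I_d.+1) (f : E -> R) : R :=
  (\int[leb]_(x in simplex a) (f x + d%:R^-1 * radial f (a i) x)) /
  fine (leb (simplex a)).

Lemma fine_cell_gt0 a : affinely_independent a -> 0 < fine (leb (simplex a)).
Proof. by move=> ai; rewrite fine_gt0// cell_gt0// cell_ltoo. Qed.

Variable f : E -> R.
Hypotheses (d0 : (0 < d)%N) (cf : continuous f).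
Hypothesis df : forall j x, derivable f x (delta_mx ord0 j).
Hypothesis cpf : forall j, continuous (partial j f).

Let cg o : continuous (fun x => f x + d%:R^-1 * radial f o x).
Proof.
apply: continuous_addf => //; apply: continuous_mulf; first exact: continuous_cstf.
exact: continuous_radial.
Qed.

(** [trace_identity] divided by d. The vertex [q] is free: the opposite vertex of a neighbor handles
    interior faces, a vertex of the face itself handles boundary faces. *)
Lemma trace_vertex_move a i q : affinely_independent a ->
  \int[leb]_(x in simplex a) (f x + d%:R^-1 * radial f (a i) x) =
  \int[leb]_(x in simplex a) (f (vertex_move a i q x)
    + d%:R^-1 * radial f q (vertex_move a i q x)).
Proof.
move=> ai; have mT := measurable_hull ai [set: 'I_d.+1]%SET.
have dN0 : d%:R != 0 :> R by rewrite pnatr_eq0 -lt0n.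
have cG : continuous (fun x => f (vertex_move a i q x)
    + d%:R^-1 * radial f q (vertex_move a i q x)).
  apply: (continuous_comp_map (g := fun x => f x + d%:R^-1 * radial f q x)) => //.
  exact: continuous_vertex_move.
have i1 := integrable_cell ai (@cg (a i)).
have i2 := integrable_cell ai cG.
apply/eqP; rewrite -subr_eq0 -RintegralB//; apply/eqP.
rewrite -[RHS](mulr0 d%:R^-1) -(@trace_identity R d a ai i q f df cf cpf) -RintegralZl//.
- by apply: eq_Rintegral => x _; field.
- apply: integrable_cell => //; apply: continuous_addf.
    apply: continuous_mulf; first exact: continuous_cstf.
    exact: continuous_jump.
  exact: continuous_radial_jump.
Qed.

(** Moving [a i] to [b j] maps the first cell onto the second and turns the first integrand into the
    second. Volumes change by a constant factor, which the division by the cell volume cancels. *)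
Lemma trace_mean_shared a b i j : affinely_independent a -> affinely_independent b ->
  hull a [set~ i]%SET = hull b [set~ j]%SET ->
  trace_mean a i f = trace_mean b j f.
Proof.
move=> ai bi ab; have [tau [[tau' tauK tau'K] ti tk]] := face_matching ai bi ab.
pose Psi := vertex_move a i (b j); pose Psi' := vertex_move b j (a i).
have lamPsi := bary_vertex_move ai bi tauK tau'K ti tk.
have PsiK : cancel Psi Psi' by exact: vertex_moveK ai bi tauK tau'K ti tk.
have t'i : tau' j = i by rewrite -ti tauK.
have t'k k : k != j -> b k = a (tau' k).
  move=> kj; rewrite tk ?tau'K//; apply: contra kj => /eqP ki.
  by rewrite -(tau'K k) ki ti.
have Psi'K : cancel Psi' Psi by exact: vertex_moveK bi ai tau'K tauK t'i t'k.
have preT : Psi @^-1` simplex b = simplex a.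
  apply/seteqP; split => x; rewrite /= !cellE// => h k.
    by rewrite -(lamPsi k).
  by rewrite -(tau'K k) lamPsi.
have mPsi : measurable_fun setT Psi.
  by apply: continuous_rV_measurable_map; exact: continuous_vertex_move.
have mPsi' : measurable_fun setT Psi'.
  by apply: continuous_rV_measurable_map; exact: continuous_vertex_move.
have tr w : exists w', forall z, Psi (z + w') = Psi z + w.
  exists (Psi' (Psi 0 + w)) => z; set w' := Psi' _.
  have hw' : Psi w' = Psi 0 + w by rewrite /w' Psi'K.
  apply: (addIr (- (Psi 0 + w))); rewrite -{1}hw' /Psi /vertex_move baryD//.
  have := baryB a i w' 0; rewrite subr0 => <-.
  by apply/rowP => l; rewrite !mxE; ring.
have va : (fine (leb (simplex a)))%:E = leb (simplex a).
  by rewrite fineK// ge0_fin_numE// cell_ltoo.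
have vb : (fine (leb (simplex b)))%:E = leb (simplex b).
  by rewrite fineK// ge0_fin_numE// cell_ltoo.
have scale A : measurable A -> ((fine (leb (simplex b)))%:E * leb (Psi @^-1` A) =
    (fine (leb (simplex a)))%:E * leb A)%E.
  move=> mA; rewrite va vb muleC -preT.
  apply: lebesgue_affine mPsi mPsi' PsiK tr _ _ _ mA.
  - exact: measurable_hull.
  - exact: cell_gt0.
  - exact: cell_ltoo.
have a0 := fine_cell_gt0 ai; have b0 := fine_cell_gt0 bi.
have cG := @cg (b j).
have h := Rintegral_affine mPsi (ltW b0) (ltW a0) scale
  (measurable_hull bi [set: 'I_d.+1]%SET) (continuous_rV_measurable cG).
rewrite preT in h.
have cP : continuous (fun x => (fun y => f y + d%:R^-1 * radial f (b j) y) (Psi x)).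
  exact: (continuous_comp_map cG (@continuous_vertex_move _ _ a i (b j))).
have iP := integrable_cell ai cP.
have iB := integrable_cell bi cG.
have hc := h iP iB.
rewrite /trace_mean (trace_vertex_move i (b j) ai).
apply: cross_mul_eq; [exact: lt0r_neq0|exact: lt0r_neq0|exact: hc].
Qed.

(** Moving [a i] to another vertex [a k] collapses the cell onto the face, so the transported
    integrand sees [f] and its gradient only on the face, where they vanish. *)
Lemma trace_mean_boundary a i : affinely_independent a ->
  (forall x, hull a [set~ i]%SET x -> f x = 0 /\ forall j, partial j f x = 0) ->
  trace_mean a i f = 0.
Proof.
move=> ai f0; rewrite /trace_mean.
have [k ki] : exists k : 'I_d.+1, k != i.
  have [e|e] := eqVneq i ord0; last by exists ord0; rewrite eq_sym.
  by exists (Ordinal (d0 : (1 < d.+1)%N)); rewrite e -val_eqE.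
rewrite (trace_vertex_move i (a k) ai).
rewrite (@eq_Rintegral _ _ _ leb _ (cst 0)).
  by rewrite (Rintegral_cst leb (measurable_hull ai _) 0) !mul0r.
move=> x; rewrite inE cellE// => Tx.
have [fx px] : f (vertex_move a i (a k) x) = 0 /\
    forall j, partial j f (vertex_move a i (a k) x) = 0.
  apply: f0; rewrite hullE// => l.
  rewrite /vertex_move baryDZ// dbaryB_vertex//.
  have [->|li] := eqVneq l i.
    by rewrite (eq_sym i) (negbTE ki) sub0r mulrN1 subrr.
  rewrite subr0; split; first by rewrite addr_ge0// mulr_ge0.
  by rewrite !inE li.
by rewrite fx /radial big1 ?mulr0 ?addr0// => j _; rewrite px mulr0.
Qed.

(* The Crouzeix-Raviart interpolant with face values trace_mean; its gradient is
   the mean of the gradient of f. *)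
Definition CR_interpolant a (g : E -> R) : E -> R := fun x =>
  \sum_i trace_mean a i g * (d%:R * (d%:R^-1 - barycentric a i x)).

(** By [tm], the trace mean is an affine function of the vertex [a i]. Summed against the
    derivatives of the coordinates, the constant drops out by [sum_dbary], and [sum_dbaryZ] selects
    the j-th integral. *)
Lemma partial_CR_interpolant a j x : affinely_independent a ->
  partial j (CR_interpolant a f) x =
  (\int[leb]_(y in simplex a) partial j f y) / fine (leb (simplex a)).
Proof.
move=> ai; have dN0 : d%:R != 0 :> R by rewrite pnatr_eq0 -lt0n.
have mT := measurable_hull ai [set: 'I_d.+1]%SET.
pose e := delta_mx ord0 j : E.
have -> : partial j (CR_interpolant a f) x =
    - \sum_i trace_mean a i f * (d%:R * dbary a i e).
  apply: derive_affine => s; rewrite /CR_interpolant mulrN mulr_sumr -sumrB.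
  by apply: eq_bigr => i _; rewrite baryDZ//; ring.
pose G := \int[leb]_(y in simplex a) (f y + d%:R^-1 * radial f 0 y).
pose I k := \int[leb]_(y in simplex a) partial k f y.
have ip k := integrable_cell ai (@cpf k).
have tm i : trace_mean a i f * fine (leb (simplex a)) =
    G - d%:R^-1 * \sum_k a i ord0 k * I k.
  rewrite /trace_mean mulfVK ?gt_eqF ?fine_cell_gt0//.
  have iz k : leb.-integrable (simplex a) (EFin \o (fun y => a i ord0 k * partial k f y)).
    by apply: integrable_cell => //; apply: continuous_mulf => //; exact: continuous_cstf.
  have -> : \sum_k a i ord0 k * I k =
      \int[leb]_(y in simplex a) (\sum_k a i ord0 k * partial k f y).
    rewrite (Rintegral_sum mT (index_enum _) xpredT iz); apply: eq_bigr => k _.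
    by rewrite RintegralZl//; exact: ip.
  have iS := integrable_sumR mT (index_enum _) xpredT iz.
  have idS : leb.-integrable (simplex a)
      (EFin \o (fun y => d%:R^-1 * \sum_k a i ord0 k * partial k f y)).
    by apply: eq_integrable (integrableZl mT d%:R^-1 iS).
  rewrite -RintegralZl// -RintegralB//; last exact: (integrable_cell ai (@cg 0)).
  apply: eq_Rintegral => y _; rewrite /radial -addrA -mulrBr -sumrB.
  congr (_ + _ * _); apply: eq_bigr => k _.
  by rewrite subr0 !mxE; ring.
apply: (canRL (mulfK (lt0r_neq0 (fine_cell_gt0 ai)))).
rewrite mulNr mulr_suml -sumrN.
rewrite (eq_bigr (fun i => \sum_k dbary a i e * a i ord0 k * I k - d%:R * G * dbary a i e)).
  rewrite sumrB -mulr_sumr sum_dbary// mulr0 subr0 exchange_big/=.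
  under eq_bigr => k _ do rewrite -mulr_suml.
  have eE k : \sum_i dbary a i e * a i ord0 k = (k == j)%:R.
    have := congr1 (fun v : E => v ord0 k) (sum_dbaryZ ai e).
    by rewrite summxE mxE eqxx /= => <-; apply: eq_bigr => i _; rewrite mxE.
  rewrite (bigD1 j)//= eE eqxx mul1r big1 ?addr0// => k kj.
  by rewrite eE (negbTE kj) mul0r.
move=> i _; rewrite mulrAC tm.
under [X in _ = X - _]eq_bigr => k _ do rewrite -mulrA.
by rewrite -mulr_sumr; field.
Qed.

End trace_mean.

(** * Integration over a mesh *)

Lemma negligible_bigcup_count (R : realType) (dsp : measure_display)
    (T : measurableType dsp) (mu : {measure set T -> \bar R}) (I : countType)
    (F : I -> set T) :
  (forall i, mu.-negligible (F i)) -> mu.-negligible (\bigcup_i F i).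
Proof.
move=> nF; pose G n := if unpickle n is Some i then F i else set0.
apply: (@negligibleS _ _ _ mu (\bigcup_n G n)).
  by move=> x [i _ Fx]; exists (pickle i) => //; rewrite /G pickleK.
apply: negligible_bigcup => n; rewrite /G; case: unpickle => [i|]; first exact: nF.
exact: negligible_set0.
Qed.

(** * Hyperplanes are null sets *)

Section null_sets.
Context (R : realType) (d : nat).
Local Notation E := 'rV[R]_d.
Local Notation leb := (lebesgue_rV R d).

(* Tonelli for {(x, t) | l (x + t e) = c}: every section at fixed x is a point,
   every section at fixed t is a translate of {l = c}. *)
Lemma lebesgue_level_set (l : E -> R) (e : E) (k c : R) :
  measurable_fun setT l -> k != 0 -> (forall x t, l (x + t *: e) = l x + t * k) ->
  leb [set x | l x = c] = 0%E.
Proof.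
move=> ml k0 lE.
pose D : set (E * measurableTypeR R) := [set p | l p.1 + p.2 * k = c].
have mD : measurable D.
  have mg : measurable_fun setT (fun p : E * measurableTypeR R => l p.1 + p.2 * k).
    apply: measurable_funD.
      by apply: (measurableT_comp ml); exact: measurable_fst.
    by apply: measurable_funM => //; exact: measurable_snd.
  exact: (measurable_preimageT mg (measurable_set1 c)).
have mA : measurable [set x : E | l x = c].
  exact: (measurable_preimageT ml (measurable_set1 c)).
have := @indic_fubini_tonelli _ _ _ _ R leb (@lebesgue_measure R) D mD.
rewrite indic_fubini_tonelli_FE// indic_fubini_tonelli_GE//.
rewrite (_ : _ \o xsection D = cst 0%E); last first.
  apply/funext => x /=; rewrite (_ : xsection D x = [set (c - l x) / k]).
    exact: lebesgue_measure_set1.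
  apply/seteqP; split => t; rewrite /xsection /= inE /D /=.
    by move=> <-; rewrite addrAC subrr add0r mulfK.
  by move=> ->; rewrite mulfVK// addrC subrK.
rewrite (_ : _ \o ysection D = cst (leb [set x : E | l x = c])); last first.
  apply/funext => t /=.
  apply: etrans (lebesgue_rV_translation (t *: e) mA); congr (leb _).
  by apply/seteqP; split => x; rewrite /ysection /= inE /D /= lE.
rewrite integral_cst// mul0e integral_cst// => h.
have : (lebesgue_measure [set: R] = +oo)%E.
  by rewrite -set_itvNyy lebesgue_measure_itv.
move=> hT; move: h; rewrite [X in (_ * X)%E]hT => /esym.
have : (0 <= leb [set x | l x = c])%E by [].
rewrite le_eqVlt => /orP[/eqP <-//|lpos].
by rewrite gt0_muley.
Qed.

Lemma lebesgue_bary_level (a : 'I_d.+1 -> E) i : (0 < d)%N -> affinely_independent a ->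
  leb [set x | barycentric a i x = 0] = 0%E.
Proof.
move=> d0 ai.
have [k ki] : exists k : 'I_d.+1, k != i.
  have [e|e] := eqVneq i ord0; last by exists ord0; rewrite eq_sym.
  by exists (Ordinal (d0 : (1 < d.+1)%N)); rewrite e -val_eqE.
apply: (@lebesgue_level_set _ (a i - a k) 1) => //.
- exact: measurable_bary.
- by move=> x t; rewrite baryDZ// dbaryB_vertex// eqxx eq_sym (negbTE ki) subr0.
Qed.

(* d points of R^d lie on a hyperplane. *)
Lemma negligible_hull (a : 'I_d -> E) : (0 < d)%N ->
  leb.-negligible (hull a [set: 'I_d]%SET).
Proof.
move=> d0.
(* The equation of the hyperplane: 1 + d unknown coefficients and only d conditions, one per
   point. *)
have [u u0 ua] : exists2 u : 'rV[R]_(1 + d), u != 0 & u *m (homogeneous a)^T = 0.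
  have : kermx (homogeneous a)^T != 0.
    rewrite -mxrank_eq0 mxrank_ker -lt0n subn_gt0.
    by apply: (leq_ltn_trans (rank_leq_col _)); rewrite add1n.
  by move=> /rowV0Pn[u /sub_kermxP ua u0]; exists u.
pose w : E := rsubmx u; pose w0 := u ord0 (lshift d ord0).
have ptw i : w0 + \sum_j w ord0 j * a i ord0 j = 0.
  have := congr1 (fun v : 'rV[R]_d => v ord0 i) ua.
  rewrite mxE [RHS]mxE big_split_ord /= big_ord1 => h; rewrite -[RHS]h.
  have hE l : (homogeneous a)^T l i = row_mx (1%:M : 'M[R]_1) (a i) ord0 l.
    by rewrite mxE mxE.
  congr (_ + _); first by rewrite hE row_mxEl mxE mulr1.
  by apply: eq_bigr => j _; rewrite hE row_mxEr mxE.
(* If the linear part vanished, [ptw] at one point would make the constant term vanish too, and then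
   u = 0. *)
have [j wj] : exists j, w ord0 j != 0.
  apply/existsP; apply: contraR u0 => /existsPn h.
  have wz j : w ord0 j = 0 by apply/eqP; have := h j; rewrite negbK.
  have := ptw (Ordinal d0); rewrite big1 ?addr0 => [z|j _]; last by rewrite wz mul0r.
  apply/eqP/rowP => l; rewrite mxE; case: (split_ordP l) => k ->.
    by rewrite (ord1 k).
  by have := wz k; rewrite mxE.
clearbody w w0; pose l (x : E) := \sum_j w ord0 j * x ord0 j.
exists [set x | l x = - w0]; split.
- apply: (measurable_preimageT (f := l) (A := [set - w0])) => //.
  apply: continuous_rV_measurable; apply: continuous_sumf => k.
  by apply: continuous_mulf; [exact: continuous_cstf|exact: continuous_coordf].
- apply: (@lebesgue_level_set l (delta_mx ord0 j) (w ord0 j)) => //.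
    apply: continuous_rV_measurable; apply: continuous_sumf => k.
    by apply: continuous_mulf; [exact: continuous_cstf|exact: continuous_coordf].
  move=> x t; rewrite /l; under eq_bigr => k _ do rewrite !mxE eqxx /= mulrDr.
  rewrite big_split/=; congr (_ + _); rewrite (bigD1 j)//= eqxx mulr1 mulrC.
  by rewrite big1 ?addr0// => k /negbTE ->; rewrite !mulr0.
- move=> x [t [_ _ t1 ->]] /=; apply/eqP; rewrite -addr_eq0 addrC; apply/eqP.
  have -> : l (\sum_i t i *: a i) = \sum_i t i * \sum_j w ord0 j * a i ord0 j.
    rewrite /l; under eq_bigr => k _ do rewrite summxE mulr_sumr.
    rewrite exchange_big/=; apply: eq_bigr => i _; rewrite mulr_sumr.
    by apply: eq_bigr => k _; rewrite mxE mulrCA.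
  rewrite -[w0]mul1r -t1 mulr_suml -big_split/=.
  by rewrite big1// => i _; rewrite -mulrDr ptw mulr0.
Qed.

End null_sets.

Section mesh_integral.
Context (R : realType) (d : nat).
Local Notation E := 'rV[R]_d.
Local Notation leb := (lebesgue_rV R d).
Variables (Omega : set E) (M : mesh R d).
Hypotheses (d0 : (0 < d)%N) (hO : polyhedral_domain Omega) (hM : conforming_mesh Omega M).

Let ai (T : 'I_(ncells M)) : affinely_independent (vertex T).
Proof. by case: hM. Qed.

(** Contains the full hyperplanes of all faces, not the faces alone. It is still null, and a point
    of a cell off it has positive coordinates, hence is interior to the cell and in no other
    cell. *)
Definition skeleton : set E :=
  boundary Omega `|` [set x | exists (T : 'I_(ncells M)) i, barycentric (vertex T) i x = 0].

Lemma measurable_domain : measurable Omega.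
Proof. by apply: open_rV_measurable; case: hO. Qed.

Lemma boundaryE : boundary Omega = closure Omega `\` Omega.
Proof.
by rewrite /boundary; have [/interior_id -> _ _ _ _] := hO.
Qed.

Lemma negligible_skeleton : leb.-negligible skeleton.
Proof.
apply: negligibleU.
  have [_ _ _ _ [m [a [_ ->]]]] := hO.
  by apply: negligible_bigcup_count => k; exact: negligible_hull.
rewrite (_ : [set x | _] = \bigcup_(p in [set: 'I_(ncells M) * 'I_d.+1])
   [set x | barycentric (vertex p.1) p.2 x = 0]); last first.
  by apply/seteqP; split => x; [move=> [T [i h]]; exists (T, i)|move=> [[T i] _ h]; exists T, i].
apply: negligible_bigcup_count => -[T i] /=; apply/negligibleP.
  apply: (measurable_preimageT (f := barycentric (vertex T) i) (A := [set 0])) => //.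
  exact: measurable_bary.
exact: lebesgue_bary_level.
Qed.

Lemma cell_off_skeleton x (T1 T2 : 'I_(ncells M)) : ~ skeleton x ->
  cell T1 x -> cell T2 x -> T1 = T2.
Proof.
move=> nx c1 c2; apply/eqP; apply: contra_notT nx => T12.
have [_ _ /(_ _ _ T12)[I1 [I2 [I1p _ h _]]]] := hM.
have : hull (vertex T1) I1 x by rewrite -h.
move: I1p; rewrite properE => /andP[_ /subsetPn[i _ iI1]].
rewrite hullE// => /(_ i)[_ /(_ iI1) z].
by right; exists T1, i.
Qed.

Lemma domain_off_skeleton x : ~ skeleton x ->
  Omega x <-> exists T : 'I_(ncells M), cell T x.
Proof.
move=> nx; have [_ cO _] := hM; split.
  by move=> /subset_closure; rewrite cO => -[T _ cT]; exists T.
move=> [T cT]; apply: contrapT => nO; apply: nx; left; rewrite boundaryE; split => //.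
by rewrite cO; exists T.
Qed.

Lemma mesh_integral (G : E -> R) : measurable_fun setT G ->
  (forall T : 'I_(ncells M), leb.-integrable (cell T) (EFin \o G)) ->
  \int[leb]_(x in Omega) G x = \sum_(T < ncells M) \int[leb]_(x in cell T) G x.
Proof.
move=> mG iG.
have mc (T : 'I_(ncells M)) : measurable (cell T) by exact: measurable_hull.
have mO := measurable_domain.
have iG' (T : 'I_(ncells M)) : leb.-integrable setT (EFin \o (G \_ (cell T))).
  by have := iG T; rewrite integrable_mkcond// -restrict_EFin.
rewrite Rintegral_mkcond.
under eq_bigr => T _ do rewrite Rintegral_mkcond.
rewrite -(Rintegral_sum measurableT (index_enum _) xpredT iG').
rewrite /Rintegral; congr fine; apply: ae_eq_integral => //.
- apply/measurable_EFinP; apply/(measurable_restrictT _ mO); exact: measurable_funTS.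
- apply/measurable_EFinP; apply: measurable_sum => T.
  apply/(measurable_restrictT _ (mc T)); exact: measurable_funTS.
- apply: negligibleS negligible_skeleton => x; apply: contra_notP => nx _ /=.
  congr EFin; rewrite /patch.
  case: ifPn => [|]; rewrite ?notin_setE ?inE.
    move=> /(domain_off_skeleton nx)[T cT].
    rewrite (bigD1 T)//= mem_set// big1 ?addr0// => T' T'T.
    rewrite memNset// => cT'; move/eqP: T'T; apply.
    exact: cell_off_skeleton nx cT' cT.
  move=> nO; rewrite big1// => T _; rewrite memNset// => cT; apply: nO.
  by apply/(domain_off_skeleton nx); exists T.
Qed.

(** The extra null set [N] serves the pressure, which is constant on each cell only almost
    everywhere. *)
Lemma mesh_integral_piecewise (F : E -> R) (g : 'I_(ncells M) -> E -> R) (N : set E) :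
  leb.-negligible N -> measurable_fun Omega F ->
  (forall T, measurable_fun setT (g T)) ->
  (forall T, leb.-integrable (cell T) (EFin \o g T)) ->
  (forall T x, ~ N x -> ~ skeleton x -> cell T x -> F x = g T x) ->
  \int[leb]_(x in Omega) F x = \sum_(T < ncells M) \int[leb]_(x in cell T) g T x.
Proof.
move=> nN mF mg ig Fg.
have mc (T : 'I_(ncells M)) : measurable (cell T) by exact: measurable_hull.
pose G x := \sum_(T < ncells M) (g T \_ (cell T)) x.
have mG : measurable_fun setT G.
  apply: measurable_sum => T; apply/(measurable_restrictT _ (mc T)).
  exact: measurable_funTS.
have Gcell (T : 'I_(ncells M)) x : ~ skeleton x -> cell T x -> G x = g T x.
  move=> nx cT; rewrite /G (bigD1 T)//= patchE mem_set// big1 ?addr0// => T' T'T.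
  rewrite patchE memNset// => cT'; move/eqP: T'T; apply.
  exact: cell_off_skeleton nx cT' cT.
have aeG (T : 'I_(ncells M)) : ae_eq leb (cell T) (EFin \o g T) (EFin \o G).
  apply: negligibleS negligible_skeleton => x; apply: contra_notP => nx cT /=.
  by rewrite (@Gcell T x).
have iG (T : 'I_(ncells M)) : leb.-integrable (cell T) (EFin \o G).
  apply: (@integrableS _ _ _ _ setT) => //.
  have iT (T' : 'I_(ncells M)) : leb.-integrable setT (EFin \o (g T' \_ (cell T'))).
    by have := ig T'; rewrite integrable_mkcond// -restrict_EFin.
  exact: (integrable_sumR measurableT (index_enum _) xpredT iT).
transitivity (\int[leb]_(x in Omega) G x).
  rewrite /Rintegral; congr fine; apply: ae_eq_integral; first exact: measurable_domain.
  - exact/measurable_EFinP.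
  - by apply/measurable_EFinP; exact: measurable_funTS.
  - apply: negligibleS (negligibleU nN negligible_skeleton) => x.
    apply: contra_notP => /not_orP[nNx nx] /(domain_off_skeleton nx)[T cT] /=.
    by rewrite (@Fg T x)// (@Gcell T x).
rewrite (mesh_integral mG iG); apply: eq_bigr => T _.
rewrite /Rintegral; congr fine; apply: ae_eq_integral => //.
- by apply/measurable_EFinP; exact: measurable_funTS.
- by apply/measurable_EFinP; exact: measurable_funTS.
- by apply: negligibleS (aeG T) => x /= h1 h2; apply: h1 => cT; rewrite h2.
Qed.

End mesh_integral.

Section CR_face_jump.
Context (R : realType) (d : nat).
Local Notation E := 'rV[R]_d.
Local Notation leb := (lebesgue_rV R d).
Variable (a : 'I_d.+1 -> E).
Hypotheses (d0 : (0 < d)%N) (ai : affinely_independent a).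

(** [e i] is the value of the affine function at the barycenter of the face. With s the sum of the
    [e k], its coefficients in barycentric coordinates are s - d e k; over the vertices of the face
    they add up to d s - d (s - e i) = 0. *)
Lemma CR_face_jump_eq0 (i : 'I_d.+1) (e : 'I_d.+1 -> R) (g : E -> R) : e i = 0 ->
  (forall x, hull a [set~ i]%SET x ->
     g x = \sum_k e k * (d%:R * (d%:R^-1 - barycentric a k x))) ->
  face_jump_sqr (hull a [set~ i]%SET) g = 0.
Proof.
move=> ei gE; have dN0 : d%:R != 0 :> R by rewrite pnatr_eq0 -lt0n.
pose s := \sum_k e k.
apply: (face_jump_sqr_eq0 d0 ai (cc := fun k => s - d%:R * e k)).
  move=> x Fx; rewrite gE//.
  under [RHS]eq_bigr => k _ do rewrite mulrBl.
  rewrite sumrB -mulr_sumr sum_bary// mulr1 /s -sumrB.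
  by apply: eq_bigr => k _; field.
rewrite sumrB sumr_const (_ : #|_| = d); last by rewrite cardC1 card_ord.
have sE : s = \sum_(k | k != i) e k by rewrite /s (bigD1 i)//= ei add0r.
by rewrite -mulr_sumr -sE -[s *+ d]mulr_natl subrr.
Qed.

(* (\int g)^2 <= |T| \int g^2, from \int (g - mean)^2 >= 0 *)
Lemma jensen_cell (g : E -> R) : continuous g ->
  \int[leb]_(x in hull a [set: 'I_d.+1]%SET)
    (((\int[leb]_(y in hull a [set: 'I_d.+1]%SET) g y)
      / fine (leb (hull a [set: 'I_d.+1]%SET))) ^+ 2)
  <= \int[leb]_(x in hull a [set: 'I_d.+1]%SET) (g x ^+ 2).
Proof.
move=> cg; set T := hull a _; set A := \int[leb]_(y in T) g y.
set V := fine (leb T); set m := A / V.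
have mT : measurable T by exact: measurable_hull.
have V0 : 0 < V by exact: fine_cell_gt0.
have ig := integrable_cell ai cg.
have ig2 := integrable_cell ai (continuous_mulf cg cg).
have ic c := integrable_cell ai (@continuous_cstf R _ c).
have img := integrable_cell ai (continuous_mulf (@continuous_cstf R _ (2 * m)) cg).
have : 0 <= \int[leb]_(x in T) ((g x - m) ^+ 2).
  by apply: Rintegral_ge0 => x _; exact: sqr_ge0.
rewrite (@eq_Rintegral _ _ _ leb T (fun x => (g x * g x - 2 * m * g x) + m ^+ 2)); last first.
  by move=> x _; rewrite !expr2; ring.
have ib := integrable_cell ai (continuous_subf (continuous_mulf cg cg)
  (continuous_mulf (@continuous_cstf R _ (2 * m)) cg)).
rewrite (RintegralD mT ib (ic (m ^+ 2))) (RintegralB mT ig2 img).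
rewrite (RintegralZl (2 * m) mT ig) -/A.
rewrite (Rintegral_cst leb mT (m ^+ 2)) -/V.
have -> : A = m * V by rewrite /m mulfVK// gt_eqF.
rewrite (@eq_Rintegral _ _ _ leb T (fun x => g x ^+ 2) (fun x => g x * g x)); last first.
  by move=> x _; rewrite expr2.
rewrite !expr2; lra.
Qed.

End CR_face_jump.

Section test_functions.
Context (R : realType) (d : nat) (Omega : set 'rV[R]_d) (f : 'rV[R]_d -> R).
Hypotheses (oO : open Omega) (tf : test_function Omega f).

Lemma test_function_continuous : continuous f.
Proof. by have [/(_ [::])[]] := tf. Qed.

Lemma test_function_derivable j x : derivable f x (delta_mx ord0 j).
Proof. by have [/(_ [::])[_]] := tf; exact. Qed.

Lemma test_function_partial j : continuous (partial j f).
Proof. by have [/(_ [:: j])[]] := tf. Qed.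

(** A boundary point lies outside the open set [Omega], hence off the closed support: [f] vanishes
    in a whole neighborhood, and so do its derivatives there. *)
Lemma test_function_boundary x : boundary Omega x ->
  f x = 0 /\ forall j, partial j f x = 0.
Proof.
move=> [_]; rewrite (interior_id _).1// => nO.
have [_ _ sO] := tf.
have f0 : \forall y \near x, f y = 0.
  have : nbhs x (~` closure [set y | f y != 0]).
    apply: open_nbhs_nbhs; split; first by rewrite openC; exact: closed_closure.
    by move=> /sO.
  apply: filterS => y hy; apply/eqP; apply: contra_notT hy => fy.
  exact: subset_closure.
by split; [exact: nbhs_singleton f0|move=> j; exact: derive_near0].
Qed.

End test_functions.

(** * The interpolant on the whole mesh *)

Section CR_interpolation.
Context (R : realType) (d : nat).
Local Notation E := 'rV[R]_d.
Local Notation leb := (lebesgue_rV R d).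
Variables (Omega : set E) (M : mesh R d).
Hypotheses (d0 : (0 < d)%N) (hO : polyhedral_domain Omega) (hM : conforming_mesh Omega M).

Let ai (T : 'I_(ncells M)) : affinely_independent (vertex T).
Proof. by case: hM. Qed.

Let oO : open Omega. Proof. by case: hO. Qed.

Definition CR_interp (f : E -> R) : broken M := fun T => CR_interpolant (vertex T) f.

Lemma X_CR_interp f : X_CR (CR_interp f).
Proof.
exists (fun T k => trace_mean (vertex T) k f).
apply/funext => T'; apply/funext => x; rewrite (bigD1 T')//= [X in _ + X]big1 ?addr0.
  by apply: eq_bigr => k _; rewrite /CR_basis eqxx.
move=> T TT'; rewrite big1// => k _; rewrite /CR_basis eq_sym (negbTE TT') mulr0//.
Qed.

Section interp_norm.
Variable f : E -> R.
Hypothesis tf : test_function Omega f.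
Let cf := test_function_continuous tf.
Let df := test_function_derivable tf.
Let cpf := test_function_partial tf.

(** On the common face, matched vertices have equal coordinates, so the jump is again a
    Crouzeix-Raviart combination; its coefficient at [i1] is the difference of the two means over
    the shared face. *)
Let interior_jump (T1 T2 : 'I_(ncells M)) : interior_face T1 T2 ->
  face_jump_sqr (cell T1 `&` cell T2) (CR_interp f T1 \- CR_interp f T2) = 0.
Proof.
move=> [[i1 F1] [i2 F2]]; rewrite F1.
have F12 : hull (vertex T1) [set~ i1]%SET = hull (vertex T2) [set~ i2]%SET.
  by rewrite -[LHS]F1 -[RHS]F2.
have [tau [[tau' tauK tau'K] ti tk]] := face_matching (ai T1) (ai T2) F12.
apply: (CR_face_jump_eq0 d0 (ai T1) (e := fun k => trace_mean (vertex T1) k f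
   - trace_mean (vertex T2) (tau k) f)).
  by rewrite ti (trace_mean_shared d0 cf df cpf (ai T1) (ai T2) F12) subrr.
move=> x Fx.
have lamE k : barycentric (vertex T2) (tau k) x = barycentric (vertex T1) k x.
  rewrite -(bary_vertex_move (ai T1) (ai T2) tauK tau'K ti tk) /vertex_move.
  move: Fx; rewrite hullE// => /(_ i1)[_ ->]; last by rewrite !inE eqxx.
  by rewrite scale0r addr0.
rewrite /= /CR_interp /CR_interpolant [X in _ - X](reindex tau)/=; last by exists tau' => l _.
by rewrite -sumrB; apply: eq_bigr => k _; rewrite lamE -mulrBl.
Qed.

Let boundary_jump (T : 'I_(ncells M)) i : boundary_face Omega T i ->
  face_jump_sqr (face T i) (CR_interp f T) = 0.
Proof.
move=> bF; apply: (CR_face_jump_eq0 d0 (ai T) (e := fun k => trace_mean (vertex T) k f)) => //.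
apply: (trace_mean_boundary d0 cf df cpf (ai T)) => x Fx.
exact: (test_function_boundary oO tf (bF x Fx)).
Qed.

Lemma normX_CR_interpE : normX_sqr Omega (CR_interp f) = \sum_(T < ncells M)
  \sum_(j < d) normL2 leb (cell T) (partial j (CR_interp f T)) ^+ 2.
Proof.
rewrite /normX_sqr [X in _ + X + _]big1 ?addr0; last first.
  move=> T1 _; rewrite big1// => T2 /andP[_ /asboolP iF].
  by rewrite interior_jump// mulr0.
rewrite [X in _ + X]big1 ?addr0//.
move=> T _; rewrite big1// => i /asboolP bF.
by rewrite boundary_jump// mulr0.
Qed.

(** Gradients of the interpolant are constant on cells, and cells have positive volume. This is how
    a vanishing discrete norm will be excluded. *)
Lemma normX_CR_interp_le0 : normX_sqr Omega (CR_interp f) <= 0 ->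
  forall (T : 'I_(ncells M)) j x, partial j (CR_interp f T) x = 0.
Proof.
rewrite normX_CR_interpE => h T j x.
have : \sum_(j < d) normL2 leb (cell T) (partial j (CR_interp f T)) ^+ 2 <= 0.
  apply: le_trans h; rewrite [leRHS](bigD1 T)//= lerDl.
  by apply: sumr_ge0 => T' _; apply: sumr_ge0 => k _; exact: sqr_ge0.
rewrite (bigD1 j)//=; set S := (X in _ + X) => h2.
have S0 : 0 <= S by apply: sumr_ge0 => k _; exact: sqr_ge0.
have : normL2 leb (cell T) (partial j (CR_interp f T)) ^+ 2 <= 0.
  by apply: le_trans h2; rewrite lerDl.
rewrite sqr_normL2 (@eq_Rintegral _ _ _ leb (cell T)
  (fun _ => (partial j (CR_interp f T) x) ^+ 2)); last first.
  by move=> y _; rewrite !partial_CR_interpolant.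
have mc : measurable (cell T) by exact: measurable_hull.
rewrite (Rintegral_cst leb mc) pmulr_lle0 ?fine_cell_gt0// => h3.
by apply/eqP; rewrite -sqrf_eq0 eq_le h3 sqr_ge0.
Qed.

Lemma normX_CR_interp : normX_sqr Omega (CR_interp f) <=
  \sum_(j < d) normL2 leb Omega (partial j f) ^+ 2.
Proof.
rewrite normX_CR_interpE.
rewrite exchange_big/=; apply: ler_sum => j _; rewrite sqr_normL2.
have cp2 : continuous (fun x => partial j f x ^+ 2).
  exact: (continuous_mulf (@cpf j) (@cpf j)).
rewrite (@mesh_integral_piecewise _ _ Omega M d0 hO hM _ (fun _ x => partial j f x ^+ 2) set0) //.
- apply: ler_sum => T _; rewrite sqr_normL2.
  apply: le_trans (jensen_cell (ai T) (@cpf j)).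
  rewrite le_eqVlt; apply/orP; left; apply/eqP; apply: eq_Rintegral => x _.
  by rewrite partial_CR_interpolant.
- exact: negligible_set0.
- by apply: measurable_funTS; exact: continuous_rV_measurable.
- by move=> T; exact: continuous_rV_measurable.
- by move=> T; exact: integrable_cell.
Qed.

End interp_norm.

Variables (f : 'I_d -> E -> R) (q : E -> R).
Hypothesis tf : forall i, test_function Omega (f i).
Hypothesis hq : Q_h0 Omega M q.

(** On each cell both integrals equal the constant value of [q] times the integral of div f, since
    the divergence of the interpolant is the mean of div f. *)
Lemma form_bh_CR_interp : form_bh Omega (fun i => CR_interp (f i)) q =
  form_b Omega (fun i => (f i, fun j => partial j (f i))) q.
Proof.
have [[qL2 _] qc] := hq.
have [c hc] := choice qc.
pose N := \bigcup_(T : 'I_(ncells M)) [set x | ~ (cell T x -> q x = c T)].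
have nN : leb.-negligible N by apply: negligible_bigcup_count => T; exact: hc.
have qE T x : ~ N x -> cell T x -> q x = c T.
  by move=> nNx cT; apply: contrapT => qc'; apply: nNx; exists T => // /(_ cT).
have mq : measurable_fun Omega q.
  by apply: (inL2_measurable _ qL2); exact: measurable_domain.
have cp i : continuous (partial i (f i)) by exact: test_function_partial (tf i) i.
have cdiv : continuous (fun x => \sum_i partial i (f i) x).
  by apply: continuous_sumf => i; exact: cp.
pose m (T : 'I_(ncells M)) := (\int[leb]_(y in cell T) \sum_i partial i (f i) y)
   / fine (leb (cell T)).
have mE (T : 'I_(ncells M)) x : \sum_i partial i (CR_interp (f i) T) x = m T.
  have pE i : partial i (CR_interp (f i) T) x =
      (\int[leb]_(y in cell T) partial i (f i) y) / fine (leb (cell T)).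
    apply: partial_CR_interpolant => //; first exact: test_function_continuous (tf i).
    exact: test_function_partial (tf i).
  under eq_bigr => i _ do rewrite pE.
  rewrite -mulr_suml /m; congr (_ / _); apply: esym; apply: Rintegral_sum.
    exact: measurable_hull.
  by move=> i; apply: integrable_cell => //; exact: cp.
rewrite /form_bh /form_b; congr (- _).
rewrite (@mesh_integral_piecewise _ _ Omega M d0 hO hM _ (fun T x => m T * c T) N) //.
rewrite (@mesh_integral_piecewise _ _ Omega M d0 hO hM _
  (fun T x => c T * \sum_i partial i (f i) x) N) //.
- apply: eq_bigr => T _.
  have mc : measurable (cell T) by exact: measurable_hull.
  rewrite RintegralZl//; last exact: integrable_cell.
  have mV : m T * fine (leb (cell T)) = \int[leb]_(y in cell T) \sum_i partial i (f i) y.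
    by rewrite /m mulfVK// gt_eqF// fine_cell_gt0.
  by rewrite (Rintegral_cst leb mc (m T * c T)) mulrAC mV mulrC.
- apply: measurable_funM => //; apply: measurable_funTS.
  exact: continuous_rV_measurable.
- move=> T; apply: continuous_rV_measurable; apply: continuous_mulf => //.
  exact: continuous_cstf.
- move=> T; apply: integrable_cell => //; apply: continuous_mulf => //.
  exact: continuous_cstf.
- by move=> T x nNx _ cT; rewrite (qE T)// mulrC.
- apply: measurable_funM => //; apply: measurable_funTS; apply: measurable_sum => T.
  apply: measurable_funM.
    by apply: measurable_indic; apply: open_rV_measurable; exact: open_interior.
  under eq_fun do rewrite mE.
  exact: measurable_cst.
- by move=> T; apply: integrable_cell => //; exact: continuous_cstf.
- move=> T x nNx nx cT; rewrite (qE T)//; congr (_ * _).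
  (* Off the skeleton x is interior to its cell, so exactly one indicator in [div_h] is 1. *)
  rewrite /div_h (bigD1 T)//= mE indicE mem_set; last first.
    apply: interior_cell => // k; rewrite lt_neqAle.
    have : 0 <= barycentric (vertex T) k x by move: cT; rewrite /cell cellE.
    move=> ->; rewrite andbT; apply: contra_notN nx => /eqP h.
    by right; exists T, k.
  rewrite mul1r big1 ?addr0// => T' T'T; rewrite indicE memNset ?mul0r//.
  move=> /interior_subset cT'; move/eqP: T'T; apply.
  exact: (cell_off_skeleton hM nx cT' cT).
Qed.

Lemma form_bh_partial0 (v : 'I_d -> broken M) :
  (forall i T x, partial i (v i T) x = 0) -> form_bh Omega v q = 0.
Proof.
move=> v0; rewrite /form_bh (@eq_Rintegral _ _ _ leb Omega (cst 0)).
  rewrite (Rintegral_cst leb _ 0) ?mul0r ?oppr0//.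
  exact: measurable_domain.
move=> x _; rewrite /div_h big1 ?mul0r// => T _.
by rewrite big1 ?mulr0// => i _.
Qed.

End CR_interpolation.

(** * Density of test functions and the inf-sup condition *)

Lemma sqrtrD_le (R : realType) (x y : R) : 0 <= x -> 0 <= y ->
  Num.sqrt (x + y) <= Num.sqrt x + Num.sqrt y.
Proof.
move=> x0 y0; rewrite -[leRHS]ger0_norm ?addr_ge0 ?sqrtr_ge0// -sqrtr_sqr.
rewrite ler_wsqrtr// sqrrD !sqr_sqrtr// addrAC lerDl.
by rewrite mulrn_wge0// mulr_ge0 ?sqrtr_ge0.
Qed.

(** [W] is a squared norm, so a perturbation of order del moves the norm by order sqrt del. Hence
    del = t^2: both errors are at most linear in t, with total rate [K], and t K stays below the gap
    [G]. *)
Lemma strict_bound_stable (R : realType) (b F W Q C C' : R) :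
  0 <= b -> 0 <= W -> 0 <= Q -> 0 <= C -> 0 <= C' ->
  b * (Num.sqrt W * Q) < F ->
  exists del, [/\ 0 < del, del <= 1 & forall F' W', F - C * del <= F' ->
    0 <= W' -> W' <= W + C' * del -> b * (Num.sqrt W' * Q) < F'].
Proof.
move=> b0 W0 Q0 C0 C'0 hF.
pose G := F - b * (Num.sqrt W * Q); have G0 : 0 < G by rewrite subr_gt0.
pose K := C + b * (Num.sqrt C' * Q).
have K0 : 0 <= K by rewrite addr_ge0// !mulr_ge0// sqrtr_ge0.
pose t := Num.min 1 (G / (K + 1)).
have K1 : 0 < K + 1 by rewrite ltr_wpDl.
have t0 : 0 < t by rewrite lt_min ltr01 divr_gt0.
have t1 : t <= 1 by rewrite ge_min lexx.
have tK : t * K < G.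
  have : t <= G / (K + 1) by rewrite ge_min lexx orbT.
  by rewrite ler_pdivlMr// mulrDr mulr1; lra.
exists (t ^+ 2); split; [by rewrite exprn_gt0|by rewrite exprn_ile1// ltW|].
move=> F' W' hF' W'0 hW'.
have s1 : Num.sqrt W' <= Num.sqrt W + Num.sqrt C' * t.
  apply: (le_trans (ler_wsqrtr hW')).
  apply: (le_trans (sqrtrD_le W0 _)); first by rewrite mulr_ge0// sqr_ge0.
  by rewrite sqrtrM// sqrtr_sqr gtr0_norm.
have s2 : b * (Num.sqrt W' * Q) <= b * (Num.sqrt W * Q) + t * (b * (Num.sqrt C' * Q)).
  rewrite (_ : _ + _ = b * ((Num.sqrt W + Num.sqrt C' * t) * Q)); last by ring.
  by rewrite ler_wpM2l// ler_wpM2r.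
have s3 : C * t ^+ 2 <= t * C.
  by rewrite mulrC expr2 -mulrA ler_wpM2l ?(ltW t0)// ler_piMl.
apply: (le_lt_trans s2); apply: lt_le_trans hF'.
move: tK s3; rewrite /K /G mulrDr; lra.
Qed.

(** * Replacing a Sobolev field by test functions *)

Section L2_perturbation.
Context (R : realType) (d : nat).
Local Notation E := 'rV[R]_d.
Local Notation leb := (lebesgue_rV R d).
Variable (Omega : set E).
Hypothesis hO : polyhedral_domain Omega.

Let mO : measurable Omega. Proof. exact: measurable_domain. Qed.

Lemma integrable_domain (g : E -> R) : continuous g -> leb.-integrable Omega (EFin \o g).
Proof.
move=> cg; have [_ _ _ bO _] := hO.
have ccl : compact (closure Omega).
  apply: bounded_closed_compact; last exact: closed_closure.
  move: bO => [N [Nr hN]]; exists N; split => // K NK.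
  have : closed [set x : E | `|x| <= K].
    apply: (@closed_comp _ _ (fun x : E => `|x|) [set z | z <= K]).
      by move=> x _; exact: norm_continuous.
    exact: closed_le.
  move=> /closure_id; rewrite /= => cK x /= xO; suff : [set x : E | `|x| <= K] x by [].
  by rewrite cK; apply: closureS xO => y Oy; exact: hN NK y Oy.
apply: measurable_bounded_integrable => //.
- exact: bounded_lebesgue_ltoo.
- by apply: measurable_funTS; exact: continuous_rV_measurable.
- have : compact (g @` closure Omega).
    by apply: continuous_compact => //; apply: continuous_subspaceT; exact: cg.
  move=> /compact_bounded[N [Nr hN]]; exists N; split => // K NK x /= Ox.
  by apply: (hN K NK); exists x => //; exact: subset_closure.
Qed.

Definition is_L2 (g : E -> R) : Prop :=
  measurable_fun Omega g /\ leb.-integrable Omega (EFin \o (fun x => g x ^+ 2)).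

Lemma is_L2_inL2 g : inL2 leb Omega g -> is_L2 g.
Proof.
by move=> h; split; [exact: inL2_measurable h|exact: inL2_integrable_sqr].
Qed.

Lemma is_L2_continuous g : continuous g -> is_L2 g.
Proof.
move=> cg; split; first by apply: measurable_funTS; exact: continuous_rV_measurable.
exact: (integrable_domain (continuous_mulf cg cg)).
Qed.

Lemma is_L2_mul g h : is_L2 g -> is_L2 h -> leb.-integrable Omega (EFin \o (fun x => g x * h x)).
Proof. by move=> [mg ig] [mh ih]; exact: integrable_mulL2. Qed.

Lemma is_L2_sub g h : is_L2 g -> is_L2 h -> is_L2 (fun x => g x - h x).
Proof.
move=> gL hL; split; first exact: measurable_funB gL.1 hL.1.
have igh := is_L2_mul gL hL; have ig := gL.2; have ih := hL.2.
have i1 : leb.-integrable Omega (EFin \o (fun x => 2 * (g x * h x))).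
  by apply: eq_integrable (integrableZl mO 2 igh).
have i2 : leb.-integrable Omega (EFin \o (fun x => g x ^+ 2 - 2 * (g x * h x))).
  by apply: eq_integrable (integrableB mO ig i1).
have i3 : leb.-integrable Omega
    (EFin \o (fun x => g x ^+ 2 - 2 * (g x * h x) + h x ^+ 2)).
  by apply: eq_integrable (integrableD mO i2 ih).
apply: (eq_integrable mO _ _ _ i3) => x _ /=; congr EFin; rewrite !expr2; ring.
Qed.

(** The integral of (g + del h)^2 / del is nonnegative. When the squared norm of g is at most del^2,
    the lower bound is of order del. *)
Lemma mul_le_young g h (del : R) : 0 < del -> is_L2 g -> is_L2 h ->
  - (\int[leb]_(x in Omega) (g x ^+ 2) / del + del * \int[leb]_(x in Omega) (h x ^+ 2))
  <= 2 * \int[leb]_(x in Omega) (g x * h x).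
Proof.
move=> del0 gL hL.
have ig := gL.2; have ih := hL.2; have igh := is_L2_mul gL hL.
have i1 : leb.-integrable Omega (EFin \o (fun x => del^-1 * g x ^+ 2)).
  by apply: eq_integrable (integrableZl mO del^-1 ig).
have i2 : leb.-integrable Omega (EFin \o (fun x => del * h x ^+ 2)).
  by apply: eq_integrable (integrableZl mO del ih).
have i3 : leb.-integrable Omega (EFin \o (fun x => 2 * (g x * h x))).
  by apply: eq_integrable (integrableZl mO 2 igh).
have i12 : leb.-integrable Omega (EFin \o (fun x => del^-1 * g x ^+ 2 + del * h x ^+ 2)).
  by apply: eq_integrable (integrableD mO i1 i2).
rewrite lerNl -subr_ge0 opprK mulrC.
rewrite -(RintegralZl _ mO ig) -(RintegralZl _ mO ih) -(RintegralZl _ mO igh).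
rewrite -RintegralD// -RintegralD//.
apply: Rintegral_ge0 => x _.
rewrite (_ : _ + _ = del^-1 * (g x + del * h x) ^+ 2); last first.
  by rewrite !expr2; field; rewrite gt_eqF.
by rewrite mulr_ge0 ?sqr_ge0// invr_ge0 ltW.
Qed.

(** The difference of the two integrands is (del g + h)^2 / del. *)
Lemma sqr_sub_le g h (del : R) : 0 < del -> is_L2 g -> is_L2 h ->
  \int[leb]_(x in Omega) ((g x - h x) ^+ 2) <=
  (1 + del) * \int[leb]_(x in Omega) (g x ^+ 2)
  + (1 + del^-1) * \int[leb]_(x in Omega) (h x ^+ 2).
Proof.
move=> del0 gL hL.
have ig := gL.2; have ih := hL.2; have igh := (is_L2_sub gL hL).2.
have i1 : leb.-integrable Omega (EFin \o (fun x => (1 + del) * g x ^+ 2)).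
  by apply: eq_integrable (integrableZl mO (1 + del) ig).
have i2 : leb.-integrable Omega (EFin \o (fun x => (1 + del^-1) * h x ^+ 2)).
  by apply: eq_integrable (integrableZl mO (1 + del^-1) ih).
have i12 : leb.-integrable Omega
    (EFin \o (fun x => (1 + del) * g x ^+ 2 + (1 + del^-1) * h x ^+ 2)).
  by apply: eq_integrable (integrableD mO i1 i2).
rewrite -(RintegralZl _ mO ig) -(RintegralZl _ mO ih) -RintegralD//.
apply: le_Rintegral => // x _.
rewrite -subr_ge0 (_ : _ - _ = del^-1 * (del * g x + h x) ^+ 2); last first.
  by rewrite !expr2; field; rewrite gt_eqF.
by rewrite mulr_ge0 ?sqr_ge0// invr_ge0 ltW.
Qed.

Definition grad_pair (f : 'I_d -> E -> R) : 'I_d -> sobolev_pair R d :=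
  fun i => (f i, fun j => partial j (f i)).

Lemma test_function_approx (w : 'I_d -> sobolev_pair R d) (q : E -> R) (b : R) :
  V_space Omega w -> inL2 leb Omega q -> 0 <= b ->
  b * (seminormV Omega w * normL2 leb Omega q) < form_b Omega w q ->
  exists2 f : 'I_d -> E -> R, (forall i, test_function Omega (f i)) &
    b * (seminormV Omega (grad_pair f) * normL2 leb Omega q)
      < form_b Omega (grad_pair f) q.
Proof.
move=> wV qI b0 hw; have qL := is_L2_inL2 qI.
have wL i j : is_L2 ((w i).2 j) by apply: is_L2_inL2; have [[_ h _] _] := wV i; exact: h.
pose W := \sum_(i < d) \sum_(j < d) normL2 leb Omega ((w i).2 j) ^+ 2.
have W0 : 0 <= W by apply: sumr_ge0 => i _; apply: sumr_ge0 => j _; exact: sqr_ge0.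
pose Q2 := \int[leb]_(x in Omega) (q x ^+ 2).
have Q20 : 0 <= Q2 by apply: Rintegral_ge0 => x _; exact: sqr_ge0.
(* [C]: each component loses at most del (1 + Q2) / 2 by [mul_le_young]. [C']: by [sqr_sub_le], the
   factor 1 + del adds del W, and each component adds (1 + 1/del) del^2 <= 2 del. *)
pose C := d%:R * (1 + Q2) / 2; pose C' := W + d%:R * 2.
have C0 : 0 <= C by rewrite divr_ge0// mulr_ge0// addr_ge0.
have C'0 : 0 <= C' by rewrite addr_ge0// mulr_ge0.
have [del [del0 del1 H]] := strict_bound_stable b0 W0 (normL2_ge0 leb Omega q) C0 C'0 hw.
have exf i : exists f, test_function Omega f /\
    normH1 Omega ((w i).1 \- f, fun j => (w i).2 j \- partial j f) < del.
  by have [_ /(_ _ del0)[f tf hf]] := wV i; exists f.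
have [f hf] := choice exf.
exists f => [i|]; first by have [] := hf i.
have cp i j : continuous (partial j (f i)).
  by have [tf _] := hf i; exact: test_function_partial tf j.
have fL i j : is_L2 (partial j (f i)) by exact: is_L2_continuous (cp i j).
pose D i j x := (w i).2 j x - partial j (f i) x.
have DL i j : is_L2 (D i j) by exact: is_L2_sub (wL i j) (fL i j).
have sumD i : \sum_(j < d) \int[leb]_(x in Omega) (D i j x ^+ 2) <= del ^+ 2.
  have [_ /ltW] := hf i; rewrite /normH1 /= => h.
  have {}h : normL2 leb Omega ((w i).1 \- f i) ^+ 2
      + \sum_(j < d) normL2 leb Omega ((w i).2 j \- partial j (f i)) ^+ 2 <= del ^+ 2.
    rewrite -ler_sqrt ?sqr_ge0 ?exprn_gt0// sqrtr_sqr gtr0_norm//.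
  apply: le_trans h; apply: ler_wpDl; first exact: sqr_ge0.
  by apply: ler_sum => j _; rewrite sqr_normL2.
have D0 i j : 0 <= \int[leb]_(x in Omega) (D i j x ^+ 2).
  by apply: Rintegral_ge0 => x _; exact: sqr_ge0.
apply: H.
- have iD i : leb.-integrable Omega (EFin \o (fun x => D i i x * q x)).
    exact: is_L2_mul (DL i i) qL.
  have iw i : leb.-integrable Omega (EFin \o (fun x => (w i).2 i x * q x)).
    exact: is_L2_mul (wL i i) qL.
  have if_ i : leb.-integrable Omega (EFin \o (fun x => partial i (f i) x * q x)).
    exact: is_L2_mul (fL i i) qL.
  have -> : form_b Omega w q = - \sum_i \int[leb]_(x in Omega) ((w i).2 i x * q x).
    rewrite /form_b -(Rintegral_sum mO (index_enum _) xpredT iw); congr (- _).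
    by apply: eq_Rintegral => x _; rewrite mulr_suml.
  have -> : form_b Omega (grad_pair f) q =
      - \sum_i \int[leb]_(x in Omega) (partial i (f i) x * q x).
    rewrite /form_b -(Rintegral_sum mO (index_enum _) xpredT if_); congr (- _).
    by apply: eq_Rintegral => x _; rewrite mulr_suml.
  have DqE i : \int[leb]_(x in Omega) (partial i (f i) x * q x) =
      \int[leb]_(x in Omega) ((w i).2 i x * q x) - \int[leb]_(x in Omega) (D i i x * q x).
    rewrite -RintegralB//; apply: eq_Rintegral => x _; rewrite /D; ring.
  rewrite [X in _ <= - X](eq_bigr _ (fun i _ => DqE i)).
  rewrite sumrB opprB [leRHS]addrC lerD2l.
  have low i : - (del * (1 + Q2) / 2) <= \int[leb]_(x in Omega) (D i i x * q x).
    have Ni : \int[leb]_(x in Omega) (D i i x ^+ 2) / del <= del.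
      rewrite ler_pdivrMr// -expr2; apply: le_trans (sumD i).
      by rewrite [leRHS](bigD1 i)//= lerDl; apply: sumr_ge0.
    have := mul_le_young del0 (DL i i) qL; rewrite -/Q2.
    move: Ni; set x1 := _ / del; set x2 := Rintegral _ _ _.
    by clearbody x1 x2 => h1 h2; lra.
  rewrite (_ : - (C * del) = \sum_(i < d) - (del * (1 + Q2) / 2)).
    by apply: ler_sum => i _.
  rewrite sumr_const card_ord -[RHS]mulr_natl /C; ring.
- by apply: sumr_ge0 => i _; apply: sumr_ge0 => j _; exact: sqr_ge0.
- have up i : \sum_(j < d) normL2 leb Omega (partial j (f i)) ^+ 2 <=
      (1 + del) * \sum_(j < d) normL2 leb Omega ((w i).2 j) ^+ 2 + 2 * del.
    have h2 : (1 + del^-1) * \sum_(j < d) \int[leb]_(x in Omega) (D i j x ^+ 2) <= 2 * del.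
      have d1 : 0 <= 1 + del^-1 by rewrite addr_ge0// invr_ge0 ltW.
      apply: (le_trans (ler_wpM2l d1 (sumD i))).
      rewrite mulrDl mul1r expr2 mulrA mulVf ?gt_eqF// mul1r mulrDl !mul1r lerD2r.
      by rewrite ler_piMl// ltW.
    apply: le_trans (lerD (lexx _) h2); rewrite !mulr_sumr -big_split/=.
    apply: ler_sum => j _; rewrite !sqr_normL2.
    rewrite (@eq_Rintegral _ _ _ leb Omega (fun x => ((w i).2 j x - D i j x) ^+ 2)).
      exact: sqr_sub_le.
    by move=> x _; rewrite /D opprB addrC subrK.
  apply: (le_trans (ler_sum _ (fun i _ => up i))).
  rewrite big_split/= -mulr_sumr -/W sumr_const card_ord -[_ *+ d]mulr_natl /C'.
  by rewrite le_eqVlt; apply/orP; left; apply/eqP; ring.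
Qed.

End L2_perturbation.

Theorem lemma7 (R : realType) (d : nat) (Omega : set 'rV[R]_d)
  (M : mesh R d) (beta : R)
  (hd : d = 2%N \/ d = 3%N)
  (hOmega : polyhedral_domain Omega)
  (hM : conforming_mesh Omega M)
  (hbeta : 0 < beta)
  (hinfsup : (beta%:E <= infsup_b Omega)%E) :
  (beta%:E <= infsup_bh Omega M)%E.
Proof.
have d0 : (0 < d)%N by case: hd => ->.
apply: le_ereal_inf_tmp => _ [q [hq q0] <-].
set S := ereal_sup _.
suff key (b : R) : 0 <= b -> b < beta -> (b%:E <= S)%E.
  apply/lee_addgt0Pr => e e0.
  (* The maximum with 0 keeps b nonnegative when e exceeds beta. *)
  have b0 : 0 <= Num.max 0 (beta - e) by rewrite le_max lexx.
  have bb : Num.max 0 (beta - e) < beta by rewrite gt_max hbeta ltrBlDr ltrDl.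
  apply: (@le_trans _ _ ((Num.max 0 (beta - e))%:E + e%:E)%E); last first.
    by rewrite leeD2r// key.
  by rewrite -EFinD lee_fin -lerBlDr le_max lexx orbT.
move=> b0 bbeta.
have hsup : (b%:E < ereal_sup
    [set (form_b Omega w q / (seminormV Omega w * normL2 (lebesgue_rV R d) Omega q))%:E
      | w in [set w | V_space Omega w /\ V_nonzero Omega w]])%E.
  apply: (@lt_le_trans _ _ beta%:E); first by rewrite lte_fin.
  apply: le_trans hinfsup _; apply: ereal_inf_lbound; exists q => //.
  by split => //; case: hq.
have [_ [w [wV _] <-]] := ereal_sup_gt hsup; rewrite lte_fin => hw.
have Q0 : 0 <= normL2 (lebesgue_rV R d) Omega q by exact: normL2_ge0.
(* With a zero denominator the quotient would be 0 and could not exceed b >= 0. *)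
have nw : 0 < seminormV Omega w * normL2 (lebesgue_rV R d) Omega q.
  rewrite lt_neqAle mulr_ge0 ?sqrtr_ge0// andbT; apply: contraTneq hw => <-.
  by rewrite invr0 mulr0 -leNgt.
rewrite ltr_pdivlMr// in hw.
have [[qL2 _] _] := hq.
have [f tf hf] := test_function_approx hOmega wV qL2 b0 hw.
pose v i : broken M := @CR_interp R d M (f i).
have fE : form_bh Omega v q = form_b Omega (grad_pair f) q.
  exact: form_bh_CR_interp.
have vf : normV_CR Omega v <= seminormV Omega (grad_pair f).
  apply: ler_wsqrtr; apply: ler_sum => i _; exact: normX_CR_interp.
have fpos : 0 < form_bh Omega v q.
  by rewrite fE; apply: le_lt_trans hf; rewrite !mulr_ge0 ?sqrtr_ge0.
have Qpos : 0 < normL2 (lebesgue_rV R d) Omega q.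
  rewrite lt_neqAle Q0 andbT; apply: contraTneq nw => <-.
  by rewrite mulr0 ltxx.
(* The form is positive, so the discrete divergence is nonzero; this makes both the norm of [v] and
   [v] itself nonzero. *)
have npart : ~ (forall i T x, partial i (v i T) x = 0).
  by move=> /form_bh_partial0 h; move: fpos; rewrite h ?ltxx.
have vpos : 0 < normV_CR Omega v.
  rewrite lt_neqAle sqrtr_ge0 andbT; apply/eqP => v0; apply: npart => i T x.
  have n0 k : 0 <= normX_sqr Omega (v k).
    rewrite normX_CR_interpE//; apply: sumr_ge0 => T' _; apply: sumr_ge0 => j _.
    exact: sqr_ge0.
  apply: (normX_CR_interp_le0 d0 hOmega hM (tf i)).
  have : \sum_(k < d) normX_sqr Omega (v k) <= 0.
    by rewrite -sqrtr_eq0 -/(normV_CR Omega v) -v0.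
  by apply: le_trans; rewrite [leRHS](bigD1 i)//= lerDl; apply: sumr_ge0.
apply: (@le_trans _ _ (form_bh Omega v q /
    (normV_CR Omega v * normL2 (lebesgue_rV R d) Omega q))%:E); last first.
  apply: ereal_sup_ubound; exists v => //; split.
    by move=> i; exact: X_CR_interp.
  move=> v0; apply: npart => i T x; rewrite v0.
  by apply: (@derive_affine R d (fun=> 0) x _ 0) => s; rewrite mulr0 addr0.
rewrite lee_fin ler_pdivlMr ?mulr_gt0// fE; apply: le_trans (ltW hf).
by rewrite ler_wpM2l// ler_wpM2r.
Qed.
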